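(* Fix $y\in(0,1)$. Let $\{\mathcal{C}_n\}$ be a sequence of binary linear codes, $\mathcal{C}_n$ of length $n$ with dual distance $d_n^\bot$, and let $p_n$ be positive integers with $p_n/n=y$. Let $\widetilde{\Phi}_{\mathcal{C}_n}$ be the $p_n\times n$ random matrix whose rows are drawn independently and uniformly from $\mathcal{C}_n$ (entries $0,1$ regarded as real numbers), let $\widetilde{\mathcal{G}}_{\mathcal{C}_n}=\frac{4}{n}\widetilde{\Phi}_{\mathcal{C}_n}\widetilde{\Phi}_{\mathcal{C}_n}^T$, and let $\tilde{\mu}_{\mathcal{C}_n}=\frac{1}{p_n}\sum_{i=1}^{p_n}\delta_{\tilde{\lambda}_i}$ be its spectral measure, where $\tilde\lambda_1\ge\cdots\ge\tilde\lambda_{p_n}$ are the eigenvalues of $\widetilde{\mathcal{G}}_{\mathcal{C}_n}$. Assume $d_n^\bot\geq 5$ for all $n$. Then as $n\to\infty$, $$|\tilde{\mu}_{\mathcal{C}_n}(\mathbf{I})-\varrho_{\mathrm{MP}_y}(\mathbf{I})|\prec n^{-1/4}$$ uniformly for all intervals $\mathbf{I}\subset\mathbb{R}$; that is, for every $\varepsilon>0$ and $D>0$ there is $N=N(\varepsilon,D)$, independent of $\mathbf{I}$, such that for all $n>N$ and all intervals $\mathbf{I}\subset\mathbb{R}$, $$\mathbb{P}\left(|\tilde{\mu}_{\mathcal{C}_n}(\mathbf{I})-\varrho_{\mathrm{MP}_y}(\mathbf{I})|>n^{\varepsilon-1/4}\right)<n^{-D}.$$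
   Context: A binary linear code of length $n$ is a linear subspace $\mathcal{C}\subset\mathbb{F}_2^n$; its dual $\mathcal{C}^\bot$ is its orthogonal complement for the standard inner product on $\mathbb{F}_2^n$; the dual distance $d^\bot$ is the minimum Hamming distance of $\mathcal{C}^\bot$ (so $d^\bot\ge k$ means every nonzero codeword of $\mathcal{C}^\bot$ has Hamming weight at least $k$). The index $n$ ranges over those positive integers for which $p_n=yn$ is an integer. $\delta_z$ is the Dirac measure at $z$. $\varrho_{\mathrm{MP}_y}$ is the Marchenko-Pastur measure with parameter $y$: $\varrho_{\mathrm{MP}_y}(dx)=\frac{1}{2\pi xy}\sqrt{(x-a)(b-x)}\,\mathbf{1}_{[a,b]}(x)\,dx$ with $a=(1-\sqrt{y})^2$, $b=(1+\sqrt{y})^2$. *)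

(* Defs.v *)
From HB Require Import structures.
From mathcomp Require Import all_boot all_order all_algebra.
From mathcomp Require Import all_classical all_reals all_analysis.
From mathcomp Require polyrcf.
Export numFieldNormedType.Exports.

Set Implicit Arguments.
Unset Strict Implicit.
Unset Printing Implicit Defensive.

Import Order.TTheory GRing.Theory Num.Theory.
Local Open Scope classical_set_scope.
Local Open Scope ring_scope.

Definition dotF2 (n : nat) (u v : 'rV['F_2]_n) : 'F_2 :=
  \sum_(i < n) u 0 i * v 0 i.

Definition hamming_distance (n : nat) (u v : 'rV['F_2]_n) : nat :=
  #|[set i | u 0 i != v 0 i]%SET|.

Definition dual_code (n : nat) (C : {vspace 'rV['F_2]_n}) :
    {set 'rV['F_2]_n} :=
  [set v | [forall u in C, dotF2 u v == 0]]%SET.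

(* Extended-real valued: a code with a single word has minimum distance +oo. *)
Definition min_distance (R : realType) (n : nat) (D : {set 'rV['F_2]_n}) :
    \bar R :=
  ereal_inf [set d | exists u v : 'rV['F_2]_n,
    [/\ u \in D, v \in D, u != v & d = (hamming_distance u v)%:R%:E]].

Definition dual_distance (R : realType) (n : nat)
    (C : {vspace 'rV['F_2]_n}) : \bar R :=
  min_distance R (dual_code C).

(* Product rule over every subfamily; E is finite, so that all its subsets are
   events. *)
Definition mutually_independent (R : realType) (d : measure_display)
    (T : measurableType d) (P : probability T R) (I E : finType)
    (X : I -> T -> E) : Prop :=
  forall (J : {set I}) (A : I -> {set E}),
    P [set w | forall i, i \in J -> X i w \in A i] =
    (\prod_(i in J) P [set w | X i w \in A i])%E.

Definition uniform_on_code (R : realType) (d : measure_display)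
    (T : measurableType d) (P : probability T R) (n : nat)
    (C : {vspace 'rV['F_2]_n}) (X : T -> 'rV['F_2]_n) : Prop :=
  forall c : 'rV['F_2]_n,
    P [set w | X w = c] = ((c \in C)%:R / #|C|%:R)%:E.

Definition iid_uniform_rows (R : realType) (d : measure_display)
    (T : measurableType d) (P : probability T R) (m n : nat)
    (C : {vspace 'rV['F_2]_n}) (Phi : T -> 'M['F_2]_(m, n)) : Prop :=
  [/\ forall M : 'M['F_2]_(m, n), measurable [set w | Phi w = M],
      mutually_independent P (fun (i : 'I_m) w => row i (Phi w)) &
      forall i : 'I_m, uniform_on_code P C (fun w => row i (Phi w))].

Definition real_mx (R : realType) (m n : nat) (M : 'M['F_2]_(m, n)) :
    'M[R]_(m, n) :=
  map_mx (fun b : 'F_2 => (nat_of_ord b)%:R) M.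

Definition gram (R : realType) (m n : nat) (M : 'M['F_2]_(m, n)) : 'M[R]_m :=
  (4 / n%:R) *: (real_mx R M *m (real_mx R M)^T).

(* The real eigenvalues in nonincreasing order, each repeated according to its
   algebraic multiplicity; for a symmetric matrix these are all the
   eigenvalues. *)
Definition eigenvalues (R : realType) (m : nat) (A : 'M[R]_m) : seq R :=
  sort (fun x z => z <= x)
    (flatten [seq nseq (mup x (char_poly A)) x
             | x <- polyrcf.rootsR (char_poly A)]).

Definition spectral_measure (R : realType) (m : nat) (A : 'M[R]_m) :
    set R -> \bar R :=
  fun B => (m%:R^-1%:E * \sum_(l <- eigenvalues A) \d_l B)%E.

Definition mp_left (R : realType) (y : R) : R := (1 - Num.sqrt y) ^+ 2.

Definition mp_right (R : realType) (y : R) : R := (1 + Num.sqrt y) ^+ 2.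

Definition mp_density (R : realType) (y x : R) : R :=
  (2 * pi * x * y)^-1 * Num.sqrt ((x - mp_left y) * (mp_right y - x))
  * \1_(`[mp_left y, mp_right y]%classic) x.

Definition marchenko_pastur (R : realType) (y : R) (B : set R) : \bar R :=
  (\int[lebesgue_measure]_(x in B) (mp_density y x)%:E)%E.

Definition admissible_length (R : realType) (y : R) (n : nat) : Prop :=
  (0 < n)%N /\ y * n%:R \is a Num.int.

(* Main.v *)
(* Passing from the 0-1 matrix [Phi] to the sign matrix [X = J - 2 Phi] changes
   the Gram matrix by rank two, hence every eigenvalue count by at most two.
   Dual distance at least 5 makes the entries of a row of [X] four-wise
   independent, which suffices for the variance bound [2 |B|^2] of a quadratic
   form in a row.  Removing one row at a time (Sherman-Morrison), this gives for
   the mean [s] of the normalized trace of [(X^T X / n - z)^-1] the equation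
   [z s^2 + (z + 1 - y) s + 1 = O(1 / (n v^2))], where [v = Im z]; bounded
   differences replace the mean of the square by the square of the mean.  Take
   [v = n^(-1/3)].  For real [E] in the bulk the quadratic at [z = E] has
   conjugate roots, whose imaginary parts are [pi y] times the
   Marchenko-Pastur density up to sign; as [Im s >= 0], [s] stays away from the
   lower root, so it is close to the upper one, within [n^(-1/4)] at distance
   [n^(-1/6)] from the edges.  Hence the mean spectral measure, smoothed by a
   Cauchy kernel of width [v], is within [n^(-1/4)] of the limit; no mass can
   be missing near the edges because the limit has total mass 1.  The density
   bound also shows that smoothing moves little mass.  Finally the counting
   function changes by [O(1/n)] when one row changes, so it is exponentially
   concentrated around its mean. *)

Require Import Defs.
From HB Require Import structures.
From mathcomp Require Import all_boot all_order all_algebra.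
From mathcomp Require Import all_classical all_reals all_analysis.
From mathcomp Require Import measurable_realfun complex ring lra.
From mathcomp Require polyrcf spectral.

Set Implicit Arguments.
Unset Strict Implicit.
Unset Printing Implicit Defensive.

Import Order.TTheory GRing.Theory Num.Theory.
Import numFieldNormedType.Exports.
Import ComplexField.
Local Open Scope classical_set_scope.
Local Open Scope ring_scope.

Local Notation Re := complex.Re.
Local Notation Im := complex.Im.

(** * Averages over finite product spaces *)

(** The rows are modelled as a uniform point of the finite product [{ffun 'I_p -> codeword V}], so
    expectations are finite averages [avg]; the given probability enters only at the end, when the
    law of [Phi] is read off. The equation is derived for the [n x n] matrix [X^T X / n], for which
    replacing a row is a rank-one operation; its [n - p] extra zero eigenvalues produce the term
    [(1 - y) / z], subtracted afterwards. Two obstacles shape the estimates. Dividing by [1 + s]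
    would call for a lower bound on [|1 + s|]; instead the variance of the quadratic form is bounded
    by a multiple of [|1 + s|], which cancels the division. And the density is controlled only in
    the bulk and only after smoothing. Undoing the smoothing costs a factor [ln (1 / v)]; since
    [v = u^4] and the target error is [u^3], with [u = n^(-1/12)], even [ln (1 / v) <= 4 / u] is
    good enough. Distribution functions are compared through the mean value theorem and an explicit
    primitive of the limiting density. The constants depend on [y] alone, not on the code or the
    interval. *)

Section Average.
Variables (F : numFieldType) (T : finType).
Implicit Types f g : T -> F.

Definition avg f : F := #|T|%:R^-1 * \sum_t f t.

Lemma eq_avg f g : f =1 g -> avg f = avg g.
Proof. by move=> fg; rewrite /avg; under eq_bigr do rewrite fg. Qed.

Lemma avgD f g : avg (fun t => f t + g t) = avg f + avg g.
Proof. by rewrite /avg big_split/= mulrDr. Qed.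

Lemma avgZ c f : avg (fun t => c * f t) = c * avg f.
Proof. by rewrite /avg -mulr_sumr mulrCA. Qed.

Lemma avgN f : avg (fun t => - f t) = - avg f.
Proof. by rewrite /avg sumrN mulrN. Qed.

Lemma avgB f g : avg (fun t => f t - g t) = avg f - avg g.
Proof. by rewrite avgD avgN. Qed.

Lemma avg_sum (J : Type) (s : seq J) (Q : pred J) (h : J -> T -> F) :
  avg (fun t => \sum_(j <- s | Q j) h j t) = \sum_(j <- s | Q j) avg (h j).
Proof. by rewrite /avg exchange_big -mulr_sumr. Qed.

Lemma avg_cst c : (0 < #|T|)%N -> avg (fun=> c) = c.
Proof.
move=> T0; rewrite /avg sumr_const -[c *+ _]mulr_natl mulrA mulVf ?mul1r//.
by rewrite pnatr_eq0 -lt0n.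
Qed.

Lemma le_avg f g : (forall t, f t <= g t) -> avg f <= avg g.
Proof. by move=> fg; rewrite ler_wpM2l ?invr_ge0//; apply: ler_sum. Qed.

Lemma avg_ge0 f : (forall t, 0 <= f t) -> 0 <= avg f.
Proof. by move=> f0; rewrite mulr_ge0 ?invr_ge0// sumr_ge0. Qed.

Lemma avg_inj_invol (p : T -> T) f : involutive p -> avg (f \o p) = avg f.
Proof.
move=> pK; rewrite /avg; congr (_ * _).
by rewrite [RHS](reindex p)//; exists p => ? _; exact: pK.
Qed.

End Average.

Lemma avg_pair (F : numFieldType) (S T : finType) (f : S -> T -> F) :
  avg (fun st : S * T => f st.1 st.2) = avg (fun s => avg (f s)).
Proof.
rewrite /avg card_prod natrM invfM -mulrA -mulr_sumr; congr (_ * (_ * _)).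
by rewrite pair_bigA.
Qed.

(** * Conditional averages and bounded differences on a finite product *)

Section Product.
Variables (I K : finType).
Local Notation Omega := {ffun I -> K}.

Definition upd (w : Omega) (i : I) (k : K) : Omega :=
  [ffun j => if j == i then k else w j].

Lemma upd_id w i : upd w i (w i) = w.
Proof. by apply/ffunP => j; rewrite ffunE; case: eqP => // ->. Qed.

Lemma upd_upd w i k l : upd (upd w i k) i l = upd w i l.
Proof. by apply/ffunP => j; rewrite !ffunE; case: eqP. Qed.

Lemma updC w i j k l : i != j -> upd (upd w i k) j l = upd (upd w j l) i k.
Proof.
move=> ij; apply/ffunP => u; rewrite !ffunE.
by case: eqP => // ->; rewrite eq_sym (negPf ij).
Qed.

Lemma upd_same w i k : upd w i k i = k.
Proof. by rewrite ffunE eqxx. Qed.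

Section Marginal.
Variable F : numFieldType.
Implicit Types f g : Omega -> F.

(** The conditional expectation given all coordinates but [i], kept as a function on the whole
    product. *)
Definition cavg i f : Omega -> F := fun w => avg (fun k => f (upd w i k)).

Definition indep_of i f := forall w k, f (upd w i k) = f w.

Lemma cavg_indep i f : indep_of i (cavg i f).
Proof. by move=> w k; apply: eq_avg => l; rewrite upd_upd. Qed.

Lemma cavg_indepM i f g : (0 < #|K|)%N -> indep_of i g ->
  cavg i (fun w => g w * f w) =1 (fun w => g w * cavg i f w).
Proof.
move=> K0 gi w; rewrite /cavg -avgZ; apply: eq_avg => k.
by rewrite gi.
Qed.

(** Tower rule. The involution [p] trades coordinate [i] of the sample for the fresh value [k], so
    [f (upd w i k)] and [f w] have the same average over the pairs [(w, k)]. *)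
Lemma avg_cavg i f : (0 < #|K|)%N -> avg (cavg i f) = avg f.
Proof.
move=> K0; rewrite /cavg -(avg_pair (fun w k => f (upd w i k))).
pose p (wk : Omega * K) := (upd wk.1 i wk.2, wk.1 i).
have pK : involutive p.
  by move=> [w k]; rewrite /p/= upd_upd upd_same upd_id.
rewrite -(avg_inj_invol _ pK) /p/=.
under eq_avg do rewrite /= upd_upd upd_id.
rewrite (avg_pair (fun w _ => f w)).
by apply: eq_avg => w; rewrite avg_cst.
Qed.


Lemma indep_of_cavg i j f : indep_of i f -> indep_of i (cavg j f).
Proof.
move=> fi; have [<-|ij] := eqVneq i j; first exact: cavg_indep.
by move=> w k; apply: eq_avg => l; rewrite updC// fi.
Qed.

Definition bounded_diff (c : F) f :=
  forall i w k, `|f w - f (upd w i k)| <= c.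

Lemma norm_avg (T : finType) (f : T -> F) : `|avg f| <= avg (fun t => `|f t|).
Proof.
rewrite /avg normrM ger0_norm ?invr_ge0// ler_wpM2l ?invr_ge0//.
exact: ler_norm_sum.
Qed.

Lemma norm_avg_le (T : finType) (f : T -> F) c :
  (0 < #|T|)%N -> (forall t, `|f t| <= c) -> `|avg f| <= c.
Proof.
move=> T0 fc; apply: le_trans (norm_avg f) _.
by rewrite -[leRHS](avg_cst c T0) le_avg.
Qed.

Lemma bounded_diff_cavg c f i w : (0 < #|K|)%N -> bounded_diff c f ->
  `|f w - cavg i f w| <= c.
Proof.
move=> K0 fc; rewrite -[X in X - _](avg_cst (f w) K0) -avgB.
exact: norm_avg_le.
Qed.

Lemma cavg_bounded_diff c f j : (0 < #|K|)%N ->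
  bounded_diff c f -> bounded_diff c (cavg j f).
Proof.
move=> K0 fc i w k; have [<-|ij] := eqVneq i j.
  by rewrite cavg_indep subrr normr0 (le_trans _ (fc i w k)).
rewrite -avgB; apply: norm_avg_le => // l.
by rewrite (updC w k l ij).
Qed.

Definition cavgs (s : seq I) f := foldl (fun g i => cavg i g) f s.

Lemma cavgs_indep s f i : indep_of i f \/ i \in s -> indep_of i (cavgs s f).
Proof.
elim: s f => [|j s IH] f/=; first by case.
rewrite inE => -[fi|/orP[/eqP ij|si]]; refine (IH (cavg j f) _).
- by left; exact: indep_of_cavg.
- by left; rewrite ij; exact: cavg_indep.
- by right.
Qed.

Lemma indep_of_all f : (forall i, indep_of i f) -> forall w w', f w = f w'.
Proof.
(* [u s] is [w] overwritten by [w'] at the coordinates in [s]; no overwriting changes [f], and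
   [u (enum I)] is [w']. *)
move=> fi w w'; pose u s := foldr (fun i v => upd v i (w' i)) w s.
have fu s : f (u s) = f w by elim: s => //= i s <-; rewrite fi.
rewrite -(fu (enum I)); congr f; apply/ffunP => i.
have : i \in enum I by rewrite mem_enum.
elim: (enum I) => //= j s IH; rewrite inE ffunE.
by case: eqP => [->//|_ /=]; exact: IH.
Qed.

Lemma avg_cavgs s f : (0 < #|K|)%N -> avg (cavgs s f) = avg f.
Proof.
by move=> K0; elim: s f => //= i s IH f; rewrite IH avg_cavg.
Qed.

Lemma cavgs_enum f w : (0 < #|K|)%N -> cavgs (enum I) f w = avg f.
Proof.
move=> K0; rewrite -(avg_cavgs (enum I))//.
have fi i : indep_of i (cavgs (enum I) f).
  by apply: cavgs_indep; right; rewrite mem_enum.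
rewrite (eq_avg (fun w' => indep_of_all fi w' w)) avg_cst//.
by rewrite card_ffun expn_gt0 K0.
Qed.

(** Pythagoras: [f - cavg i f] is orthogonal to every function that ignores coordinate [i]. *)
Lemma avg_sqr_cavg i f : (0 < #|K|)%N -> avg (fun w => f w ^+ 2) =
  avg (fun w => cavg i f w ^+ 2) + avg (fun w => (f w - cavg i f w) ^+ 2).
Proof.
move=> K0.
have cross : avg (fun w => cavg i f w * f w) = avg (fun w => cavg i f w ^+ 2).
  rewrite -(avg_cavg i)//; apply: eq_avg => w.
  by rewrite (cavg_indepM f K0 (cavg_indep i f)) expr2.
rewrite -avgD.
rewrite [RHS](eq_avg (g := fun w => (2 * cavg i f w ^+ 2 +
  (- 2) * (cavg i f w * f w)) + f w ^+ 2)); last by move=> w; ring.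
by rewrite !avgD !avgZ cross mulNr subrr add0r.
Qed.

(** Coordinates are averaged out one by one, and each orthogonal increment contributes at most
    [c ^+ 2]. For complex [f] the square is not a squared modulus: this is the error made when the
    mean of the squared trace is replaced by the square of its mean. *)
Lemma bounded_diff_variance c f : (0 < #|K|)%N -> bounded_diff c f ->
  `|avg (fun w => f w ^+ 2) - avg f ^+ 2| <= #|I|%:R * c ^+ 2.
Proof.
move=> K0 fc; have Om0 : (0 < #|{: Omega}|)%N by rewrite card_ffun expn_gt0 K0.
have -> : avg f ^+ 2 = avg (fun w => cavgs (enum I) f w ^+ 2).
  by rewrite -[LHS](avg_cst _ Om0); apply: eq_avg => w; rewrite cavgs_enum.
rewrite cardT; elim: (enum I) f fc => [|i s IH] f fc /=.
  by rewrite subrr normr0 mul0r.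
rewrite (avg_sqr_cavg i)// addrAC mulrS mulrDl mul1r [leRHS]addrC.
rewrite (le_trans (ler_normD _ _))// lerD//.
  exact/IH/cavg_bounded_diff.
apply: norm_avg_le => // w; rewrite normrX.
by apply: lerXn2r; rewrite ?nnegrE ?bounded_diff_cavg// (le_trans _ (fc i w (w i))).
Qed.

End Marginal.

(** * Exponential concentration from bounded differences *)

Section Concentration.
Variable R : realType.
Implicit Types f : Omega -> R.

(** From [expR (- x) >= 1 - x] comes [expR x <= 1 / (1 - x)], and [(1 - x) (1 + x + 2 x^2) = 1 + x^2
    (1 - 2 x)]. *)
Lemma expR_le_quad (x : R) : x <= 2^-1 -> expR x <= 1 + x + 2 * x ^+ 2.
Proof.
move=> xle; have x1 : 0 < 1 - x by lra.
have : expR x <= (1 - x)^-1.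
  rewrite -[expR x]invrK -expRN lef_pV2 ?posrE ?expR_gt0//.
  exact: expR_ge1Dx.
move/le_trans; apply; rewrite -div1r ler_pdivrMr//; nra.
Qed.

(** Given the other coordinates, the deviation from [cavg i f] has mean zero, so the linear term of
    [expR_le_quad] averages out and only the quadratic one is paid for. *)
Lemma avg_expR_cavg (t c : R) i f : (0 < #|K|)%N -> 0 <= t -> t * c <= 2^-1 ->
  bounded_diff c f ->
  avg (fun w => expR (t * f w)) <=
  expR (2 * (t * c) ^+ 2) * avg (fun w => expR (t * cavg i f w)).
Proof.
move=> K0 t0 tc fc; rewrite -avgZ -(avg_cavg i)//; apply: le_avg => w.
rewrite /cavg -/(cavg i f w).
have -> : avg (fun k => expR (t * f (upd w i k))) = expR (t * cavg i f w) *
    avg (fun k => expR (t * (f (upd w i k) - cavg i f w))).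
  by rewrite -avgZ; apply: eq_avg => k; rewrite -expRD; congr expR; ring.
rewrite mulrC ler_pM2r ?expR_gt0//.
have /le_avg/le_trans : forall k : K,
    expR (t * (f (upd w i k) - cavg i f w)) <=
    (1 + 2 * (t * c) ^+ 2) + t * (f (upd w i k) - cavg i f w).
  move=> k; set x := f _ - _.
  have xc : `|x| <= c by rewrite /x -(cavg_indep i f w k) bounded_diff_cavg.
  have tx : `|t * x| <= t * c by rewrite normrM ger0_norm// ler_wpM2l.
  have := tx; rewrite ler_norml => /andP[tx1 tx2].
  apply: le_trans (expR_le_quad (le_trans tx2 tc)) _.
  have : (t * x) ^+ 2 <= (t * c) ^+ 2 by nra.
  lra.
apply; rewrite avgD avgZ avgB !avg_cst//.
rewrite -/(cavg i f w) subrr mulr0 addr0; exact: expR_ge1Dx.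
Qed.

Lemma avg_expR_le (t c : R) f : (0 < #|K|)%N -> 0 <= t -> t * c <= 2^-1 ->
  bounded_diff c f ->
  avg (fun w => expR (t * f w)) <=
  expR (2 * #|I|%:R * (t * c) ^+ 2) * expR (t * avg f).
Proof.
move=> K0 t0 tc fc.
have Om0 : (0 < #|{: Omega}|)%N by rewrite card_ffun expn_gt0 K0.
have -> : expR (t * avg f) = avg (fun w => expR (t * cavgs (enum I) f w)).
  by rewrite -[LHS](avg_cst _ Om0); apply: eq_avg => w; rewrite cavgs_enum.
rewrite cardT; elim: (enum I) f fc => [|i s IH] f fc /=.
  by rewrite mulr0 mul0r expR0 mul1r.
apply: le_trans (avg_expR_cavg i K0 t0 tc fc) _.
have -> : 2 * (size s).+1%:R * (t * c) ^+ 2 =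
    2 * (t * c) ^+ 2 + 2 * (size s)%:R * (t * c) ^+ 2.
  by rewrite -[(size s).+1%:R]natr1; ring.
rewrite expRD -mulrA ler_pM2l ?expR_gt0//.
exact/IH/cavg_bounded_diff.
Qed.

(** Chernoff's bound for [f] and for [- f], whence the factor 2; the choice of [t] is left to the
    caller. *)
Lemma concentration (t c s : R) f : (0 < #|K|)%N -> 0 <= t -> t * c <= 2^-1 ->
  bounded_diff c f ->
  avg (fun w => (s < `|f w - avg f|)%R%:R) <=
  2 * expR (2 * #|I|%:R * (t * c) ^+ 2 - t * s).
Proof.
move=> K0 t0 tc fc.
have up (g : Omega -> R) : bounded_diff c g ->
    avg (fun w => (s < g w - avg g)%R%:R) <=
    expR (2 * #|I|%:R * (t * c) ^+ 2 - t * s).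
  move=> gc; apply: (@le_trans _ _ (avg (fun w =>
      expR (- t * s - t * avg g) * expR (t * g w)))).
    apply: le_avg => w; rewrite -expRD; case: ltP => sg; last exact: expR_ge0.
    rewrite -[leLHS]expR0 ler_expR; nra.
  rewrite avgZ.
  apply: (le_trans (ler_wpM2l (expR_ge0 _) (avg_expR_le K0 t0 tc gc))).
  by rewrite -!expRD ler_expR; lra.
have fcN : bounded_diff c (fun w => - f w).
  by move=> i w k; rewrite -opprD normrN.
rewrite mulr_natl mulr2n; apply: le_trans (lerD (up _ fc) (up _ fcN)).
rewrite -avgD; apply: le_avg => w; rewrite avgN -opprD.
case: (ltP s `|_|) => [|_]; last by rewrite addr_ge0.
rewrite ltr_normr => /orP[] ->; first by rewrite lerDl.
by rewrite lerDr.
Qed.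

End Concentration.

End Product.

(** * Resolvents *)

Section ComplexModulus.
Variable R : realType.
Local Notation C := R[i].
Local Notation nc := (@Normc.normc R).
Local Notation toC := (real_complex R).
Implicit Types x y z : C.

Lemma nc_ge0 z : 0 <= nc z.
Proof. by case: z => a b; exact: sqrtr_ge0. Qed.

Lemma ncE z : `|z| = toC (nc z).
Proof. by case: z => a b; rewrite normc_def. Qed.

Lemma nc_sqr z : nc z ^+ 2 = Re z ^+ 2 + Im z ^+ 2.
Proof. by case: z => a b; rewrite sqr_sqrtr// addr_ge0 ?sqr_ge0. Qed.

Lemma ncM x y : nc (x * y) = nc x * nc y.
Proof. exact: Normc.normcM. Qed.

Lemma ncV x : nc x^-1 = (nc x)^-1.
Proof. exact: Normc.normcV. Qed.

Lemma ncN x : nc (- x) = nc x.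
Proof. by case: x => a b /=; rewrite !sqrrN. Qed.

Lemma ncD x y : nc (x + y) <= nc x + nc y.
Proof. by rewrite -lecR rmorphD/= -!ncE; exact: ler_normD. Qed.

Lemma ncB x y : nc (x - y) <= nc x + nc y.
Proof. by rewrite -(ncN y); exact: ncD. Qed.

Lemma nc_real (a : R) : nc (toC a) = `|a|.
Proof. by rewrite /= expr0n addr0 sqrtr_sqr. Qed.

Lemma nc0 : nc 0 = 0.
Proof. by rewrite -[0]/(toC 0) nc_real normr0. Qed.

Lemma nc1 : nc 1 = 1.
Proof. by rewrite -[1]/(toC 1) nc_real normr1. Qed.

Lemma ncX x k : nc (x ^+ k) = nc x ^+ k.
Proof. by elim: k => [|k IH]; rewrite ?expr0 ?nc1// !exprS ncM IH. Qed.

Lemma nc_eq0 x : (nc x == 0) = (x == 0).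
Proof.
by rewrite -[RHS]normr_eq0 ncE -[0 : C]/(toC 0) (inj_eq (@complexI _)).
Qed.

Lemma nc_gt0 x : (0 < nc x) = (x != 0).
Proof. by rewrite lt_def nc_eq0 nc_ge0 andbT. Qed.

Lemma Im_le_nc z : `|Im z| <= nc z.
Proof.
rewrite -(@ler_pXn2r _ 2)// ?nnegrE ?nc_ge0// nc_sqr real_normK ?num_real//.
by rewrite lerDr sqr_ge0.
Qed.

Lemma Re_le_nc z : `|Re z| <= nc z.
Proof.
rewrite -(@ler_pXn2r _ 2)// ?nnegrE ?nc_ge0// nc_sqr real_normK ?num_real//.
by rewrite lerDl sqr_ge0.
Qed.

Lemma nc_sum (J : Type) (s : seq J) (P : pred J) (f : J -> C) :
  nc (\sum_(j <- s | P j) f j) <= \sum_(j <- s | P j) nc (f j).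
Proof.
elim/big_ind2: _ => [|x a y b xa yb|//]; first by rewrite nc0.
exact: le_trans (ncD _ _) (lerD xa yb).
Qed.

Lemma ImD x y : Im (x + y) = Im x + Im y.
Proof. by case: x y => [a b] [c d]. Qed.

Lemma ImN x : Im (- x) = - Im x. Proof. by case: x. Qed.

Lemma ImM x y : Im (x * y) = Re x * Im y + Im x * Re y.
Proof. by case: x y => [a b] [c d]. Qed.

Lemma Im_sum (J : Type) (s : seq J) (P : pred J) (f : J -> C) :
  Im (\sum_(j <- s | P j) f j) = \sum_(j <- s | P j) Im (f j).
Proof. by elim/big_ind2: _ => // x a y b <- <-; rewrite ImD. Qed.

Lemma ImMr (a : R) z : Im (toC a * z) = a * Im z.
Proof. by rewrite ImM/= mul0r addr0. Qed.

Lemma mul_conj_nc z : z * conjc z = toC (nc z ^+ 2).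
Proof. by rewrite rmorphXn/= -ncE sqr_normc. Qed.

Lemma nc_conj z : nc (conjc z) = nc z.
Proof. by case: z => a b /=; rewrite sqrrN. Qed.

Lemma Im_conj z : Im (conjc z) = - Im z. Proof. by case: z. Qed.

Lemma conjMr z (a : R) : conjc (z * toC a) = conjc z * toC a.
Proof. by rewrite rmorphM/= oppr0. Qed.

Lemma toC_sum (J : Type) (s : seq J) (P : pred J) (f : J -> R) :
  toC (\sum_(j <- s | P j) f j) = \sum_(j <- s | P j) toC (f j).
Proof. exact: raddf_sum. Qed.

Lemma nc_avg (T : finType) (f : T -> C) : nc (avg f) <= avg (fun t => nc (f t)).
Proof.
rewrite /avg ncM ncV -[X in nc X](rmorph_nat (real_complex R)) nc_real ger0_norm//.
by rewrite ler_wpM2l ?invr_ge0// nc_sum.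
Qed.

Lemma toC_avg (T : finType) (f : T -> R) : toC (avg f) = avg (fun t => toC (f t)).
Proof. by rewrite /avg rmorphM/= fmorphV rmorph_nat toC_sum. Qed.

Lemma Im_avg (T : finType) (f : T -> C) : Im (avg f) = avg (fun t => Im (f t)).
Proof.
by rewrite /avg -[X in X^-1 * _](rmorph_nat (real_complex R)) -fmorphV ImMr Im_sum.
Qed.

End ComplexModulus.

Section Resolvent.
Variable R : realType.
Local Notation C := R[i].
Local Notation nc := (@Normc.normc R).
Local Notation toC := (real_complex R).

Definition cmx m n (A : 'M[R]_(m, n)) : 'M[C]_(m, n) := map_mx toC A.

Definition resolvent n (A : 'M[R]_n) (z : C) : 'M[C]_n :=
  invmx (cmx A - z%:M).

Variables (m n : nat) (c : R) (X : 'M[R]_(m, n)) (z : C).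
Hypotheses (c0 : 0 <= c) (z0 : 0 < Im z).
Let A := c *: (X^T *m X).
Let G := resolvent A z.

Let cmx_form (u : 'rV[C]_n) :
  (u *m cmx A *m (map_mx conjc u)^T) 0 0 =
  toC (c * \sum_k nc ((u *m (cmx X)^T) 0 k) ^+ 2).
Proof.
rewrite /A /cmx map_mxZ/= map_mxM/= -scalemxAr -scalemxAl mulmxA.
rewrite -[X in _ *: X]mulmxA -map_trmx mxE mxE rmorphM/=; congr (_ * _).
rewrite toC_sum; apply: eq_bigr => k _; rewrite -mul_conj_nc; congr (_ * _).
rewrite !mxE rmorph_sum/=; apply: eq_bigr => j _.
by rewrite !mxE rmorphM/= mulrC oppr0.
Qed.

Let row_norm (u : 'rV[C]_n) :
  (u *m (map_mx conjc u)^T) 0 0 = toC (\sum_k nc (u 0 k) ^+ 2).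
Proof.
by rewrite mxE toC_sum; apply: eq_bigr => k _; rewrite !mxE mul_conj_nc.
Qed.

(** If [u (A - z) = 0], then taking the imaginary part of [u (A - z) u^*], where [u A u^*] is real,
    leaves [Im z |u|^2 = 0]. *)
Lemma resolvent_unit : cmx A - z%:M \in unitmx.
Proof.
rewrite -row_free_unit; apply: inj_row_free => u uM.
have : (u *m (cmx A - z%:M) *m (map_mx conjc u)^T) 0 0 = 0.
  by rewrite uM mul0mx mxE.
rewrite mulmxBr mulmxBl mul_mx_scalar -scalemxAl mxE cmx_form mxE mxE row_norm.
move/(congr1 (@Im R)); rewrite ImD ImN/= [z * _]mulrC ImMr add0r => /eqP.
rewrite oppr_eq0 mulf_eq0 [Im z == 0]gt_eqF// orbF psumr_eq0; last first.
  by move=> k _; exact: sqr_ge0.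
move/allP => u0; apply/rowP => k; rewrite mxE; apply/eqP.
by rewrite -nc_eq0 -sqrf_eq0; apply: u0; rewrite mem_index_enum.
Qed.

Lemma cmx_sym : (cmx A)^T = cmx A.
Proof. by rewrite /cmx map_trmx /A linearZ/= trmx_mul trmxK. Qed.

Lemma resolvent_sym : G^T = G.
Proof. by rewrite /G trmx_inv linearB/= tr_scalar_mx cmx_sym. Qed.

(* [x = u (A - z)] with [u = x G], and [x] is its own conjugate, so that
   [x G x^T = u (A - conj z) u^*]. *)
Lemma resolvent_form (x : 'rV[R]_n) : exists2 a : R, 0 <= a &
  (cmx x *m G *m (cmx x)^T) 0 0 =
  toC a - conjc z * toC (\sum_k nc ((cmx x *m G) 0 k) ^+ 2).
Proof.
set u := cmx x *m G.
have xu : cmx x = u *m (cmx A - z%:M) by rewrite mulmxKV// resolvent_unit.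
exists (c * \sum_k nc ((u *m (cmx X)^T) 0 k) ^+ 2).
  by rewrite mulr_ge0// sumr_ge0// => k _; exact: sqr_ge0.
have -> : (cmx x)^T = (cmx A - (conjc z)%:M) *m (map_mx conjc u)^T.
  rewrite -[X in X *m _]trmxK -trmx_mul; congr trmx.
  have -> : cmx x = map_mx conjc (cmx x).
    by apply/matrixP => i j; rewrite !mxE conjc_real.
  rewrite xu map_mxM/=; congr (_ *m _).
  rewrite map_mxD map_mxN map_scalar_mx linearB/= tr_scalar_mx cmx_sym.
  by congr (_ - _); apply/matrixP => i j; rewrite !mxE conjc_real.
rewrite mulmxA mulmxBr mulmxBl mul_mx_scalar -scalemxAl mxE cmx_form.
by rewrite mxE mxE row_norm.
Qed.

(** The preceding identity summed over the basis vectors. It is used in two ways: its imaginary part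
    is the Ward identity, [Im z] times the sum of the [|G j k|^2]; multiplied by [z] its last term
    becomes real, so [Im (z tr G) = a Im z >= 0]. *)
Lemma resolvent_trace : exists2 a : R, 0 <= a &
  \tr G = toC a - conjc z * toC (\sum_j \sum_k nc (G j k) ^+ 2).
Proof.
have H (j : 'I_n) : {a : R | 0 <= a &
    G j j = toC a - conjc z * toC (\sum_k nc (G j k) ^+ 2)}.
  apply: cid2; have [a a0 E] := resolvent_form (delta_mx 0 j); exists a => //.
  have dG : cmx (delta_mx 0 j) *m G = row j G.
    by rewrite /cmx map_delta_mx -rowE.
  move: E; rewrite dG; under eq_bigr do rewrite mxE.
  move=> <-; rewrite /cmx map_delta_mx trmx_delta -colE.
  by rewrite !mxE.
exists (\sum_j s2val (H j)); first by apply: sumr_ge0 => j _; case: (H j).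
rewrite !toC_sum mulr_sumr -sumrB; apply: eq_bigr => j _.
exact: (s2valP' (H j)).
Qed.

End Resolvent.

(** * Rank-one updates of the resolvent *)

Section RankOne.
Variable R : realType.
Local Notation C := R[i].
Local Notation nc := (@Normc.normc R).
Local Notation toC := (real_complex R).
Variables (m m' n : nat) (c : R) (X : 'M[R]_(m, n)) (X' : 'M[R]_(m', n)).
Variables (x : 'rV[R]_n) (z : C).
Hypotheses (c0 : 0 <= c) (z0 : 0 < Im z).
Let A := c *: (X^T *m X).
Let A' := c *: (X'^T *m X').
Hypothesis AE : A' = A + c *: (x^T *m x).
Let G := resolvent A z.
Let G' := resolvent A' z.

Definition qform n (x : 'rV[R]_n) (B : 'M[C]_n) : C :=
  (cmx x *m B *m (cmx x)^T) 0 0.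

Let q := toC c * qform x G.
Let r := toC c * qform x G'.

Let scal (B : 'M[C]_n) :
  cmx x *m B *m (toC c *: ((cmx x)^T *m cmx x)) =
  (toC c * qform x B) *: cmx x.
Proof.
rewrite -scalemxAr mulmxA [_ *m _ *m (cmx x)^T]mx11_scalar mul_scalar_mx.
by rewrite scalerA.
Qed.

Let AEc : cmx A' - z%:M = cmx A - z%:M + toC c *: ((cmx x)^T *m cmx x).
Proof.
rewrite AE /cmx map_mxD addrAC; congr (_ + _).
by rewrite map_mxZ/= map_mxM/= map_trmx.
Qed.

Let GE : G - G' = G *m (toC c *: ((cmx x)^T *m cmx x)) *m G'.
Proof.
rewrite -[toC c *: _](addKr (cmx A - z%:M)) -AEc.
rewrite mulmxDr mulmxDl mulmxN mulVmx ?resolvent_unit// mulNmx mul1mx.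
by rewrite -mulmxA mulmxV ?resolvent_unit// mulmx1 addrC.
Qed.

Let row1 : cmx x *m G = (1 + q) *: (cmx x *m G').
Proof.
have /(congr1 (fun B => cmx x *m B)) := GE.
rewrite !mulmxA scal mulmxBr -scalemxAl => /eqP.
by rewrite subr_eq addrC => /eqP ->; rewrite scalerDl scale1r.
Qed.

(** Sherman-Morrison in scalar form: the resolvent identity [GE], multiplied by [x] on the left and
    by its transpose on the right. It also shows that [1 + q] cannot vanish. *)
Lemma rank1_mul : (1 - r) * (1 + q) = 1.
Proof.
suff qr : q = (1 + q) * r by rewrite mulrC mulrBr -qr mulr1 addrK.
by rewrite {1}/q /qform row1 -scalemxAl mxE mulrCA.
Qed.

Let q1_neq0 : 1 + q != 0.
Proof.
by apply: contra_eq_neq rank1_mul => ->; rewrite mulr0 eq_sym oner_eq0.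
Qed.

Lemma rank1_inv : 1 - r = (1 + q)^-1.
Proof. by rewrite -[LHS](mulfK q1_neq0) rank1_mul mul1r. Qed.

Lemma rank1_row : cmx x *m G' = (1 - r) *: (cmx x *m G).
Proof. by rewrite rank1_inv row1 scalerA mulVf ?scale1r. Qed.

Lemma Im_zq_ge0 : 0 <= Im (z * q).
Proof.
have [a a0 E] := resolvent_form X c0 z0 x.
rewrite /q /qform E mulrCA ImMr mulr_ge0// mulrBr ImD ImN.
rewrite mulrA mul_conj_nc -rmorphM/= subr0 [z * _]mulrC ImMr.
by rewrite mulr_ge0// ltW.
Qed.

(** [|z| |1 + q| >= Im (z (1 + q)) >= Im z], since [Im (z q) >= 0]. *)
Lemma rank1_norm : nc (1 - r) <= nc z / Im z.
Proof.
have z_neq0 : z != 0 by apply: contraTneq z0 => ->; rewrite ltxx.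
rewrite rank1_inv ncV -[leRHS]invrK lef_pV2 ?posrE ?invr_gt0 ?divr_gt0//;
  rewrite ?nc_gt0//.
rewrite invf_div ler_pdivrMr ?nc_gt0// -ncM mulrC.
apply: le_trans (Im_le_nc _); rewrite mulrDr mulr1 ImD.
by rewrite (le_trans _ (ler_norm _))// lerDl Im_zq_ge0.
Qed.

(** The difference of traces is [c (1 - r)] times the sum of the squares of the entries of [x G]. By
    the identity for the quadratic form, [c Im z] times the sum of their squared moduli is
    [Im q <= |1 + q|], and [|1 - r| |1 + q| = 1]. *)
Lemma rank1_trace : nc (\tr G - \tr G') <= (Im z)^-1.
Proof.
rewrite -linearB/= GE.
have -> : \tr (G *m (toC c *: ((cmx x)^T *m cmx x)) *m G') =
    toC c * (1 - r) * \sum_k ((cmx x *m G) 0 k) ^+ 2.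
  rewrite -scalemxAr -scalemxAl linearZ/= -mulrA; congr (_ * _).
  rewrite mulmxA -[X in \tr X]mulmxA mxtrace_mulC rank1_row -scalemxAl linearZ/=.
  congr (_ * _); rewrite trace_mx11 mxE; apply: eq_bigr => k _.
  rewrite expr2; congr (_ * _).
  have Gs : G^T = G := resolvent_sym c X z.
  by rewrite -[G in LHS]Gs -trmx_mul mxE.
have [a a0 E] := resolvent_form X c0 z0 x.
have Imq : Im q = c * (Im z * \sum_k nc ((cmx x *m G) 0 k) ^+ 2).
  rewrite /q /qform E ImMr ImD ImN [conjc z * _]mulrC ImMr/= add0r.
  by rewrite Im_conj -/A -/G; ring.
rewrite !ncM nc_real ger0_norm//.
have sum_le : nc (\sum_k ((cmx x *m G) 0 k) ^+ 2) <=
    \sum_k nc ((cmx x *m G) 0 k) ^+ 2.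
  by apply: le_trans (nc_sum _ _ _) _; apply: ler_sum => k _; rewrite ncX.
have q_le := le_trans (ler_norm _) (Im_le_nc (1 + q)).
have r1 : nc (1 - r) * nc (1 + q) = 1 by rewrite -ncM rank1_mul nc1.
rewrite -[leRHS]div1r ler_pdivlMr// -r1.
move: q_le; rewrite ImD/= add0r Imq => /(ler_wpM2l (nc_ge0 (1 - r))).
apply: le_trans.
rewrite [leRHS](_ : _ = c * nc (1 - r) * Im z *
  \sum_k nc ((cmx x *m G) 0 k) ^+ 2); last by ring.
rewrite mulrAC ler_wpM2l// !mulr_ge0 ?nc_ge0//; exact: ltW.
Qed.

End RankOne.

Section ResolventBound.
Variable R : realType.
Local Notation C := R[i].
Local Notation nc := (@Normc.normc R).
Local Notation toC := (real_complex R).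
Variables (m n : nat) (c : R) (X : 'M[R]_(m, n)) (z : C).
Hypotheses (c0 : 0 <= c) (z0 : 0 < Im z) (n0 : (0 < n)%N).
Let G := resolvent (c *: (X^T *m X)) z.

(** The left side is the variance bound of a normalized quadratic form. The point is the factor
    [|1 + tr G / n|] on the right: it later cancels a division by the same quantity, for which no
    lower bound is available. *)
Lemma resolvent_variance :
  2 / n%:R ^+ 2 * (\sum_j \sum_k nc (G j k) ^+ 2) <=
  (4 + 2 / nc z) / (n%:R * Im z) * nc (1 + toC n%:R^-1 * \tr G).
Proof.
have z_neq0 : z != 0 by apply: contraTneq z0 => ->; rewrite ltxx.
have zp : 0 < nc z by rewrite nc_gt0.
have np : 0 < n%:R :> R by rewrite ltr0n.
have [a a0 E] := resolvent_trace X c0 z0.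
rewrite -/G in E; set b := \sum_j _ in E *.
have Imz : Im z + Im z * a / n%:R <= nc z * nc (1 + toC n%:R^-1 * \tr G).
  rewrite -ncM; apply: le_trans (Im_le_nc _).
  rewrite (le_trans _ (ler_norm _))// mulrDr mulr1 ImD lerD2l mulrCA ImMr E.
  rewrite mulrBr ImD ImN mulrA mul_conj_nc -rmorphM/= subr0 [z * _]mulrC ImMr.
  by rewrite le_eqVlt; apply/orP; left; apply/eqP; field; rewrite gt_eqF.
(* The arithmetic-geometric mean inequality on each diagonal entry, weighted so that half of
   [nc z * b] can be absorbed once [zb] is known. *)
have tr_le : nc (\tr G) <= n%:R / (2 * nc z) + nc z / 2 * b.
  apply: le_trans (nc_sum _ _ _) _.
  have -> : n%:R / (2 * nc z) = \sum_(j < n) (2 * nc z)^-1.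
    by rewrite sumr_const card_ord mulr_natl.
  rewrite mulr_sumr -big_split/=; apply: ler_sum => j _.
  apply: (@le_trans _ _ ((2 * nc z)^-1 + nc z / 2 * nc (G j j) ^+ 2)).
    rewrite -subr_ge0 (_ : _ - _ = (nc z)^-1 / 2 * (nc z * nc (G j j) - 1) ^+ 2).
      by rewrite mulr_ge0 ?sqr_ge0// mulr_ge0// invr_ge0 nc_ge0.
    by field; rewrite gt_eqF.
  rewrite lerD2l ler_wpM2l ?divr_ge0 ?nc_ge0// (bigD1 j)//= lerDl.
  by apply: sumr_ge0 => k _; exact: sqr_ge0.
have b0 : 0 <= b by do 2![apply: sumr_ge0 => ? _]; exact: sqr_ge0.
have zb : nc z * b <= a + nc (\tr G).
  have -> : nc z * b = nc (conjc z * toC b) by rewrite ncM nc_conj nc_real ger0_norm.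
  have -> : conjc z * toC b = toC a - \tr G by rewrite E opprB addrC subrK.
  by apply: le_trans (ncB _ _) _; rewrite nc_real ger0_norm.
have {tr_le zb} b_le : b <= 2 * a / nc z + n%:R / nc z ^+ 2.
  have : nc z * b <= 2 * a + n%:R / nc z.
    have -> : n%:R / nc z = 2 * (n%:R / (2 * nc z)) by field; rewrite gt_eqF.
    by lra.
  rewrite mulrC -ler_pdivlMr// => /le_trans; apply.
  by rewrite le_eqVlt; apply/orP; left; apply/eqP; field; rewrite gt_eqF.
apply: (@le_trans _ _ ((4 + 2 / nc z) / (n%:R * Im z) *
    ((Im z + Im z * a / n%:R) / nc z))); last first.
  rewrite ler_wpM2l//; last by rewrite ler_pdivrMr// [leRHS]mulrC.
  by rewrite divr_ge0 ?addr_ge0 ?divr_ge0 ?mulr_ge0 ?nc_ge0// ltW.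
apply: (@le_trans _ _ (2 / n%:R ^+ 2 * (2 * a / nc z + n%:R / nc z ^+ 2))).
  by rewrite ler_wpM2l// divr_ge0// exprn_ge0.
rewrite -subr_ge0 (_ : _ - _ = 4 / (n%:R * nc z) + 2 * a / (n%:R * nc z) ^+ 2).
  by rewrite addr_ge0 ?divr_ge0 ?mulr_ge0 ?nc_ge0 ?sqr_ge0.
by field; rewrite !gt_eqF.
Qed.

End ResolventBound.

(** * The self-consistent equation for the mean trace *)

Section SelfConsistent.
Variable R : realType.
Local Notation C := R[i].
Local Notation nc := (@Normc.normc R).
Local Notation toC := (real_complex R).

(** This is all that the self-consistent equation uses about the law of a row. [B] ranges over
    symmetric, not Hermitian, matrices: resolvents of real symmetric matrices are of this kind. *)
Definition isotropic (K : finType) n (xi : K -> 'rV[R]_n) :=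
  forall B : 'M[C]_n, B^T = B ->
    avg (fun k => qform (xi k) B) = \tr B /\
    avg (fun k => nc (qform (xi k) B - \tr B) ^+ 2) <=
      2 * \sum_j \sum_k nc (B j k) ^+ 2.

Variables (p n : nat) (K : finType) (xi : K -> 'rV[R]_n) (z : C).
Hypotheses (n0 : (0 < n)%N) (K0 : (0 < #|K|)%N) (z0 : 0 < Im z).
Hypothesis xiP : isotropic xi.
Local Notation Omega := {ffun 'I_p -> K}.
Implicit Types w : Omega.

Definition sample w : 'M[R]_(p, n) := \matrix_i xi (w i).
(** The row is zeroed rather than deleted: the matrix keeps its size, and a zero row adds nothing to
    [X^T X]. *)
Definition sample_del i w : 'M[R]_(p, n) :=
  \matrix_j (if j == i then 0 else xi (w j)).

Definition cov m (X : 'M[R]_(m, n)) : 'M[R]_n := n%:R^-1 *: (X^T *m X).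

Definition ctrace (w : Omega) : C :=
  toC n%:R^-1 * \tr (resolvent (cov (sample w)) z).

Let G w := resolvent (cov (sample w)) z.
Let Gd i w := resolvent (cov (sample_del i w)) z.
Let sd i w : C := toC n%:R^-1 * \tr (Gd i w).
Let r i w : C := toC n%:R^-1 * qform (xi (w i)) (G w).
Let q i w : C := toC n%:R^-1 * qform (xi (w i)) (Gd i w).

Let cov_del i w : cov (sample w) =
  cov (sample_del i w) + n%:R^-1 *: ((xi (w i))^T *m xi (w i)).
Proof.
rewrite /cov -scalerDr; congr (_ *: _); apply/matrixP => a b.
rewrite !mxE [LHS](bigD1 i)//= [X in _ = X + _](bigD1 i)//= !mxE eqxx.
rewrite mxE mul0r add0r addrC; congr (_ + _); last by rewrite big_ord1 !mxE.
by apply: eq_bigr => j /negPf ji; rewrite !mxE ji.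
Qed.

Let nV0 : 0 <= n%:R^-1 :> R. Proof. by rewrite invr_ge0. Qed.

Let r_le i w : nc (1 - r i w) <= nc z / Im z := rank1_norm nV0 z0 (cov_del i w).

Let s_le i w : nc (sd i w - ctrace w) <= (n%:R * Im z)^-1.
Proof.
rewrite /sd /ctrace -mulrBr ncM nc_real ger0_norm// invfM ler_wpM2l//.
exact: rank1_trace nV0 z0 (cov_del i w).
Qed.

Let Gd_upd i w k : Gd i (upd w i k) = Gd i w.
Proof.
rewrite /Gd; congr (resolvent (cov _) _); apply/matrixP => a b; rewrite !mxE ffunE.
by case: eqP.
Qed.

Let Gd_sym i w : (Gd i w)^T = Gd i w.
Proof. exact: resolvent_sym. Qed.

(** The [r i w] sum to the trace of [A G = 1 + z G] with [A = X^T X / n]. This closes the equation: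
    the sum over the rows is again expressed by [ctrace]. *)
Lemma sum_1r w : \sum_i (1 - r i w) =
  p%:R - n%:R - z * n%:R * ctrace w.
Proof.
rewrite sumrB sumr_const card_ord -addrA -opprD; congr (_ - _).
have np : n%:R != 0 :> R by rewrite pnatr_eq0 -lt0n.
have np' : n%:R != 0 :> C by rewrite pnatr_eq0 -lt0n.
have -> : n%:R + z * n%:R * ctrace w = \tr (cmx (cov (sample w)) *m G w).
  have -> : cmx (cov (sample w)) *m G w = 1%:M + z *: G w.
    rewrite -(mulmxV (resolvent_unit n%:R^-1 (sample w) z0)) -/(cov _).
    by rewrite -mul_scalar_mx -mulmxDl subrK.
  rewrite linearD linearZ/= mxtrace1 /ctrace fmorphV rmorph_nat.
  by congr (_ + _); rewrite mulrA mulfK.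
rewrite /cov /cmx map_mxZ/= map_mxM/= -scalemxAl linearZ/= -mulmxA mxtrace_mulC.
rewrite mulr_sumr; apply: eq_bigr => i _; congr (_ * _).
have -> : xi (w i) = row i (sample w) by apply/rowP => j; rewrite !mxE.
rewrite /qform -map_trmx !mxE; apply: eq_bigr => j _; rewrite !mxE; congr (_ * _).
by apply: eq_bigr => k _; rewrite !mxE.
Qed.

Let z_gt0 : 0 < nc z.
Proof. by rewrite nc_gt0; apply: contraTneq z0 => ->; rewrite ltxx. Qed.

Let np : 0 < n%:R :> R. Proof. by rewrite ltr0n. Qed.

Let sd_neq0 i w : 1 + sd i w != 0.
Proof.
have [a a0 E] := resolvent_trace (sample_del i w) nV0 z0.
apply/negP => /eqP/(congr1 (fun u => Im (z * u))).
rewrite mulr0 mulrDr mulr1 ImD mulrCA ImMr -/(Gd i w) E.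
rewrite mulrBr ImD ImN mulrA mul_conj_nc -rmorphM/= subr0 [z * _]mulrC ImMr.
by apply/eqP; rewrite gt_eqF// ltr_wpDr// !mulr_ge0// ltW.
Qed.

(** With [t = sd - q] and [1 - r = 1 / (1 + q)], the averaged quantity is
    [t / (1 + sd) + (1 - r) t^2 / (1 + sd)]. Given the other rows the first term has mean zero. In
    the second, [|1 - r| <= |z| / Im z], and [resolvent_variance] bounds the mean of [|t|^2] by a
    multiple of [|1 + sd|]. *)
Let key i : nc (avg (fun w => (1 - r i w) * (1 + sd i w)) - 1) <=
  (4 * nc z + 2) / (n%:R * Im z ^+ 2).
Proof.
set e := (4 * nc z + 2) / _.
have Om0 : (0 < #|{: Omega}|)%N by rewrite card_ffun expn_gt0 K0.
rewrite -[X in _ - X](avg_cst 1 Om0) -avgB -(avg_cavg i)//.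
apply: le_trans (nc_avg _) _; rewrite -[leRHS](avg_cst _ Om0).
apply: le_avg => w; rewrite /cavg.
pose t k := sd i w - toC n%:R^-1 * qform (xi k) (Gd i w).
have decomp k : (1 - r i (upd w i k)) * (1 + sd i (upd w i k)) - 1 =
    (1 + sd i w)^-1 * t k +
    (1 - r i (upd w i k)) * (t k ^+ 2 / (1 + sd i w)).
  have := rank1_mul z0 (cov_del i (upd w i k)).
  rewrite -/(cov _) -/(G _) -/(r i _) -/(Gd i _) Gd_upd.
  have -> : sd i (upd w i k) = sd i w by rewrite /sd Gd_upd.
  rewrite upd_same; set q' := _ * qform _ (Gd i w); set r' := 1 - r _ _ => E.
  have q1 : 1 + q' != 0.
    by apply: contra_eq_neq E => ->; rewrite mulr0 eq_sym oner_eq0.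
  have -> : r' = (1 + q')^-1 by rewrite -[LHS](mulfK q1) E mul1r.
  by rewrite /t -/q'; field; rewrite q1 sd_neq0.
have [mean var] := xiP (Gd_sym i w).
rewrite (eq_avg decomp) avgD avgZ avgB avg_cst// avgZ mean.
rewrite subrr mulr0 add0r; apply: le_trans (nc_avg _) _.
pose c1 := nc z / Im z / nc (1 + sd i w).
have c1_ge0 : 0 <= c1 by rewrite !divr_ge0 ?nc_ge0// ltW.
apply: (@le_trans _ _ (avg (fun k => c1 * n%:R^-1 ^+ 2 *
    nc (qform (xi k) (Gd i w) - \tr (Gd i w)) ^+ 2))).
  apply: le_avg => k; rewrite ncM [nc (_ / _)]ncM ncX ncV.
  have -> : nc (t k) ^+ 2 =
      n%:R^-1 ^+ 2 * nc (qform (xi k) (Gd i w) - \tr (Gd i w)) ^+ 2.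
    rewrite /t /sd -mulrBr ncM exprMn nc_real ger0_norm//.
    by rewrite -opprB ncN.
  rewrite [leRHS](_ : _ = nc z / Im z *
    (n%:R^-1 ^+ 2 * nc (qform (xi k) (Gd i w) - \tr (Gd i w)) ^+ 2 /
     nc (1 + sd i w))); last by rewrite /c1; ring.
  by rewrite ler_wpM2r ?r_le// divr_ge0 ?nc_ge0// mulr_ge0 ?exprn_ge0 ?nc_ge0.
rewrite avgZ.
apply: le_trans (ler_wpM2l _ var) _; first by rewrite mulr_ge0 ?exprn_ge0.
have := resolvent_variance (sample_del i w) nV0 z0 n0.
rewrite -/(cov _) -/(Gd i w) -/(sd i w) => /(ler_wpM2l c1_ge0).
rewrite (_ : c1 * (2 / n%:R ^+ 2 * _) = c1 * n%:R^-1 ^+ 2 *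
  (2 * \sum_j \sum_k nc (Gd i w j k) ^+ 2)); last first.
  by rewrite exprVn; ring.
move/le_trans; apply.
rewrite le_eqVlt /c1 /e; apply/orP; left; apply/eqP.
by field; rewrite !gt_eqF// nc_gt0 sd_neq0.
Qed.

Lemma ctrace_bounded_diff :
  bounded_diff (toC (2 / (n%:R * Im z))) ctrace.
Proof.
move=> i w k; rewrite ncE lecR.
have -> : ctrace w - ctrace (upd w i k) =
    (sd i (upd w i k) - ctrace (upd w i k)) - (sd i w - ctrace w).
  by rewrite /sd Gd_upd; ring.
apply: le_trans (ncB _ _) _; rewrite mulr_natl mulr2n; exact: lerD.
Qed.

(** By [sum_1r], the sum over [i] of [(1 - r_i) (1 + ctrace) - 1], divided by [n], is minus the
    quadratic. Of the constant 9, 4 comes from [key], 1 from replacing the trace without row [i] by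
    the full trace, and 4 from the bounded-difference error
    [p (2 / (n Im z))^2 = 4 y / (n Im z^2)]. *)
Lemma self_consistent (y := p%:R / n%:R : R) (s := avg ctrace) :
  nc (z * s ^+ 2 + (z + 1 - toC y) * s + 1) <=
  y * ((9 * nc z + 2) / (n%:R * Im z ^+ 2)).
Proof.
have Om0 : (0 < #|{: Omega}|)%N by rewrite card_ffun expn_gt0 K0.
have yE : toC y = toC n%:R^-1 * p%:R by rewrite rmorphM/= mulrC rmorph_nat.
set e1 := (4 * nc z + 2) / (n%:R * Im z ^+ 2).
have termE i : nc (avg (fun w => (1 - r i w) * (1 + ctrace w)) - 1) <=
    (5 * nc z + 2) / (n%:R * Im z ^+ 2).
  have -> : avg (fun w => (1 - r i w) * (1 + ctrace w)) - 1 =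
      (avg (fun w => (1 - r i w) * (1 + sd i w)) - 1) -
      avg (fun w => (1 - r i w) * (sd i w - ctrace w)).
    rewrite addrAC -avgB; congr (_ - _); apply: eq_avg => w; ring.
  apply: le_trans (ncB _ _) _.
  have -> : (5 * nc z + 2) / (n%:R * Im z ^+ 2) =
      e1 + nc z / Im z * (n%:R * Im z)^-1 by rewrite /e1; field; rewrite !gt_eqF.
  apply: lerD; first exact: key.
  apply: le_trans (nc_avg _) _; rewrite -[leRHS](avg_cst _ Om0).
  apply: le_avg => w; rewrite ncM; apply: ler_pM; rewrite ?nc_ge0//.
have main : nc (avg (fun w => z * ctrace w ^+ 2 +
    (z + 1 - toC y) * ctrace w + 1)) <=
    y * ((5 * nc z + 2) / (n%:R * Im z ^+ 2)).
  have -> : avg (fun w => z * ctrace w ^+ 2 + (z + 1 - toC y) * ctrace w + 1) =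
      - (toC n%:R^-1 * \sum_i
        (avg (fun w => (1 - r i w) * (1 + ctrace w)) - 1)).
    rewrite sumrB mulrBr -avg_sum -avgZ sumr_const card_ord -yE opprB.
    rewrite -[X in _ = X - _](avg_cst _ Om0) -avgB; apply: eq_avg => w.
    rewrite -mulr_suml sum_1r yE rmorphV ?unitfE ?gt_eqF// rmorph_nat; field.
    by rewrite pnatr_eq0 -lt0n.
  rewrite ncN ncM nc_real ger0_norm//.
  set B := (_ / _); have -> : y * B = n%:R^-1 * (p%:R * B) by rewrite /y; ring.
  rewrite ler_wpM2l//.
  apply: le_trans (nc_sum _ _ _) _.
  rewrite mulrC mulr_natr -[in leRHS](card_ord p) -sumr_const.
  by apply: ler_sum.
have var : nc (avg (fun w => ctrace w ^+ 2) - s ^+ 2) <=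
    4 * y / (n%:R * Im z ^+ 2).
  have := bounded_diff_variance K0 ctrace_bounded_diff.
  rewrite ncE card_ord -rmorphXn/= -[p%:R](rmorph_nat (real_complex R)).
  rewrite -rmorphM lecR => /le_trans; apply.
  rewrite le_eqVlt /y; apply/orP; left; apply/eqP; field.
  by rewrite !gt_eqF.
have -> : z * s ^+ 2 + (z + 1 - toC y) * s + 1 =
    avg (fun w => z * ctrace w ^+ 2 + (z + 1 - toC y) * ctrace w + 1) -
    z * (avg (fun w => ctrace w ^+ 2) - s ^+ 2).
  rewrite !avgD (avgZ z) (avgZ (z + 1 - toC y)) avg_cst// -[avg (fun w => ctrace w)]/s.
  by ring.
apply: le_trans (ncB _ _) _; rewrite ncM.
have -> : y * ((9 * nc z + 2) / (n%:R * Im z ^+ 2)) =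
    y * ((5 * nc z + 2) / (n%:R * Im z ^+ 2)) +
    nc z * (4 * y / (n%:R * Im z ^+ 2)).
  by field; rewrite !gt_eqF.
by apply: lerD => //; rewrite ler_wpM2l ?nc_ge0.
Qed.

Lemma Im_avg_ctrace_ge0 : 0 <= Im (avg ctrace).
Proof.
rewrite Im_avg; apply: avg_ge0 => w.
have [a a0 E] := resolvent_trace (sample w) nV0 z0.
rewrite /ctrace ImMr mulr_ge0// E ImD ImN [conjc z * _]mulrC ImMr/= add0r.
by rewrite Im_conj mulrN opprK mulr_ge0 ?(ltW z0)//;
  do 2![apply: sumr_ge0 => ? _]; exact: sqr_ge0.
Qed.

End SelfConsistent.

(** * Spectra of symmetric matrices *)

Section Spectrum.
Variable R : realType.
Local Notation C := R[i].
Local Notation nc := (@Normc.normc R).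
Local Notation toC := (real_complex R).

Definition cadj m n (P : 'M[C]_(m, n)) : 'M[C]_(n, m) := (map_mx conjc P)^T.

Lemma cadjK m n (P : 'M[C]_(m, n)) : cadj (cadj P) = P.
Proof. by apply/matrixP => i j; rewrite !mxE conjcK. Qed.

Lemma cadjM m n p (P : 'M[C]_(m, n)) (Q : 'M[C]_(n, p)) :
  cadj (P *m Q) = cadj Q *m cadj P.
Proof. by rewrite /cadj map_mxM trmx_mul. Qed.

Definition diagonalizes n (A : 'M[R]_n) (P : 'M[C]_n) (D : 'rV[R]_n) :=
  [/\ P *m cadj P = 1%:M, cadj P *m P = 1%:M &
      cmx A = cadj P *m diag_mx (cmx D) *m P].

Lemma diagonalization n (A : 'M[R]_n) : A^T = A -> exists P D, diagonalizes A P D.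
Proof.
move=> As.
have Areal : cmx A \is a spectral.realmx.
  by apply/mxOverP => i j; rewrite mxE complex_real.
have Asym : cmx A \is sesquilinear.symmetricmx.
  by apply/sesquilinear.is_hermitianmxP; rewrite expr0 scale1r map_mx_id// /cmx map_trmx As.
have Ah := spectral.realsym_hermsym Asym Areal.
have An := spectral.hermitian_normalmx Ah.
have E := elimT (@spectral.orthomx_spectralP _ _ _) An.
have PU := spectral.spectral_unitarymx (cmx A).
have /mxOverP Dreal := spectral.hermitian_spectral_diag_real Ah.
set P := spectral.spectralmx _ in E PU; set d := spectral.spectral_diag _ in E Dreal.
have PV : invmx P = cadj P by rewrite (spectral.invmx_unitary PU) /cadj map_trmx.
exists P, (map_mx (@complex.Re R) d); split.
- by rewrite -PV mulmxV// spectral.spectral_unit.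
- by rewrite -PV mulVmx// spectral.spectral_unit.
- rewrite E PV; congr (_ *m diag_mx _ *m _); apply/rowP => j; rewrite !mxE.
  by rewrite RRe_real.
Qed.

Section Diagonalized.
Variables (n : nat) (A : 'M[R]_n) (P : 'M[C]_n) (D : 'rV[R]_n).
Hypothesis AD : diagonalizes A P D.

Lemma char_poly_diagonalized : char_poly A = \prod_i ('X - (D 0 i)%:P).
Proof.
have [PP PP' E] := AD.
apply: (map_poly_inj (real_complex R)); rewrite -[LHS]/(map_poly toC _) map_char_poly.
rewrite -/(cmx A) E rmorph_prod/=.
transitivity (char_poly (diag_mx (cmx D))).
  rewrite /char_poly /char_poly_mx.
  have -> : 'X%:M - map_mx polyC (cadj P *m diag_mx (cmx D) *m P) =
      map_mx polyC (cadj P) *m ('X%:M - map_mx polyC (diag_mx (cmx D))) *m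
      map_mx polyC P.
    rewrite mulmxBr mulmxBl !map_mxM/=; congr (_ - _).
    by rewrite scalar_mxC -mulmxA -map_mxM PP' map_mx1 mulmx1.
  rewrite !det_mulmx mulrAC -det_mulmx -map_mxM PP' map_mx1 det1 mul1r//.
rewrite char_poly_trig ?diag_mx_is_trig//; apply: eq_bigr => i _.
by rewrite !mxE eqxx mulr1n rmorphB/= map_polyX map_polyC.
Qed.

(** In both lists the number of occurrences of [x] is the multiplicity of [x] as a root of the
    characteristic polynomial. *)
Lemma eigenvalues_diagonalized :
  perm_eq (eigenvalues A) [seq D 0 i | i <- enum 'I_n].
Proof.
rewrite /eigenvalues perm_sort; apply/allP => /= x _; apply/eqP.
have E : char_poly A = \prod_(u <- [seq D 0 i | i <- enum 'I_n]) ('X - u%:P).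
  by rewrite big_map big_enum char_poly_diagonalized.
rewrite -[RHS]mu_prod_XsubC -E; set f := char_poly A.
have f0 : f != 0 by rewrite monic_neq0// char_poly_monic.
rewrite count_flatten -map_comp sumnE big_map.
under eq_bigr do rewrite /= count_nseq/=.
have [xr|xNr] := boolP (x \in polyrcf.rootsR f).
  rewrite (bigD1_seq x)//= ?polyrcf.uniq_roots// eqxx mul1n big1 ?addn0// => u.
  by move=> /negPf ->.
rewrite big1_seq => [|u /andP[_ ur]]; last first.
  by case: eqP => // ux; rewrite -ux ur in xNr.
rewrite mupNroot//; apply: contra xNr => xf.
by have := polyrcf.roots_on_rootsR f0 x; rewrite /= xf => <-.
Qed.

Lemma count_eigenvalues (a : pred R) :
  count a (eigenvalues A) = #|[set i | a (D 0 i)]|%SET.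
Proof.
rewrite (permP eigenvalues_diagonalized) -sum1_count big_map -sum1_card.
by rewrite big_enum_cond/=; apply: eq_bigl => i; rewrite inE.
Qed.

Lemma sum_eigenvalues (T : nmodType) (f : R -> T) :
  \sum_(l <- eigenvalues A) f l = \sum_i f (D 0 i).
Proof. by rewrite (perm_big _ eigenvalues_diagonalized) big_map big_enum. Qed.

Lemma resolvent_trace_eigenvalues z : Im z != 0 ->
  \tr (resolvent A z) = \sum_(l <- eigenvalues A) (toC l - z)^-1.
Proof.
move=> z0; rewrite sum_eigenvalues; have [PP PP' E] := AD.
have Dz i : toC (D 0 i) - z != 0.
  apply: contra z0 => /eqP/(congr1 (@complex.Im R)); rewrite ImD ImN/= add0r => /eqP.
  by rewrite oppr_eq0.
pose d := \row_i (toC (D 0 i) - z)^-1.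
have -> : resolvent A z = cadj P *m diag_mx d *m P.
  have H : (cmx A - z%:M) *m (cadj P *m diag_mx d *m P) = 1%:M.
    have -> : cmx A - z%:M = cadj P *m diag_mx (cmx D - const_mx z) *m P.
      rewrite linearB/= diag_const_mx mulmxBr mulmxBl -E; congr (_ - _).
      by rewrite scalar_mxC -mulmxA PP' mulmx1.
    rewrite !mulmxA -[X in X *m diag_mx d]mulmxA PP mulmx1.
    rewrite -[X in X *m P]mulmxA mulmx_diag.
    suff -> : diag_mx (\row_j ((cmx D - const_mx z) 0 j * d 0 j)) = 1%:M.
      by rewrite mulmx1.
    apply/matrixP => i j; rewrite !mxE divff ?Dz//.
  have U : cmx A - z%:M \in unitmx by case/mulmx1_unit: H.
  by rewrite -[RHS](mulKmx U) H mulmx1.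
rewrite mxtrace_mulC mulmxA PP mul1mx mxtrace_diag.
by apply: eq_bigr => i _; rewrite !mxE.
Qed.

Lemma quadratic_form_diagonalized (u : 'rV[C]_n) :
  (u *m cmx A *m cadj u) 0 0 =
  toC (\sum_i D 0 i * nc ((u *m cadj P) 0 i) ^+ 2).
Proof.
have [_ _ ->] := AD; rewrite !mulmxA -mulmxA.
have -> : P *m cadj u = cadj (u *m cadj P).
  by rewrite cadjM cadjK.
rewrite mul_mx_diag mxE toC_sum; apply: eq_bigr => i _.
by rewrite !mxE -mulrA mulrCA mul_conj_nc -rmorphM.
Qed.

Lemma norm_diagonalized (u : 'rV[C]_n) :
  \sum_i nc (u 0 i) ^+ 2 = \sum_i nc ((u *m cadj P) 0 i) ^+ 2.
Proof.
have H k (w : 'rV[C]_k) : (w *m cadj w) 0 0 = toC (\sum_i nc (w 0 i) ^+ 2).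
  by rewrite mxE toC_sum; apply: eq_bigr => i _; rewrite !mxE mul_conj_nc.
apply: (@complexI R); rewrite -!H; have [_ PP' _] := AD.
have -> : cadj (u *m cadj P) = P *m cadj u.
  by rewrite cadjM cadjK.
by rewrite mulmxA -[u *m _ *m P]mulmxA PP' mulmx1.
Qed.

End Diagonalized.

Lemma rank_diag_mask n (S : {set 'I_n}) :
  (\rank (diag_mx (\row_i (i \in S)%:R : 'rV[C]_n)) <= #|S|)%N.
Proof.
rewrite diag_mx_sum_delta.
apply: (@leq_trans (\sum_(i in S) 1)); last by rewrite sum1_card.
rewrite [X in (_ <= X)%N]big_mkcond/=.
elim/big_ind2: _ => [|a x b y ax bY|i _]; first by rewrite mxrank0.
  exact: leq_trans (mxrank_add _ _) (leq_add ax bY).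
rewrite mxE; case: ifP => _; last by rewrite scale0r mxrank0.
by rewrite scale1r mxrank_delta.
Qed.

(* A unit vector in the span of the eigenvectors of [A] with eigenvalues in
   [S], orthogonal to those of [B] with eigenvalues in [S], and in the kernel
   of [A - B] would have two different Rayleigh quotients. *)
Lemma rank_inequality n (A B : 'M[R]_n) (S : pred R) :
  A^T = A -> B^T = B -> (forall x y, S x -> y <= x -> S y) ->
  (count S (eigenvalues A) <= count S (eigenvalues B) + \rank (A - B)%R)%N.
Proof.
move=> As Bs Sdown.
have [P [D AD]] := diagonalization As; have [Q [F BF]] := diagonalization Bs.
rewrite (count_eigenvalues AD) (count_eigenvalues BF).
set IA := [set i | S (D 0 i)]%SET; set IB := [set i | S (F 0 i)]%SET.
pose M1 := cadj P *m diag_mx (\row_i (i \in ~: IA)%:R).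
pose M2 := cadj Q *m diag_mx (\row_i (i \in IB)%:R).
pose M3 := cmx (A - B).
rewrite leqNgt; apply/negP => lt.
have M1r : (\rank M1 <= n - #|IA|)%N.
  rewrite (leq_trans (mxrankM_maxr _ _))// (leq_trans (rank_diag_mask _))//.
  by rewrite cardsCs finset.setCK card_ord.
have M2r : (\rank M2 <= #|IB|)%N.
  by rewrite (leq_trans (mxrankM_maxr _ _))// rank_diag_mask.
have M3r : \rank M3 = \rank (A - B) by rewrite mxrank_map.
pose M := row_mx M1 (row_mx M2 M3).
have rk m1 m2 (X : 'M[C]_(n, m1)) (Y : 'M[C]_(n, m2)) :
    (\rank (row_mx X Y) <= \rank X + \rank Y)%N.
  rewrite -mxrank_tr tr_row_mx -addsmxE -(mxrank_tr X) -(mxrank_tr Y).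
  exact: mxrank_adds_leqif.
have IAn : (#|IA| <= n)%N by rewrite -[leqRHS]card_ord max_card.
(* If the count failed, [(n - #|IA|) + #|IB| + \rank (A - B)] would be below [n], so some nonzero
   [u] meets all three conditions. *)
have Mr : (\rank M < n)%N.
  apply: leq_ltn_trans (rk _ _ _ _) _.
  apply: leq_ltn_trans (leq_add M1r (rk _ _ _ _)) _.
  apply: leq_ltn_trans (leq_add (leqnn _) (leq_add M2r (leqnn _))) _.
  rewrite M3r -[X in (_ < X)%N](subnK IAn) ltn_add2l//.
have : kermx M != 0 by rewrite -mxrank_eq0 mxrank_ker subn_eq0 -ltnNge.
case/rowV0Pn => u /sub_kermxP; rewrite !mul_mx_row => /eqP.
rewrite !row_mx_eq0 => /and3P[/eqP u1 /eqP u2 /eqP u3] u0.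
set a := fun i => nc ((u *m cadj P) 0 i) ^+ 2.
set b := fun i => nc ((u *m cadj Q) 0 i) ^+ 2.
have a0 i : i \notin IA -> a i = 0.
  move=> iA; move: u1 => /rowP/(_ i); rewrite mulmxA mul_mx_diag !mxE inE iA mulr1.
  by rewrite /a mxE => ->; rewrite nc0 expr0n.
have b0 i : i \in IB -> b i = 0.
  move=> iB; move: u2 => /rowP/(_ i); rewrite mulmxA mul_mx_diag !mxE iB mulr1.
  by rewrite /b mxE => ->; rewrite nc0 expr0n.
have eqf : \sum_i D 0 i * a i = \sum_i F 0 i * b i.
  apply: (@complexI R).
  rewrite -(quadratic_form_diagonalized AD) -(quadratic_form_diagonalized BF).
  congr ((_ *m _) 0 0); apply/eqP; rewrite -subr_eq0 -mulmxBr.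
  by rewrite -map_mxB; apply/eqP.
have ua := norm_diagonalized AD u; have ub := norm_diagonalized BF u.
have un : 0 < \sum_i nc (u 0 i) ^+ 2.
  rewrite lt_def psumr_eq0; last by move=> i _; exact: sqr_ge0.
  rewrite sumr_ge0 ?andbT; last by move=> i _; exact: sqr_ge0.
  apply: contra u0 => /allP H; apply/eqP/rowP => i; rewrite mxE; apply/eqP.
  by rewrite -nc_eq0 -sqrf_eq0; apply: H; rewrite mem_index_enum.
(* [S] comes without a threshold separating it from its complement. The double sum compares each
   eigenvalue of [A] in [S] directly with each one of [B] outside; all terms are nonnegative and the
   total is 0. *)
have dbl : \sum_i \sum_j (F 0 j - D 0 i) * (a i * b j) = 0.
  transitivity ((\sum_i a i) * (\sum_j F 0 j * b j) -
                (\sum_i D 0 i * a i) * (\sum_j b j)).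
    rewrite !mulr_suml -sumrB; apply: eq_bigr => i _.
    by rewrite !mulr_sumr -sumrB; apply: eq_bigr => j _; ring.
  by rewrite /a /b -ua -ub eqf mulrC subrr.
have pos i j : 0 <= (F 0 j - D 0 i) * (a i * b j).
  have [iA|/a0->] := boolP (i \in IA); last by rewrite mul0r mulr0.
  have [/b0->|jB] := boolP (j \in IB); first by rewrite !mulr0.
  have ab : 0 <= a i * b j by apply: mulr_ge0; exact: sqr_ge0.
  rewrite mulr_ge0// subr_ge0 leNgt.
  move: iA jB; rewrite !inE => iA; apply: contra => /ltW; exact: Sdown.
have z i j : (F 0 j - D 0 i) * (a i * b j) = 0.
  move/eqP: dbl; rewrite psumr_eq0 => [/allP/(_ i)|k _]; last exact: sumr_ge0.
  rewrite mem_index_enum => /(_ isT); rewrite psumr_eq0// => /allP/(_ j).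
  by rewrite mem_index_enum => /(_ isT)/eqP.
have z' i j : a i * b j = 0.
  have [iA|/a0->] := boolP (i \in IA); last by rewrite mul0r.
  have [/b0->|jB] := boolP (j \in IB); first by rewrite mulr0.
  move/eqP: (z i j); rewrite mulf_eq0 subr_eq0 => /orP[/eqP FD|/eqP//].
  by move: iA jB; rewrite !inE FD => ->.
have : (\sum_i a i) * (\sum_j b j) = 0.
  rewrite mulr_suml big1// => i _; rewrite mulr_sumr big1// => j _; exact: z'.
by move/eqP; rewrite -ua -ub mulf_eq0 orbb gt_eqF.
Qed.

End Spectrum.

(** * Rows drawn from a code *)

Section Code.
Variables (R : realType) (n : nat) (C : {vspace 'rV['F_2]_n}).
Local Notation nc := (@Normc.normc R).
Local Notation toC := (real_complex R).

Definition codeword := {c : 'rV['F_2]_n | c \in C}.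
HB.instance Definition _ := SubFinite.on codeword.

Definition sgn2 (b : 'F_2) : R := 1 - 2 * (nat_of_ord b)%:R.

Definition signs (k : codeword) : 'rV[R]_n := map_mx sgn2 (val k).

Lemma F2P (b : 'F_2) : b = 0 \/ b = 1.
Proof. by case: b => -[|[|]]//= i; [left|right]; apply/val_inj. Qed.

Lemma sgn20 : sgn2 0 = 1.
Proof. by rewrite /sgn2 mulr0 subr0. Qed.

Lemma sgn21 : sgn2 1 = -1.
Proof. by rewrite /sgn2 (_ : nat_of_ord (1%R : 'F_2) = 1%N)//; lra. Qed.

Lemma sgn2D a b : sgn2 (a + b) = sgn2 a * sgn2 b.
Proof.
case: (F2P a) (F2P b) => -> [] ->; rewrite ?add0r ?addr0 ?sgn20 ?mul1r ?mulr1//.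
have -> : 1 + 1 = 0 :> 'F_2 by exact: val_inj.
by rewrite sgn20 sgn21 mulrNN mulr1.
Qed.

Lemma sgn2_sqr b : sgn2 b * sgn2 b = 1.
Proof. by case: (F2P b) => ->; rewrite ?sgn20 ?sgn21 ?mulrNN mulr1. Qed.

Lemma codeword_gt0 : (0 < #|{: codeword}|)%N.
Proof. by apply/card_gt0P; exists (exist _ 0 (mem0v C)). Qed.

(** Some codeword [c] is not orthogonal to [u]; translation by [c] permutes the code and flips the
    sign of the character. *)
Lemma avg_character (u : 'rV['F_2]_n) : u \notin dual_code C ->
  avg (fun k : codeword => sgn2 (dotF2 (val k) u)) = 0.
Proof.
rewrite inE => /forallPn[c]; rewrite negb_imply => /andP[cC uc].
have {}uc : dotF2 c u = 1 by case: (F2P (dotF2 c u)) uc => // ->; rewrite eqxx.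
pose shift (k : codeword) : codeword := exist _ (val k + c) (memvD (valP k) cC).
have shiftK : involutive shift.
  move=> k; apply: val_inj => /=; rewrite -addrA.
  suff -> : c + c = 0 by rewrite addr0.
  apply/rowP => j; rewrite !mxE; case: (F2P (c 0 j)) => ->; exact: val_inj.
have E : avg (fun k : codeword => sgn2 (dotF2 (val k) u)) =
    - avg (fun k : codeword => sgn2 (dotF2 (val k) u)).
  rewrite -[LHS](avg_inj_invol _ shiftK) -avgN; apply: eq_avg => k /=.
  have -> : dotF2 (val k + c) u = dotF2 (val k) u + dotF2 c u.
    by rewrite /dotF2 -big_split; apply: eq_bigr => i _; rewrite mxE mulrDl.
  by rewrite sgn2D uc sgn21 mulrN1.
lra.
Qed.

Hypothesis dC : (5%:E <= dual_distance R C)%E.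

Lemma dual_code_small (u : 'rV['F_2]_n) :
  (#|[set i | u 0%R i != 0%R]%SET| <= 4)%N -> u \in dual_code C -> u = 0.
Proof.
move=> u4 uD; apply/eqP/negPn/negP => u0.
have : (dual_distance R C <= (hamming_distance u 0)%:R%:E)%E.
  apply: ereal_inf_lbound; exists u, 0; split => //.
  rewrite inE; apply/forall_inP => c _; rewrite /dotF2 big1// => i _.
  by rewrite !mxE mulr0.
move=> /(le_trans dC); rewrite lee_fin ler_nat leqNgt => /negP; apply.
rewrite ltnS; apply: leq_trans u4; rewrite /hamming_distance.
by apply: eq_leq; apply: eq_card => i; rewrite !inE mxE.
Qed.

Let dotF2_delta (c : 'rV['F_2]_n) (i : 'I_n) : dotF2 c (delta_mx 0 i) = c 0 i.
Proof.
rewrite /dotF2 (bigD1 i)//= mxE !eqxx mulr1 big1 ?addr0// => j ji.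
by rewrite mxE (negPf ji) andbF mulr0.
Qed.

Let dotF2D (c u v : 'rV['F_2]_n) : dotF2 c (u + v) = dotF2 c u + dotF2 c v.
Proof. by rewrite /dotF2 -big_split; apply: eq_bigr => i _; rewrite mxE mulrDr. Qed.

(** The hypothesis says that [e] occurs an odd number of times among [a], [b], [c], [d]. Then [u] is
    nonzero at [e] and has weight at most 4, so it lies outside the dual code and its character
    averages to 0. *)
Lemma avg_signs4_eq0 (a b c d e : 'I_n) :
  (e == a) (+) (e == b) (+) (e == c) (+) (e == d) ->
  avg (fun k => signs k 0 a * signs k 0 b * (signs k 0 c * signs k 0 d)) = 0.
Proof.
move=> eabcd.
pose u : 'rV['F_2]_n :=
  delta_mx 0 a + delta_mx 0 b + (delta_mx 0 c + delta_mx 0 d).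
rewrite (eq_avg (g := fun k : codeword => sgn2 (dotF2 (val k) u))); last first.
  by move=> k; rewrite !dotF2D !dotF2_delta !sgn2D !mxE.
apply: avg_character; apply/negP => uD.
have u0 : u = 0.
  apply: dual_code_small => //.
  apply: leq_trans (subset_leq_card (B := [set a; b; c; d]%SET) _) _.
    apply/fintype.subsetP => i; rewrite !inE !mxE !eqxx/=.
    by case: (i == a); case: (i == b); case: (i == c); case: (i == d);
      rewrite //= ?mulr0n ?addr0 ?eqxx.
  do 2![apply: leq_trans (leq_card_setU _ _) _; rewrite cards1 addn1 ltnS].
  by apply: leq_trans (leq_card_setU _ _) _; rewrite !cards1.
move: eabcd; have := congr1 (fun w : 'rV_n => w 0 e) u0; rewrite !mxE !eqxx/=.
by do 4!case: eqP.
Qed.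

Lemma avg_signs4 (a b c d : 'I_n) : a != b -> c != d ->
  avg (fun k => signs k 0 a * signs k 0 b * (signs k 0 c * signs k 0 d)) =
  ((a == c) && (b == d))%:R + ((a == d) && (b == c))%:R.
Proof.
move=> ab cd.
have one (x y : 'I_n) : avg (fun k => signs k 0 x * signs k 0 y *
    (signs k 0 x * signs k 0 y)) = 1.
  rewrite -[RHS](avg_cst _ codeword_gt0); apply: eq_avg => k.
  by rewrite mulrACA !mxE !sgn2_sqr mulr1.
have [ac|ac] := eqVneq a c.
  subst c; have [bd|bd] := eqVneq b d.
    by subst d; rewrite one (negPf ab) addr0.
  rewrite (@avg_signs4_eq0 _ _ _ _ b) ?eqxx ?(negPf bd) ?(eq_sym b) ?(negPf ab)//=.
  by rewrite andbF addr0.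
have [ad|ad] := eqVneq a d.
  subst d; have [bc|bc] := eqVneq b c.
    subst c; rewrite add0r -[RHS](one a b); apply: eq_avg => k; ring.
  rewrite (@avg_signs4_eq0 _ _ _ _ b) ?addr0//.
  by rewrite eqxx (negPf bc) !(eq_sym b) (negPf ab).
rewrite (@avg_signs4_eq0 _ _ _ _ a) ?addr0//.
by rewrite eqxx (negPf ab) (negPf ac) (negPf ad).
Qed.

(** Padding with the square of a sign, which is 1, reduces two factors to four. *)
Lemma avg_signs2 (a b : 'I_n) :
  avg (fun k => signs k 0 a * signs k 0 b) = (a == b)%:R.
Proof.
rewrite (eq_avg (g := fun k => signs k 0 a * signs k 0 b *
  (signs k 0 b * signs k 0 b))); last by move=> k; rewrite !mxE sgn2_sqr mulr1.
have [->|ab] := eqVneq a b.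
  rewrite -[RHS](avg_cst _ codeword_gt0); apply: eq_avg => k.
  by rewrite !mxE !sgn2_sqr mulr1.
by rewrite (@avg_signs4_eq0 _ _ _ _ a)// eqxx (negPf ab).
Qed.

(** Squares of signs are 1, so the diagonal of the form is exactly the trace and only off-diagonal
    pairs fluctuate. In the second moment a pair [(a, b)] meets itself and [(b, a)]; both contribute
    [|B a b|^2] as [B] is symmetric, whence the factor 2. *)
Lemma signs_isotropic : isotropic signs.
Proof.
move=> B Bs.
have qE k : qform (signs k) B =
    \sum_a \sum_b B a b * toC (signs k 0 a * signs k 0 b).
  rewrite /qform mxE exchange_big/=; apply: eq_bigr => b _.
  rewrite mxE mulr_suml; apply: eq_bigr => a _.
  by rewrite !mxE rmorphM/=; ring.
split.
  rewrite (eq_avg qE) avg_sum; apply: eq_bigr => a _.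
  rewrite avg_sum (bigD1 a)//= avgZ -toC_avg avg_signs2 eqxx mulr1.
  rewrite big1 ?addr0// => b ba; rewrite avgZ -toC_avg avg_signs2.
  by rewrite eq_sym (negPf ba) mulr0.
pose P (ab : 'I_n * 'I_n) := ab.1 != ab.2.
have dE k : qform (signs k) B - \tr B =
    \sum_(ab | P ab) B ab.1 ab.2 * toC (signs k 0 ab.1 * signs k 0 ab.2).
  rewrite qE pair_bigA/= (bigID P)/= -addrA -[RHS]addr0; congr (_ + _).
  apply/eqP; rewrite subr_eq0; apply/eqP.
  rewrite -(pair_big_dep xpredT (fun a b => ~~ P (a, b))
    (fun a b => B a b * toC (signs k 0 a * signs k 0 b)))/=.
  apply: eq_bigr => a _; rewrite (big_pred1 a) => [|b].
    by rewrite !mxE sgn2_sqr mulr1.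
  by rewrite /P/= negbK eq_sym.
rewrite -lecR toC_avg.
have -> : avg (fun k => toC (nc (qform (signs k) B - \tr B) ^+ 2)) =
    \sum_(ab | P ab) \sum_(cd | P cd) B ab.1 ab.2 * conjc (B cd.1 cd.2) *
      toC (avg (fun k => signs k 0 ab.1 * signs k 0 ab.2 *
        (signs k 0 cd.1 * signs k 0 cd.2))).
  under eq_bigr => ab _ do under eq_bigr => cd _ do rewrite toC_avg -avgZ.
  under eq_bigr => ab _ do rewrite -avg_sum.
  rewrite -avg_sum; apply: eq_avg => k.
  rewrite -mul_conj_nc dE rmorph_sum/= mulr_suml; apply: eq_bigr => ab _.
  rewrite mulr_sumr; apply: eq_bigr => cd _.
  rewrite conjMr.
  by rewrite [toC (_ * (_ * _))]rmorphM/=; ring.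
pose g (ab cd : 'I_n * 'I_n) : R :=
  ((ab.1 == cd.1) && (ab.2 == cd.2))%:R + ((ab.1 == cd.2) && (ab.2 == cd.1))%:R.
have -> : \sum_(ab | P ab) \sum_(cd | P cd) B ab.1 ab.2 * conjc (B cd.1 cd.2) *
      toC (avg (fun k => signs k 0 ab.1 * signs k 0 ab.2 *
        (signs k 0 cd.1 * signs k 0 cd.2))) =
    \sum_(ab | P ab) toC (2 * nc (B ab.1 ab.2) ^+ 2).
  apply: eq_bigr => -[a b] Pab.
  under eq_bigr => cd Pcd do rewrite (avg_signs4 Pab Pcd) rmorphD mulrDr.
  have Pba : P (b, a) by rewrite /P/= eq_sym.
  have Bba : B b a = B a b by rewrite -[in LHS]Bs mxE.
  rewrite big_split/= (bigD1 (a, b))//= !eqxx/= mulr1.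
  rewrite [X in _ + X + _]big1 => [|[c d]/andP[_ ne]]; last first.
    move: ne; rewrite xpair_eqE/= (eq_sym c) (eq_sym d) => /negPf ->.
    by rewrite mulr0.
  rewrite (bigD1 (b, a))//= !eqxx/= mulr1 big1 => [|[c d]/andP[_ ne]]; last first.
    move: ne; rewrite xpair_eqE/= (eq_sym c) (eq_sym d) andbC => /negPf ->.
    by rewrite mulr0.
  by rewrite !addr0 Bba mul_conj_nc -rmorphD/= mulr_natl mulr2n.
rewrite -toC_sum lecR -mulr_sumr ler_wpM2l//.
rewrite pair_bigA/= [leRHS](bigID P)/= lerDl; apply: sumr_ge0 => ab _.
exact: sqr_ge0.
Qed.

End Code.

(** * Gram matrices and their counting functions *)

Section GramLink.
Variable R : realType.
Local Notation C := R[i].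
Local Notation nc := (@Normc.normc R).
Local Notation toC := (real_complex R).

(** The two products share their nonzero spectrum; the surplus zeros contribute [- 1 / z] each. The
    proof goes through [X G_A = G_B X], which gives [A G_A] and [B G_B] the same trace. *)
Lemma resolvent_trace_swap p n (c : R) (X : 'M[R]_(p, n)) z : 0 < Im z ->
  \tr (resolvent (c *: (X^T *m X)) z) =
  \tr (resolvent (c *: (X *m X^T)) z) - (n%:R - p%:R) / z.
Proof.
move=> z0; have z_neq0 : z != 0 by apply: contraTneq z0 => ->; rewrite ltxx.
set A := c *: (X^T *m X); set B := c *: (X *m X^T).
have BE : B = c *: (X^T^T *m X^T) by rewrite trmxK.
have Au : cmx A - z%:M \in unitmx := resolvent_unit c X z0.
have Bu : cmx B - z%:M \in unitmx by rewrite BE; exact: resolvent_unit.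
have comm : cmx X *m (cmx A - z%:M) = (cmx B - z%:M) *m cmx X.
  rewrite mulmxBr mulmxBl scalar_mxC; congr (_ - _).
  rewrite /cmx -!map_mxM/=; congr map_mx.
  by rewrite /A /B -scalemxAr -scalemxAl mulmxA.
have XG : resolvent B z *m cmx X = cmx X *m resolvent A z.
  by rewrite -[LHS](mulmxK Au) -[resolvent B z *m _ *m _]mulmxA comm mulKmx.
have trA : \tr (cmx A *m resolvent A z) = n%:R + z * \tr (resolvent A z).
  rewrite -{1}[cmx A](subrK z%:M) mulmxDl mulmxV// linearD/= mxtrace1.
  by rewrite mul_scalar_mx linearZ.
have trB : \tr (cmx B *m resolvent B z) = p%:R + z * \tr (resolvent B z).
  rewrite -{1}[cmx B](subrK z%:M) mulmxDl mulmxV// linearD/= mxtrace1.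
  by rewrite mul_scalar_mx linearZ.
have : \tr (cmx A *m resolvent A z) = \tr (cmx B *m resolvent B z).
  rewrite [in RHS]mxtrace_mulC /A /B /cmx !map_mxZ/= !map_mxM/= -/A -/B.
  rewrite -scalemxAl -scalemxAr !linearZ/=; congr (_ * _).
  by rewrite mulmxA -/(cmx X) XG mxtrace_mulC mulmxA -map_trmx mxtrace_mulC mulmxA.
rewrite trA trB => /eqP; rewrite addrC -subr_eq => /eqP E.
apply: (mulfI z_neq0); rewrite mulrBr [z * (_ / z)]mulrC divfK// -E; ring.
Qed.

Lemma rank_gram_le p n (c : R) (X X' : 'M[R]_(p, n)) : (\rank (X - X')%R <= 1)%N ->
  (\rank (c *: (X *m X^T) - c *: (X' *m X'^T))%R <= 2)%N.
Proof.
move=> r1; rewrite -scalerBr.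
apply: leq_trans (mxrank_scale _ _) _.
have -> : X *m X^T - X' *m X'^T = (X - X') *m X^T + X' *m (X - X')^T.
  by rewrite linearB/= mulmxBl mulmxBr addrA subrK.
apply: leq_trans (mxrank_add _ _) _; apply: (@leq_add _ _ 1 1).
  exact: leq_trans (mxrankM_maxl _ _) r1.
by rewrite (leq_trans (mxrankM_maxr _ _))// mxrank_tr.
Qed.

Lemma gram_sym p n (c : R) (X : 'M[R]_(p, n)) :
  (c *: (X *m X^T))^T = c *: (X *m X^T).
Proof. by rewrite linearZ/= trmx_mul trmxK. Qed.

(** With an interval bound as threshold, one predicate covers [x < c], [x <= c] and both infinities,
    so the count in any interval is a difference of two values of [below_count]. *)
Definition below (b : itv_bound R) : pred R := fun x => (BRight x <= b)%O.

Lemma below_down b x y : below b x -> y <= x -> below b y.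
Proof. by move=> bx yx; apply: le_trans bx; rewrite bnd_simp. Qed.

Definition below_count p (A : 'M[R]_p) (b : itv_bound R) : R :=
  (count (below b) (eigenvalues A))%:R / p%:R.

Lemma below_count_gram p n (c : R) (X X' : 'M[R]_(p, n)) b :
  (\rank (X - X')%R <= 1)%N ->
  `|below_count (c *: (X *m X^T)) b - below_count (c *: (X' *m X'^T)) b|
    <= 2 / p%:R.
Proof.
move=> r1.
have half (Y Y' : 'M[R]_(p, n)) : (\rank (Y - Y')%R <= 1)%N ->
    below_count (c *: (Y *m Y^T)) b <= below_count (c *: (Y' *m Y'^T)) b + 2 / p%:R.
  move=> r; rewrite /below_count -mulrDl ler_wpM2r ?invr_ge0// -natrD ler_nat.
  apply: leq_trans (rank_inequality (gram_sym c Y) (gram_sym c Y')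
    (@below_down b)) _.
  by rewrite leq_add2l rank_gram_le.
have r1' : (\rank (X' - X)%R <= 1)%N.
  by rewrite -opprB -scaleN1r (leq_trans (mxrank_scale _ _)).
by rewrite ler_distl lerBlDr !half.
Qed.

Lemma size_eigenvalues p (A : 'M[R]_p) : A^T = A -> size (eigenvalues A) = p.
Proof.
move=> /diagonalization[P [D AD]].
by rewrite (perm_size (eigenvalues_diagonalized AD)) size_map size_enum_ord.
Qed.

(** The list has exactly [p] entries, so the default 0 of the indexing is never read. The indexed
    form lets samples and eigenvalues be averaged together. *)
Lemma avg_eigenvalues (F : numFieldType) p (A : 'M[R]_p) (g : R -> F) : A^T = A ->
  avg (fun i : 'I_p => g (eigenvalues A)`_i) =
  p%:R^-1 * \sum_(l <- eigenvalues A) g l.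
Proof.
move=> As; rewrite /avg card_ord (big_nth 0) size_eigenvalues// big_mkord//.
Qed.

Section Sample.
Variables (p n : nat) (V : {vspace 'rV['F_2]_n}).
Hypothesis n0 : (0 < n)%N.
Local Notation Omega := {ffun 'I_p -> codeword V}.
Implicit Types w : Omega.

Definition word_mx w : 'M['F_2]_(p, n) := \matrix_i val (w i).

Let Y w : 'M[R]_(p, n) := 2 *: real_mx R (word_mx w).

Let gramE w : gram R (word_mx w) = n%:R^-1 *: (Y w *m (Y w)^T).
Proof.
rewrite /gram /Y linearZ/= -scalemxAl -scalemxAr !scalerA; congr (_ *: _).
by rewrite mulrC -mulrA -natrM mulrC.
Qed.

Definition sign_gram w : 'M[R]_p :=
  n%:R^-1 *: (sample (@signs R n V) w *m (sample (@signs R n V) w)^T).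

Lemma sign_gram_sym w : (sign_gram w)^T = sign_gram w.
Proof. exact: gram_sym. Qed.

Lemma below_count_sign w b :
  `|below_count (gram R (word_mx w)) b - below_count (sign_gram w) b| <= 2 / p%:R.
Proof.
(* A Gram matrix does not see the sign of its factor, and [2 Phi] minus [- X] is the all-ones
   matrix, of rank one. *)
have -> : sign_gram w = n%:R^-1 *: (- sample (@signs R n V) w *m
    (- sample (@signs R n V) w)^T).
  by rewrite linearN/= mulmxN mulNmx opprK.
rewrite gramE; apply: below_count_gram; rewrite opprK.
have -> : Y w + sample (@signs R n V) w =
    (const_mx 1 : 'cV_p) *m (const_mx 1 : 'rV_n).
  apply/matrixP => i j; rewrite !mxE big_ord1 !mxE mulr1 /sgn2.
  by rewrite addrC subrK.
by rewrite (leq_trans (mxrankM_maxl _ _))// rank_leq_col.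
Qed.

Lemma below_count_bounded_diff b :
  bounded_diff (2 / p%:R) (fun w => below_count (gram R (word_mx w)) b).
Proof.
move=> i w k; rewrite !gramE; apply: below_count_gram.
have -> : Y w - Y (upd w i k) =
    (delta_mx i 0 : 'cV_p) *m row i (Y w - Y (upd w i k)).
  apply/matrixP => a j; rewrite !mxE big_ord1 !mxE ffunE.
  case: (eqVneq a i) => [->|ai]; first by rewrite ffunE !eqxx mul1r.
  by rewrite subrr mul0r.
by rewrite (leq_trans (mxrankM_maxl _ _))// rank_leq_col.
Qed.

Hypothesis dV : (5%:E <= dual_distance R V)%E.

Definition sign_stieltjes (z : C) : C := avg (fun w : Omega =>
  avg (fun i : 'I_p => (toC (eigenvalues (sign_gram w))`_i - z)^-1)).

Lemma sign_stieltjesE z (y := p%:R / n%:R : R) : (0 < p)%N -> 0 < Im z ->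
  avg (@ctrace R p n _ (@signs R n V) z) =
  toC y * sign_stieltjes z - toC (1 - y) / z :> C.
Proof.
move=> p0 z0.
have np : n%:R != 0 :> R by rewrite pnatr_eq0 -lt0n.
have pp : p%:R != 0 :> C by rewrite pnatr_eq0 -lt0n.
have Om0 : (0 < #|{: Omega}|)%N by rewrite card_ffun expn_gt0 codeword_gt0.
rewrite /sign_stieltjes -avgZ -[X in _ - X](avg_cst _ Om0) -avgB.
apply: eq_avg => w; rewrite (avg_eigenvalues (fun l => (toC l - z)^-1) (sign_gram_sym w)).
have [P [D AD]] := diagonalization (sign_gram_sym w).
rewrite /ctrace resolvent_trace_swap// -/(sign_gram w).
rewrite (resolvent_trace_eigenvalues AD) ?gt_eqF//.
rewrite /y rmorphB/= rmorphM/= !fmorphV !rmorph_nat rmorph1.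
have np' : n%:R != 0 :> C by rewrite pnatr_eq0 -lt0n.
have z_neq0 : z != 0 by apply: contraTneq z0 => ->; rewrite ltxx.
by field; rewrite z_neq0 pp np'.
Qed.

End Sample.
End GramLink.

(** * Stability in the bulk *)

Section Stability.
Variable R : realType.
Local Notation C := R[i].
Local Notation nc := (@Normc.normc R).
Local Notation toC := (real_complex R).

Section Edges.
Variable y : R.
Hypothesis y01 : 0 < y < 1.
Local Notation a := (mp_left y).
Local Notation b := (mp_right y).

Lemma mp_left_gt0 : 0 < a.
Proof.
have [y0 y1] := andP y01; rewrite /mp_left exprn_gt0// subr_gt0.
by rewrite -sqrtr1 ltr_sqrt.
Qed.

Lemma mp_edges_sum : a + b = 2 * (1 + y).
Proof.
have [y0 y1] := andP y01; rewrite /mp_left /mp_right.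
rewrite sqrrB sqrrD sqr_sqrtr ?ltW//; ring.
Qed.

Lemma mp_edges_mul : a * b = (1 - y) ^+ 2.
Proof.
have [y0 y1] := andP y01; rewrite /mp_left /mp_right -exprMn.
by rewrite -subr_sqr expr1n sqr_sqrtr ?ltW.
Qed.

Lemma mp_left_lt_right : a < b.
Proof.
have [y0 y1] := andP y01; rewrite -subr_gt0 /mp_left /mp_right.
have -> : (1 + Num.sqrt y) ^+ 2 - (1 - Num.sqrt y) ^+ 2 = 4 * Num.sqrt y by ring.
by rewrite mulr_gt0// sqrtr_gt0.
Qed.

(** On [[a, b]] this is the square root of minus the discriminant of [x s^2 + (x + 1 - y) s + 1]. *)
Definition mp_disc x := Num.sqrt ((x - a) * (b - x)).

Lemma mp_densityE x : a <= x <= b -> mp_density y x = mp_disc x / (2 * pi * x * y).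
Proof.
move=> xab; rewrite /mp_density indicE mem_set ?mulr1; last by rewrite /= in_itv.
by rewrite mulrC.
Qed.

Lemma mp_disc_sqr x : a <= x <= b -> mp_disc x ^+ 2 = 4 * x - (x + 1 - y) ^+ 2.
Proof.
move=> /andP[ax xb]; rewrite sqr_sqrtr ?mulr_ge0 ?subr_ge0//.
have -> : (x - a) * (b - x) = (a + b) * x - x ^+ 2 - a * b by ring.
rewrite mp_edges_sum mp_edges_mul; ring.
Qed.

(** If [|s| > 1], the leading term is compared with the others and divided by [|s|], giving
    [|z| |s| <= |z| + 3]. Unlike the trivial bound [1 / Im z], this does not degrade as [z]
    approaches the real axis. *)
Lemma stieltjes_bound (s z : C) (e : R) : a <= nc z -> e <= 1 ->
  nc (z * s ^+ 2 + (z + 1 - toC y) * s + 1) <= e -> nc s <= 1 + 3 / a.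
Proof.
move=> az e1 H; have [y0 y1] := andP y01; have a0 := mp_left_gt0.
have [s1|s1] := leP (nc s) 1; first by rewrite (le_trans s1)// lerDl divr_ge0// ltW.
have z0 : 0 < nc z by apply: lt_le_trans az.
have H2 : nc z * nc s ^+ 2 <= e + (nc z + 1) * nc s + 1.
  have -> : nc z * nc s ^+ 2 = nc ((z * s ^+ 2 + (z + 1 - toC y) * s + 1) -
      (z + toC (1 - y)) * s - 1).
    rewrite -ncX -ncM; congr nc; rewrite rmorphB/= rmorph1; ring.
  apply: le_trans (ncB _ _) _; rewrite nc1 lerD2r.
  apply: le_trans (ncB _ _) _; apply: lerD => //.
  rewrite ncM ler_wpM2r ?nc_ge0//; apply: le_trans (ncD _ _) _.
  rewrite nc_real lerD2l ger0_norm; lra.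
have H3 : nc z * nc s <= nc z + 3.
  rewrite -(ler_pM2r (lt_trans ltr01 s1)); nra.
have : nc s <= (nc z + 3) / nc z by rewrite ler_pdivlMr// mulrC.
move/le_trans; apply; rewrite mulrDl divff ?gt_eqF// lerD2l.
by rewrite ler_wpM2l// lef_pV2.
Qed.

(** Moving the quadratic from [z] to the real point [E] costs [v (|s|^2 + |s|)] and makes its roots
    [sp] and [sm] explicit. The factor [E] of the leading coefficient cancels the one in
    [|s - sm| >= mp_disc E / (2 E)]. *)
Lemma stieltjes_stability (s : C) (E v e : R) :
  a < E < b -> 0 < v -> e <= 1 -> 0 <= Im s ->
  nc (Complex E v * s ^+ 2 + (Complex E v + 1 - toC y) * s + 1) <= e ->
  `|Im s - mp_disc E / (2 * E)| <=
    2 * (e + v * ((1 + 3 / a) ^+ 2 + (1 + 3 / a))) / mp_disc E.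
Proof.
move=> /andP[aE Eb] v0 e1 s0 H; have a0 := mp_left_gt0.
have E0 : 0 < E by exact: lt_trans aE.
have d0 : 0 < mp_disc E by rewrite sqrtr_gt0 mulr_gt0// subr_gt0.
set z := Complex E v in H.
have az : a <= nc z.
  by apply: le_trans (Re_le_nc z) => /=; rewrite ger0_norm ltW.
have sb := stieltjes_bound az e1 H.
set S0 := 1 + 3 / a in sb *.
have zE : z = toC E + toC v * Complex 0 1.
  by rewrite /z; simpc.
have nci : nc (Complex 0 1) = 1.
  by rewrite /= expr0n expr1n add0r sqrtr1.
have HE : nc (toC E * s ^+ 2 + (toC E + 1 - toC y) * s + 1) <=
    e + v * (S0 ^+ 2 + S0).
  have -> : toC E * s ^+ 2 + (toC E + 1 - toC y) * s + 1 =
     (z * s ^+ 2 + (z + 1 - toC y) * s + 1) - toC v * Complex 0 1 * (s ^+ 2 + s).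
    by rewrite zE; ring.
  apply: le_trans (ncB _ _) _; apply: lerD => //.
  rewrite !ncM nci mulr1 nc_real gtr0_norm// ler_wpM2l ?(ltW v0)//.
  apply: le_trans (ncD _ _) _; rewrite ncX lerD//.
  by rewrite lerXn2r ?nnegrE ?nc_ge0// (le_trans (nc_ge0 _) sb).
pose sp : C := Complex (- (E + 1 - y) / (2 * E)) (mp_disc E / (2 * E)).
pose sm : C := Complex (- (E + 1 - y) / (2 * E)) (- (mp_disc E / (2 * E))).
have fact : toC E * s ^+ 2 + (toC E + 1 - toC y) * s + 1 =
    toC E * ((s - sp) * (s - sm)).
  have sum : toC E * (sp + sm) = - (toC E + 1 - toC y).
    rewrite /sp /sm; simpc; congr Complex.
    by field; rewrite gt_eqF.
  have prod : toC E * (sp * sm) = 1.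
    rewrite /sp /sm; simpc; rewrite -[RHS]/(Complex 1 0); congr Complex; last by ring.
    have := mp_disc_sqr (x := E); rewrite !ltW// => /(_ isT) D.
    have -> : E * ((E + 1 - y) / (2 * E) * ((E + 1 - y) / (2 * E)) +
       mp_disc E / (2 * E) * (mp_disc E / (2 * E))) =
      ((E + 1 - y) ^+ 2 + mp_disc E ^+ 2) / (4 * E) by field; rewrite gt_eqF.
    by rewrite D; field; rewrite gt_eqF.
  rewrite [RHS](_ : _ = toC E * s ^+ 2 - toC E * (sp + sm) * s + toC E * (sp * sm)).
    by rewrite sum prod mulNr opprK.
  by move: (toC E) => E1; ring.
have smE : mp_disc E / (2 * E) <= nc (s - sm).
  apply: le_trans (Im_le_nc _); rewrite ImD ImN/= opprK.
  by rewrite (le_trans _ (ler_norm _))// lerDr.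
have sp_le : `|Im s - mp_disc E / (2 * E)| <= nc (s - sp).
  by apply: le_trans (Im_le_nc _); rewrite ImD ImN.
apply: le_trans sp_le _; rewrite ler_pdivlMr//.
have := HE; rewrite fact !ncM nc_real gtr0_norm// => HE'.
have : E * (nc (s - sp) * (mp_disc E / (2 * E))) <= e + v * (S0 ^+ 2 + S0).
  apply: le_trans HE'; rewrite ler_wpM2l ?(ltW E0)// ler_wpM2l ?nc_ge0//.
have -> : E * (nc (s - sp) * (mp_disc E / (2 * E))) = nc (s - sp) * mp_disc E / 2.
  by field; rewrite gt_eqF.
lra.
Qed.

End Edges.

Definition poisson (v x : R) := v / (pi * (x ^+ 2 + v ^+ 2)).

Lemma Im_stieltjes_kernel (l x v : R) : 0 < v ->
  Im (toC l - Complex x v)^-1 = pi * poisson v (x - l).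
Proof.
move=> v0; have pi0 := pi_gt0 R; rewrite /poisson /=; simpc => /=.
have D : 0 < (x - l) ^+ 2 + v ^+ 2 by rewrite ltr_wpDl ?sqr_ge0// exprn_gt0.
have -> : (l - x) ^+ 2 + (- v) ^+ 2 = (x - l) ^+ 2 + v ^+ 2 by ring.
by move: (pi : R) pi0 => q q0; field; rewrite !gt_eqF.
Qed.

Section DensityEstimate.
Variable y : R.
Hypothesis y01 : 0 < y < 1.
Local Notation a := (mp_left y).
Local Notation b := (mp_right y).

Definition smoothed_density (p n : nat) (V : {vspace 'rV['F_2]_n}) (v x : R) :=
  avg (fun w : {ffun 'I_p -> codeword V} =>
    avg (fun i : 'I_p => poisson v (x - (eigenvalues (sign_gram R w))`_i))).

Lemma Im_sign_stieltjes p n (V : {vspace 'rV['F_2]_n}) (v x : R) : 0 < v ->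
  Im (@sign_stieltjes R p n V (Complex x v)) = pi * smoothed_density p V v x.
Proof.
move=> v0; rewrite /sign_stieltjes /smoothed_density Im_avg -avgZ.
apply: eq_avg => w; rewrite Im_avg -avgZ; apply: eq_avg => i.
exact: Im_stieltjes_kernel.
Qed.

(* The scale [u = n^(-1/12)] makes the self-consistent error [1 / (n v^2)],
   the shift [v = u^4] off the real axis and the distance [h = u^2] to the
   edges balance at [v / sqrt h = h^(3/2) = u^3 = n^(-1/4)]. *)
Lemma density_estimate : exists K u0 : R, [/\ 0 < K, 0 < u0 &
  forall (p n : nat) (V : {vspace 'rV['F_2]_n}) (u x : R),
    (0 < p)%N -> (0 < n)%N -> p%:R / n%:R = y ->
    (5%:E <= dual_distance R V)%E ->
    0 < u <= u0 -> n%:R * u ^+ 12 = 1 -> a + u ^+ 2 <= x <= b - u ^+ 2 ->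
    `|smoothed_density p V (u ^+ 4) x - mp_density y x| <= K * u ^+ 3].
Proof.
have a0 := mp_left_gt0 y01; have ab := mp_left_lt_right y01.
have [y0 y1] := andP y01; have pi0 := pi_gt0 R.
have b0 : 0 < b := lt_trans a0 ab.
pose S0 := 1 + 3 / a.
have S00 : 0 < S0 by rewrite addr_gt0// divr_gt0.
pose c1 := 9 * (b + 1) + 2.
have c10 : 0 < c1 by rewrite /c1; lra.
pose c2 := c1 + (S0 ^+ 2 + S0).
have S02 : 0 < S0 ^+ 2 by rewrite exprn_gt0.
have c20 : 0 < c2 by rewrite /c2; lra.
pose g := Num.sqrt ((b - a) / 2).
have g0 : 0 < g by rewrite sqrtr_gt0 divr_gt0// subr_gt0.
(* The first summand is the stability error divided by [mp_disc y x >= g * u]; the second covers the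
   zero eigenvalues of [X^T X], that is [(1 - y) v / |z|^2]. Dividing by [pi * y] turns imaginary
   parts into densities. *)
pose K := (2 * c2 / g + a ^- 2) / (pi * y).
have K0 : 0 < K.
  apply: divr_gt0; last exact: mulr_gt0.
  apply: addr_gt0; last by rewrite invr_gt0 exprn_gt0.
  by apply: divr_gt0 => //; exact: mulr_gt0.
exists K, (c1^-1); split => //; first by rewrite invr_gt0.
move=> p n V u x p0 n0 pn dV /andP[u0 uc] nu /andP[ax xb].
have u1 : u <= 1.
  by rewrite (le_trans uc)// invf_le1// /c1; lra.
have u2 : 0 < u ^+ 2 by rewrite exprn_gt0.
have u4 : 0 < u ^+ 4 by rewrite exprn_gt0.
have u41 : u ^+ 4 <= u by rewrite exprS ler_piMr ?(ltW u0)// exprn_ile1// ltW.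
have xab : a < x < b by apply/andP; split; lra.
have x0 : 0 < x by case/andP: xab => ? _; exact: lt_trans a0 _.
set v := u ^+ 4 in u4 u41 *.
pose z := Complex x v.
have zb : Normc.normc z <= b + 1.
  have -> : z = toC x + toC v * Complex 0 1 by rewrite /z; simpc.
  apply: le_trans (ncD _ _) _; rewrite ncM !nc_real !gtr0_norm//.
  have -> : Normc.normc (Complex 0 1 : C) = 1.
    by rewrite /= expr0n expr1n add0r sqrtr1.
  by case/andP: xab => _ ?; lra.
have V0 := codeword_gt0 V.
pose s := avg (@ctrace R p n _ (@signs R n V) z).
have SC : Normc.normc (z * s ^+ 2 + (z + 1 - toC y) * s + 1) <=
    y * ((9 * Normc.normc z + 2) / (n%:R * v ^+ 2)).
  by rewrite -pn; exact: (self_consistent p n0 V0 (z := z) u4 (signs_isotropic dV)).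
have s0 : 0 <= Im s by exact: Im_avg_ctrace_ge0.
have nE : n%:R = u ^- 12.
  by rewrite -[LHS](mulfK (lt0r_neq0 (exprn_gt0 12 u0))) nu mul1r.
have nv2 : n%:R * v ^+ 2 = v^-1.
  by rewrite nE /v; field; rewrite gt_eqF.
have e_le : y * ((9 * Normc.normc z + 2) / (n%:R * v ^+ 2)) <= c1 * v.
  rewrite nv2 invrK mulrA ler_wpM2r ?(ltW u4)//.
  have zc : 9 * Normc.normc z + 2 <= c1 by rewrite /c1; lra.
  have := nc_ge0 z; nra.
have e1 : c1 * v <= 1.
  rewrite -(mulfV (lt0r_neq0 c10)) ler_wpM2l ?(ltW c10)//; exact: le_trans u41 uc.
have := stieltjes_stability y01 xab u4 e1 s0 (le_trans SC e_le).
rewrite -/S0.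
(* Of the two factors under the root, one is at least [(b - a) / 2] and the other at least
   [u ^+ 2]. *)
have dg : g * u <= mp_disc y x.
  rewrite /g /mp_disc -[u](ger0_norm (ltW u0)) -sqrtr_sqr -sqrtrM; last first.
    by rewrite divr_ge0// subr_ge0 ltW.
  rewrite ler_sqrt; last by rewrite mulr_ge0// subr_ge0; lra.
  have [xm|xm] := leP x ((a + b) / 2); nra.
have gu0 : 0 < g * u by rewrite mulr_gt0.
have d0 : 0 < mp_disc y x by exact: lt_le_trans dg.
have -> : 2 * (c1 * v + v * (S0 ^+ 2 + S0)) / mp_disc y x = 2 * c2 * v / mp_disc y x.
  by rewrite /c2; congr (_ / _); ring.
have bound : 2 * c2 * v / mp_disc y x <= 2 * c2 / g * u ^+ 3.
  apply: (@le_trans _ _ (2 * c2 * v / (g * u))).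
    apply: ler_wpM2l; first by rewrite !mulr_ge0// ltW.
    by rewrite lef_pV2.
  rewrite le_eqVlt; apply/orP; left; apply/eqP; rewrite /v; field.
  by rewrite !gt_eqF.
move=> /le_trans/(_ bound) close.
have sE : Im s = y * (pi * smoothed_density p V v x) + (1 - y) * (v / (x ^+ 2 + v ^+ 2)).
  rewrite /s (sign_stieltjesE V n0 (z := z) p0 u4) pn ImD ImN !ImMr.
  by rewrite Im_sign_stieltjes// /z; simpc.
set sd := smoothed_density p V v x in sE *.
have rE : mp_density y x = mp_disc y x / (2 * pi * x * y).
  by rewrite mp_densityE//; case/andP: xab => ? ?; rewrite !ltW.
have vx : (1 - y) * (v / (x ^+ 2 + v ^+ 2)) <= a ^- 2 * u ^+ 3.
  have vu : v <= u ^+ 3 by rewrite /v exprSr ler_piMr// exprn_ge0// ltW.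
  have a2 : 0 < a ^- 2 by rewrite invr_gt0 exprn_gt0.
  have xv : (x ^+ 2 + v ^+ 2)^-1 <= a ^- 2.
    have a20 : 0 < a ^+ 2 by apply: exprn_gt0.
    have xv20 : 0 < x ^+ 2 + v ^+ 2 by apply: ltr_wpDr; rewrite ?sqr_ge0 ?exprn_gt0.
    case/andP: xab => ax' _; rewrite lef_pV2//.
    have : 0 <= v ^+ 2 by rewrite sqr_ge0.
    by nra.
  have xv0 : 0 <= (x ^+ 2 + v ^+ 2)^-1 by rewrite invr_ge0 addr_ge0 ?sqr_ge0.
  have : (1 - y) * (v / (x ^+ 2 + v ^+ 2)) <= v / (x ^+ 2 + v ^+ 2).
    by rewrite ler_piMl ?gerBl ?(ltW y0)// mulr_ge0 ?(ltW u4).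
  move/le_trans; apply; rewrite mulrC; apply: ler_pM => //; exact: ltW.
have vx0 : 0 <= (1 - y) * (v / (x ^+ 2 + v ^+ 2)).
  apply: mulr_ge0; first by lra.
  by apply: divr_ge0; rewrite ?(ltW u4)// addr_ge0 ?sqr_ge0.
have -> : sd - mp_density y x =
    ((Im s - mp_disc y x / (2 * x)) - (1 - y) * (v / (x ^+ 2 + v ^+ 2))) / (pi * y).
  rewrite sE rE; have pn0 : (pi : R) != 0 by rewrite gt_eqF.
  move: (pi : R) pn0 ((1 - y) * _) => q q0 t; field.
  by rewrite q0 !gt_eqF.
rewrite normrM [X in _ * X]gtr0_norm ?invr_gt0 ?mulr_gt0//.
rewrite /K [leRHS]mulrAC ler_wpM2r ?invr_ge0 ?mulr_ge0 ?(ltW pi0) ?(ltW y0)//.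
rewrite [leRHS]mulrDl; apply: le_trans (ler_normB _ _) _; apply: lerD => //.
by rewrite ger0_norm.
Qed.

End DensityEstimate.

End Stability.

(** * The Marchenko-Pastur distribution *)

Section MarchenkoPastur.
Variable R : realType.

Lemma is_derive_atan_quot (f g : R -> R) (x df dg : R) : g x != 0 ->
  is_derive x 1 f df -> is_derive x 1 g dg ->
  is_derive x 1 (fun t => atan (f t / g t))
    ((df * g x - f x * dg) / (g x ^+ 2 + f x ^+ 2)).
Proof.
move=> g0 fx gx.
have gVx := is_deriveV g0 gx.
have qx := is_deriveM fx gVx.
have ax := @is_derive1_comp _ atan _ x _ _ (is_derive1_atan _) qx.
apply: is_derive_eq ax _; rewrite -[_ *: _]/(_ * _) -[(g x)^-1 *: _]/(_ * _).
have s0 : g x ^+ 2 + f x ^+ 2 != 0.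
  by rewrite gt_eqF// ltr_pwDl ?sqr_ge0// exprn_even_gt0.
rewrite -[_ *: _]/(_ * _) -[(f * _) x]/(f x / g x); field.
by rewrite s0 g0.
Qed.

Lemma continuous_atan_quot (f g : R -> R) (x : R) : g x != 0 ->
  {for x, continuous f} -> {for x, continuous g} ->
  {for x, continuous (fun t => atan (f t / g t))}.
Proof.
move=> g0 fx gx; apply: (@continuous_comp _ _ _ (fun t => f t / g t) atan).
  by apply: continuousM => //; exact: continuousV.
exact: continuous_atan.
Qed.

Variable y : R.
Hypothesis y01 : 0 < y < 1.
Local Notation a := (mp_left y).
Local Notation b := (mp_right y).
Local Notation disc := (mp_disc y).

Let a0 : 0 < a := mp_left_gt0 y01.
Let ab : a < b := mp_left_lt_right y01.
Let y0 : 0 < y. Proof. by case/andP: y01. Qed.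
Let y1 : y < 1. Proof. by case/andP: y01. Qed.

Lemma continuous_disc : continuous disc.
Proof.
move=> x; apply: (@continuous_comp _ _ _ (fun x => (x - a) * (b - x)) Num.sqrt);
  last exact: sqrt_continuous.
apply: continuousM; first by apply: continuousB => //; exact: cst_continuous.
by apply: continuousB => //; exact: cst_continuous.
Qed.

Lemma disc_gt0 x : a < x < b -> 0 < disc x.
Proof. by move=> /andP[ax xb]; rewrite sqrtr_gt0 mulr_gt0// subr_gt0. Qed.

Lemma is_derive_disc x : a < x < b ->
  is_derive x 1 disc ((a + b - 2 * x) / (2 * disc x)).
Proof.
move=> /[dup] /disc_gt0 d0 /andP[ax xb].
have q0 : 0 < (x - a) * (b - x) by rewrite mulr_gt0// subr_gt0.
have q : is_derive x 1 (fun x => (x - a) * (b - x)) (a + b - 2 * x).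
  apply: is_derive_eq; rewrite -![_ *: _]/(_ * _); ring.
rewrite mulrC.
exact: (@is_derive1_comp _ Num.sqrt _ x _ _ (is_derive1_sqrt q0) q).
Qed.

(* [asin w] written as [2 atan (w / (1 + sqrt (1 - w^2)))], which unlike the
   library's [asin] is visibly continuous up to [w = 1] and [w = -1]. *)
Definition mp_primitive (x : R) :=
  (disc x + (a + b) * atan ((2 * x - (a + b)) / (b - a + 2 * disc x)) -
   2 * (1 - y) * atan (((a + b) * x - 2 * (1 - y) ^+ 2) /
     ((b - a) * x + 2 * (1 - y) * disc x))) / (2 * pi * y).

Let den1 x : 0 < b - a + 2 * disc x.
Proof. by rewrite ltr_pwDl ?subr_gt0// mulr_ge0// sqrtr_ge0. Qed.

Let den2 x : a <= x -> 0 < (b - a) * x + 2 * (1 - y) * disc x.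
Proof.
move=> ax; have d0 : 0 <= disc x by exact: sqrtr_ge0.
by rewrite ltr_pwDl ?mulr_gt0 ?mulr_ge0 ?subr_gt0 ?subr_ge0 ?(ltW y1)// (lt_le_trans a0).
Qed.

Lemma continuous_mp_primitive x : a <= x -> {for x, continuous mp_primitive}.
Proof.
move=> ax; have cd := @continuous_disc x.
have cc (c : R) : {for x, continuous (fun=> c)} by exact: cst_continuous.
have ci : {for x, continuous (fun t : R => t)} by [].
apply: continuousM => //; apply: continuousB.
  apply: continuousD => //; apply: continuousM => //.
  apply: continuous_atan_quot; first by rewrite gt_eqF.
    by apply: continuousB => //; apply: continuousM.
  by apply: continuousD => //; apply: continuousM.
apply: continuousM => //; apply: continuous_atan_quot; first by rewrite gt_eqF// den2.
  by apply: continuousB => //; apply: continuousM.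
by apply: continuousD; apply: continuousM.
Qed.

(** Since [a b = (1 - y)^2], [disc x / x] equals [(a + b - x - (1 - y)^2 / x) / disc x]. The three
    summands of the primitive have derivatives [(a + b - 2 x) / (2 disc x)], [(a + b) / (2 disc x)]
    and [- (1 - y)^2 / (x disc x)], which add up to it. *)
Lemma is_derive_mp_primitive x : a < x < b ->
  is_derive x 1 mp_primitive (mp_density y x).
Proof.
move=> /[dup] /[dup] xab /disc_gt0 d0 /andP[ax xb].
have x0 : 0 < x by exact: lt_trans ax.
have dx := is_derive_disc xab.
have M1 := den1 x; have M2 := den2 (ltW ax).
have d2 : disc x ^+ 2 = (x - a) * (b - x).
  by rewrite sqr_sqrtr// mulr_ge0// subr_ge0 ltW.
have m2 : (1 - y) ^+ 2 = a * b by rewrite mp_edges_mul.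
have ba : 0 < b - a by rewrite subr_gt0.
have D1 : is_derive x 1 (fun t => atan ((2 * t - (a + b)) / (b - a + 2 * disc t)))
    (2 * disc x)^-1.
  have n1 : is_derive x 1 (fun t : R => 2 * t - (a + b)) 2.
    by apply: is_derive_eq; rewrite -![_ *: _]/(_ * _); ring.
  have m1 : is_derive x 1 (fun t : R => b - a + 2 * disc t)
      ((a + b - 2 * x) / disc x).
    apply: is_derive_eq; rewrite -![_ *: _]/(_ * _).
    by field; rewrite gt_eqF.
  apply: is_derive_eq (is_derive_atan_quot _ n1 m1) _; first by rewrite gt_eqF.
  (* The two sides differ by a multiple of [disc x ^+ 2 - (x - a) (b - x)], which vanishes; the
     later identities of this proof follow the same pattern, in part with multiples of
     [(1 - y)^2 - a b] as well. *)
  have -> : (b - a + 2 * disc x) ^+ 2 + (2 * x - (a + b)) ^+ 2 =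
      2 * (b - a) * (b - a + 2 * disc x).
    apply/eqP; rewrite -subr_eq0 (_ : _ - _ =
      4 * (disc x ^+ 2 - (x - a) * (b - x))); last by ring.
    by rewrite d2 subrr mulr0.
  have -> : 2 * (b - a + 2 * disc x) - (2 * x - (a + b)) *
      ((a + b - 2 * x) / disc x) = (b - a) * (b - a + 2 * disc x) / disc x.
    apply/eqP; rewrite -subr_eq0 (_ : _ - _ =
      4 * (disc x ^+ 2 - (x - a) * (b - x)) / disc x).
      by rewrite d2 subrr mulr0 mul0r.
    by field; rewrite gt_eqF.
  by field; rewrite !gt_eqF.
have D2 : is_derive x 1 (fun t => atan (((a + b) * t - 2 * (1 - y) ^+ 2) /
     ((b - a) * t + 2 * (1 - y) * disc t))) ((1 - y) / (2 * x * disc x)).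
  have n1 : is_derive x 1 (fun t : R => (a + b) * t - 2 * (1 - y) ^+ 2) (a + b).
    by apply: is_derive_eq; rewrite -![_ *: _]/(_ * _); ring.
  have m1 : is_derive x 1 (fun t : R => (b - a) * t + 2 * (1 - y) * disc t)
      (b - a + (1 - y) * (a + b - 2 * x) / disc x).
    apply: is_derive_eq; rewrite -![_ *: _]/(_ * _).
    by field; rewrite gt_eqF.
  apply: is_derive_eq (is_derive_atan_quot _ n1 m1) _; first by rewrite gt_eqF.
  move: m2 M2; set m := 1 - y => m2 M2.
  have -> : ((b - a) * x + 2 * m * disc x) ^+ 2 +
      ((a + b) * x - 2 * m ^+ 2) ^+ 2 =
      2 * (b - a) * x * ((b - a) * x + 2 * m * disc x).
    apply/eqP; rewrite -subr_eq0 (_ : _ - _ =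
      4 * m ^+ 2 * (disc x ^+ 2 - (x - a) * (b - x)) +
      4 * (m ^+ 2 - a * b) * (m ^+ 2 - x ^+ 2)); last by ring.
    by rewrite d2 m2 !subrr mulr0 mulr0 mul0r addr0.
  have -> : (a + b) * ((b - a) * x + 2 * m * disc x) -
      ((a + b) * x - 2 * m ^+ 2) * (b - a + m * (a + b - 2 * x) / disc x) =
      m * (b - a) * ((b - a) * x + 2 * m * disc x) / disc x.
    apply/eqP; rewrite -subr_eq0 (_ : _ - _ =
      m * (2 * (a + b) * (disc x ^+ 2 - (x - a) * (b - x)) +
      2 * (a + b - 2 * x) * (m ^+ 2 - a * b)) / disc x).
      by rewrite d2 m2 !subrr !mulr0 addr0 mulr0 mul0r.
    by field; rewrite gt_eqF.
  by field; rewrite !gt_eqF.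
have -> : mp_density y x = ((a + b - 2 * x) / (2 * disc x) +
    (a + b) * (2 * disc x)^-1 -
    2 * (1 - y) * ((1 - y) / (2 * x * disc x))) / (2 * pi * y).
  have pi0 : (pi : R) != 0 by rewrite gt_eqF// pi_gt0.
  rewrite mp_densityE; last by rewrite !ltW.
  have -> : disc x / (2 * pi * x * y) = disc x ^+ 2 / (2 * pi * x * y * disc x).
    by move: (pi : R) pi0 => q q0; field; rewrite q0 !gt_eqF.
  have -> : disc x ^+ 2 = (a + b) * x - x ^+ 2 - (1 - y) ^+ 2.
    by rewrite d2 m2; ring.
  by move: (pi : R) pi0 => q q0; field; rewrite q0 !gt_eqF.
rewrite /mp_primitive; apply: is_derive_eq.
by rewrite -![_ *: _]/(_ * _) mulr0 add0r mulrC.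
Qed.

Let disc_a : disc a = 0. Proof. by rewrite /mp_disc subrr mul0r sqrtr0. Qed.

Let disc_b : disc b = 0. Proof. by rewrite /mp_disc subrr mulr0 sqrtr0. Qed.

(** At the edges both arctangents are taken at 1 or -1, so the increment is
    [(a + b - 2 (1 - y)) / (4 y)], and [a + b = 2 (1 + y)]. *)
Lemma mp_primitive_total : mp_primitive b - mp_primitive a = 1.
Proof.
have b0 : 0 < b := lt_trans a0 ab.
have ba : b - a != 0 by rewrite subr_eq0 gt_eqF.
rewrite /mp_primitive disc_a disc_b -(mp_edges_mul y01).
have -> : (2 * b - (a + b)) / (b - a + 2 * 0) = 1.
  by field.
have -> : (2 * a - (a + b)) / (b - a + 2 * 0) = -1.
  by field.
have -> : ((a + b) * b - 2 * (a * b)) / ((b - a) * b + 2 * (1 - y) * 0) = 1.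
  by field; rewrite ba gt_eqF.
have -> : ((a + b) * a - 2 * (a * b)) / ((b - a) * a + 2 * (1 - y) * 0) = -1.
  by field; rewrite ba gt_eqF.
rewrite atanN atan1 mp_edges_sum//.
have pi0 : (pi : R) != 0 by rewrite gt_eqF// pi_gt0.
by move: (pi : R) pi0 => q q0; field; rewrite q0 gt_eqF.
Qed.

Let g (x : R) : R := disc x / (2 * pi * x * y).

Let g_ge0 x : a <= x -> 0 <= g x.
Proof.
move=> ax; rewrite divr_ge0 ?sqrtr_ge0// !mulr_ge0 ?pi_ge0 ?(ltW y0)//.
exact: le_trans (ltW a0) ax.
Qed.

Let continuous_g x : a <= x -> {for x, continuous g}.
Proof.
move=> ax; apply: continuousM; first exact: continuous_disc.
apply: continuousV.
  by rewrite !mulf_neq0 ?gt_eqF ?pi_gt0// (lt_le_trans a0).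
apply: continuousM; last exact: cst_continuous.
by apply: continuousM => //; exact: cst_continuous.
Qed.

Let continuous_within (h : R -> R) s t : a <= s ->
  (forall x, a <= x -> {for x, continuous h}) -> {within `[s, t], continuous h}.
Proof.
move=> as_ hc; apply: continuous_in_subspaceT => x; rewrite inE/= in_itv/=.
by move=> /andP[sx _]; apply: hc; exact: le_trans sx.
Qed.

Let measurable_g s t : a <= s -> measurable_fun `[s, t] (EFin \o g).
Proof.
move=> as_; apply/measurable_EFinP; apply: subspace_continuous_measurable_fun => //.
exact: continuous_within.
Qed.

Let integral_g s t : a <= s -> s <= t -> t <= b ->
  (\int[lebesgue_measure]_(x in `[s, t]) (g x)%:E =
   (mp_primitive t - mp_primitive s)%:E)%E.
Proof.
move=> as_; rewrite le_eqVlt => /predU1P[-> tb|st tb].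
  by rewrite set_itv1 integral_set1 subrr.
have F x : x \in `]s, t[ -> is_derive x 1 mp_primitive (mp_density y x).
  rewrite in_itv/= => /andP[sx xt]; apply: is_derive_mp_primitive.
  by rewrite (le_lt_trans as_ sx) (lt_le_trans xt tb).
rewrite (@continuous_FTC2 _ g mp_primitive)//.
- exact: continuous_within.
- split.
  + by move=> x /F [].
  + by apply: cvg_at_right_filter; exact: continuous_mp_primitive.
  + apply: cvg_at_left_filter; apply: continuous_mp_primitive.
    exact: le_trans as_ (ltW st).
- move=> x xst; have D := F x xst; rewrite derive1E derive_val mp_densityE//.
  move: xst; rewrite in_itv/= => /andP[sx xt].
  by rewrite (le_trans as_ (ltW sx)) (le_trans (ltW xt) tb).
Qed.

Definition mp_clamp x := Order.max a (Order.min x b).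

Definition mp_cdf x := mp_primitive (mp_clamp x) - mp_primitive a.

Definition mp_bound_cdf (c : itv_bound R) : R :=
  match c with
  | BSide _ x => mp_cdf x
  | BInfty lo => if lo then 0 else 1
  end.

Lemma mp_clamp_id x : a <= x <= b -> mp_clamp x = x.
Proof. by move=> /andP[ax xb]; rewrite /mp_clamp min_l// max_r. Qed.

Lemma mp_clamp_itv x : a <= mp_clamp x <= b.
Proof. by rewrite /mp_clamp le_max lexx ge_max (ltW ab) ge_min lexx orbT. Qed.

Let bound_point (c : itv_bound R) :=
  match c with
  | BSide _ x => mp_clamp x
  | BInfty lo => if lo then a else b
  end.

Let bound_pointE c : mp_bound_cdf c = mp_primitive (bound_point c) - mp_primitive a.
Proof. by case: c => [//|[]]/=; rewrite ?subrr ?mp_primitive_total. Qed.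

Let bound_point_itv c : a <= bound_point c <= b.
Proof.
by case: c => [? ?|[]]/=; rewrite ?mp_clamp_itv// ?lexx ?(ltW ab).
Qed.

Let mp_clamp_le x z : x <= z -> mp_clamp x <= mp_clamp z.
Proof.
by move=> xz; rewrite /mp_clamp ge_max le_max lexx/= le_max le_min2 ?orbT.
Qed.

Let bound_point_le c1 c2 : (c1 <= c2)%O -> bound_point c1 <= bound_point c2.
Proof.
have /andP[A1 B1] := bound_point_itv c1; have /andP[A2 B2] := bound_point_itv c2.
move: c1 c2 A1 B1 A2 B2 => [l1 x1|[]] [l2 x2|[]]//= _ _ _ _.
by move/lteifW; exact: mp_clamp_le.
Qed.

(** Within [[a, b]] the interval lies between the open and the closed interval with the clamped
    ends, which have equal integrals; so the kind of the ends is irrelevant. The value 0 is for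
    empty intervals with reversed ends. *)
Lemma marchenko_pastur_itv c1 c2 : marchenko_pastur y [set` Interval c1 c2] =
  (if (c1 <= c2)%O then mp_bound_cdf c2 - mp_bound_cdf c1 else 0)%:E.
Proof.
case: ifPn => c12; last first.
  rewrite /marchenko_pastur set_itv_ge ?integral_set0//.
  by apply: contra c12 => /ltW.
pose s := bound_point c1; pose t := bound_point c2.
have st : s <= t := bound_point_le c12.
have /andP[as_ sb] : a <= s <= b := bound_point_itv c1.
have /andP[at_ tb] : a <= t <= b := bound_point_itv c2.
have -> : mp_bound_cdf c2 - mp_bound_cdf c1 = mp_primitive t - mp_primitive s.
  by rewrite !bound_pointE -/s -/t; ring.
rewrite -integral_g//.
have -> : marchenko_pastur y [set` Interval c1 c2] =
    (\int[lebesgue_measure]_(x in [set` Interval c1 c2] `&` `[a, b]) (g x)%:E)%E.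
  rewrite /marchenko_pastur integral_mkcondr; apply: eq_integral => x _.
  rewrite patchE; case: ifPn => xab.
    by rewrite mp_densityE//; move: xab; rewrite inE/= in_itv.
  by rewrite /mp_density indicE (negbTE xab) mulr0.
have sub1 : [set` Interval c1 c2] `&` `[a, b] `<=` `[s, t].
  move=> x [/=]; rewrite itv_boundlr => /andP[xc1 xc2]; rewrite !in_itv/= => xab.
  have := bound_point_le xc1; have := bound_point_le xc2.
  by rewrite /= !(mp_clamp_id xab) => -> ->.
have sub2 : `]s, t[ `<=` [set` Interval c1 c2] `&` `[a, b].
  move=> x /=; rewrite in_itv/= => /andP[sx xt].
  have xab : a <= x <= b.
    by rewrite (le_trans as_ (ltW sx)) (le_trans (ltW xt) tb).
  split; last by rewrite /= in_itv.
  rewrite /= itv_boundlr; apply/andP; split.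
    rewrite leNgt; apply: contraL sx => /ltW/bound_point_le/=.
    by rewrite mp_clamp_id// -leNgt.
  rewrite leNgt; apply: contraL xt => /ltW/bound_point_le/=.
  by rewrite mp_clamp_id// -leNgt.
have g0 x : a <= x -> (0 <= (g x)%:E)%E by move=> ax; rewrite lee_fin g_ge0.
have mI : measurable ([set` Interval c1 c2] `&` `[a, b]).
  by apply: measurableI.
apply/eqP; rewrite eq_le; apply/andP; split.
  apply: ge0_subset_integral => //; first exact: measurable_g.
  by move=> x /=; rewrite in_itv/= => /andP[sx _]; apply: g0; exact: le_trans sx.
have moo : measurable_fun `]s, t[ (EFin \o g).
  apply: (measurable_funS _ _ (@measurable_g s t as_)) => //.
  by move=> x /=; rewrite !in_itv/= => /andP[/ltW -> /ltW ->].
rewrite (@integral_itv_bndoo _ s t (EFin \o g) true false)//.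
apply: ge0_subset_integral => //; last first.
  by move=> x [_ /=]; rewrite in_itv/= => /andP[ax _]; exact: g0.
by apply: (measurable_funS _ sub1 (@measurable_g s t as_)).
Qed.

(** The density vanishes like a square root at the edges, so a strip of width [h^2] there has mass
    of order [h^3]. *)
Lemma mp_density_edge_le (h x : R) : 0 < h -> a <= x <= b ->
  x <= a + h ^+ 2 \/ b - h ^+ 2 <= x ->
  mp_density y x <= Num.sqrt (b - a) / (2 * pi * a * y) * h.
Proof.
move=> h0 /[dup] xab /andP[ax xb] edge; rewrite mp_densityE//.
have d_le : disc x <= Num.sqrt (b - a) * h.
  rewrite -[h in leRHS](ger0_norm (ltW h0)) -sqrtr_sqr -sqrtrM ?subr_ge0 ?(ltW ab)//.
  rewrite ler_wsqrtr//; case: edge => e; first by nra.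
  by nra.
have pi0 := pi_gt0 R.
have x0 : 0 < x by exact: lt_le_trans ax.
rewrite [leRHS]mulrAC; apply: ler_pM => //;
  rewrite ?invr_ge0 ?mulr_ge0 ?sqrtr_ge0 ?(ltW pi0) ?(ltW x0) ?(ltW y0)//.
have pos z : 0 < z -> 0 < 2 * pi * z * y by move=> z0; rewrite !mulr_gt0.
rewrite lef_pV2 ?posrE ?pos//.
by rewrite ler_wpM2r ?(ltW y0)// ler_wpM2l// mulr_ge0// ltW.
Qed.

Lemma mp_density_le x : mp_density y x <= (b - a) / (2 * pi * a * y).
Proof.
have pi0 := pi_gt0 R.
have K0 : 0 <= (b - a) / (2 * pi * a * y).
  have D : 0 < 2 * pi * a * y by rewrite mulr_gt0// mulr_gt0// mulr_gt0.
  by rewrite divr_ge0 ?(ltW D)// subr_ge0 ltW.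
have [xab|xab] := boolP (a <= x <= b); last first.
  rewrite /mp_density indicE [_ \in _](_ : _ = false) ?mulr0//.
  by apply/negbTE; rewrite notin_setE/= in_itv/=; exact/negP.
(* With [h = sqrt (b - a)] the edge strip is all of [[a, b]]. *)
have ba : 0 < Num.sqrt (b - a) by rewrite sqrtr_gt0 subr_gt0.
apply: le_trans (mp_density_edge_le ba xab _) _.
  left; rewrite sqr_sqrtr ?subr_ge0 ?(ltW ab)//; case/andP: xab => _ xb; lra.
by rewrite [leLHS]mulrAC -expr2 sqr_sqrtr// subr_ge0 ltW.
Qed.

Lemma mp_primitive_MVT s t : a <= s -> s <= t -> t <= b ->
  exists2 c, s <= c <= t &
    mp_primitive t - mp_primitive s = mp_density y c * (t - s).
Proof.
move=> as_ st tb.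
have [c cst E] : exists2 c, c \in `[s, t]%R &
    mp_primitive t - mp_primitive s = mp_density y c * (t - s).
  apply: MVT_segment => //; last first.
    by apply: continuous_within => // x; exact: continuous_mp_primitive.
  move=> x; rewrite in_itv/= => /andP[sx xt]; apply: is_derive_mp_primitive.
  by rewrite (le_lt_trans as_ sx) (lt_le_trans xt tb).
by exists c => //; move: cst; rewrite in_itv.
Qed.

Lemma mp_density_ge0 x : 0 <= mp_density y x.
Proof.
have [xab|xab] := boolP (a <= x <= b).
  by rewrite mp_densityE//; apply: g_ge0; case/andP: xab.
rewrite /mp_density indicE [_ \in _](_ : _ = false) ?mulr0//.
by apply/negbTE; rewrite notin_setE/= in_itv/=; exact/negP.
Qed.

Lemma mp_cdf_le s t : s <= t -> mp_cdf s <= mp_cdf t.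
Proof.
move=> st; rewrite lerB// -subr_ge0.
have /andP[A1 B1] := mp_clamp_itv s; have /andP[A2 B2] := mp_clamp_itv t.
have [c _ ->] := mp_primitive_MVT A1 (mp_clamp_le st) B2.
by rewrite mulr_ge0 ?mp_density_ge0// subr_ge0 mp_clamp_le.
Qed.

Lemma mp_cdf_a : mp_cdf a = 0.
Proof. by rewrite /mp_cdf mp_clamp_id ?subrr// lexx ltW. Qed.

Lemma mp_cdf_b : mp_cdf b = 1.
Proof. by rewrite /mp_cdf mp_clamp_id ?mp_primitive_total// lexx andbT ltW. Qed.

Lemma mp_cdf_itv x : 0 <= mp_cdf x <= 1.
Proof.
have /andP[A B] := mp_clamp_itv x.
have E : mp_cdf x = mp_cdf (mp_clamp x).
  by rewrite /mp_cdf [in RHS]mp_clamp_id ?A.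
by rewrite E -mp_cdf_a -mp_cdf_b !mp_cdf_le.
Qed.

End MarchenkoPastur.

(** * Removing the smoothing *)

Section Harmonic.
Variable R : realType.

Definition harmonic_sum (N : nat) : R := \sum_(0 <= i < N) i.+1%:R^-1.

Lemma harmonic_sum_le N : (0 < N)%N -> harmonic_sum N <= 1 + ln N%:R.
Proof.
case: N => // N _; elim: N => [|N IH].
  by rewrite /harmonic_sum big_nat1 invr1 ln1 addr0.
rewrite /harmonic_sum big_nat_recr//= -/(harmonic_sum N.+1).
apply: le_trans (lerD IH (lexx _)) _; rewrite -addrA lerD2l -lerBrDl.
have N1 : 0 < N.+1%:R :> R by rewrite ltr0n.
have N2 : 0 < N.+2%:R :> R by rewrite ltr0n.
have : ln (N.+1%:R / N.+2%:R : R) <= - N.+2%:R^-1.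
  have -> : N.+1%:R / N.+2%:R = 1 + - N.+2%:R^-1 :> R.
    have : N.+1%:R + 1 != 0 :> R by rewrite natr1 gt_eqF.
    by rewrite -[N.+2%:R]natr1 => ?; field.
  by apply: le_ln1Dx; rewrite ltrN2 invf_lt1// ltr1n.
by rewrite ln_div ?posrE// => le; rewrite -lerN2 opprB.
Qed.

Lemma harmonic_sum_mono M N : (M <= N)%N -> harmonic_sum M <= harmonic_sum N.
Proof.
move=> MN; rewrite /harmonic_sum [leRHS](big_cat_nat (leq0n M) MN)//= lerDl.
by apply: sumr_ge0 => i _; rewrite invr_ge0.
Qed.

(** Replacing [t] by its integer part [k] costs a factor 2; the terms on either side of [k] form
    part of a harmonic sum, which costs another 2. *)
Lemma sum_inv_dist_le (t : R) N : 0 <= t -> t < N%:R ->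
  \sum_(0 <= m < N) (1 + `|t - m%:R|)^-1 <= 4 * harmonic_sum N.
Proof.
move=> t0 tN; pose k := Num.truncn t.
have /andP[kt tk] : k%:R <= t < k.+1%:R by exact: truncn_itv.
have kN : (k < N)%N by rewrite -(ltr_nat R); exact: le_lt_trans tN.
have term (m : nat) : (1 + `|t - m%:R|)^-1 <= 2 * (1 + `|k%:R - m%:R|)^-1 :> R.
  rewrite -[2]invrK -invfM lef_pV2 ?posrE ?mulr_gt0 ?ltr_pwDl ?invr_gt0//.
  have : `|k%:R - m%:R| <= `|t - m%:R| + 1 :> R.
    have -> : k%:R - m%:R = (t - m%:R) - (t - k%:R) :> R by ring.
    apply: le_trans (ler_normB _ _) _; rewrite lerD2l ger0_norm ?subr_ge0//.
    by rewrite lerBlDl natr1 ltW.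
  have [->|km] := eqVneq k m; first by rewrite subrr normr0; have := normr_ge0 (t - m%:R); lra.
  have : 1 <= `|k%:R - m%:R| :> R.
    rewrite ler_normr; move: km; rewrite neq_ltn => /orP[].
      by rewrite -(ler_nat R) -natr1 => ?; apply/orP; right; lra.
    by rewrite -(ler_nat R) -natr1 => ?; apply/orP; left; lra.
  lra.
apply: le_trans (ler_sum _ (fun m _ => term m)) _.
rewrite -mulr_sumr (_ : 4 = 2 * 2); last by ring.
rewrite -mulrA ler_wpM2l// (big_cat_nat (n := k))//=; last exact: ltnW.
rewrite mulr_natl mulr2n lerD//.
  apply: le_trans (harmonic_sum_mono (ltnW kN)).
  rewrite big_nat_rev/= /harmonic_sum big_nat [leRHS]big_nat.
  apply: ler_sum => i /andP[_ ik]; rewrite add0n.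
  rewrite lef_pV2 ?posrE ?ltr_pwDl// -natrB ?leq_subr// normr_nat subKn// -natr1 addrC.
  by rewrite lerD2l lerDr.
apply: le_trans (harmonic_sum_mono (leq_subr k N)).
rewrite -{1}[k]add0n big_addn /harmonic_sum; apply: ler_sum => i _.
by rewrite natrD opprD addrCA subrr addr0 normrN normr_nat -natr1 addrC.
Qed.

End Harmonic.

Section Smoothing.
Variable R : realType.

(** The distribution function of the standard Cauchy law, whose density is [poisson 1]. *)
Definition arctan_cdf (u : R) : R := 2^-1 + atan u / pi.

Lemma arctan_cdf_itv u : 0 <= arctan_cdf u <= 1.
Proof.
have pi0 := pi_gt0 R; rewrite /arctan_cdf.
have A : atan u / pi <= 2^-1.
  by rewrite ler_pdivrMr// mulrC ltW// atan_ltpi2.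
have B : - 2^-1 <= atan u / pi.
  by rewrite ler_pdivlMr// mulNr mulrC ltW// atan_gtNpi2.
apply/andP; split; lra.
Qed.

Lemma atan_le_id (w : R) : 0 <= w -> atan w <= w.
Proof.
move=> w0.
have [c _ E] : exists2 c, c \in `[0, w]%R & atan w - atan 0 = (1 + c ^+ 2)^-1 * (w - 0).
  apply: MVT_segment => //.
  by apply: continuous_subspaceT; exact: continuous_atan.
move: E; rewrite atan0 !subr0 => ->; apply: ler_piMl => //.
by rewrite invf_le1 ?ltr_pwDl ?sqr_ge0// lerDl sqr_ge0.
Qed.

Lemma atan_inv (u : R) : 0 < u -> atan u^-1 = pi / 2 - atan u.
Proof.
move=> u0; set x := atan u.
have x0 : 0 < x by rewrite -(atan0 R) lt_atan.
have xpi : x < pi / 2 by exact: atan_ltpi2.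
have pi0 := pi_gt0 R.
rewrite -[RHS]tanK; last by rewrite in_itv/=; apply/andP; split; lra.
congr atan; rewrite /tan sinB cosB sin_pihalf cos_pihalf !mul1r !mul0r subr0 add0r.
by rewrite -[u](atanK u) -/x /tan invf_div.
Qed.

Lemma arctan_cdfN u : arctan_cdf (- u) = 1 - arctan_cdf u.
Proof. by rewrite /arctan_cdf atanN; lra. Qed.

Lemma arctan_cdf_ge_half u : 0 <= u -> 2^-1 <= arctan_cdf u.
Proof.
move=> u0; rewrite /arctan_cdf lerDl divr_ge0 ?pi_ge0//.
by rewrite -(atan0 R) le_atan.
Qed.

(** For [u <= 1] the tail is at most 1/2. For [u > 1] it is [atan (1 / u) / pi <= 1 / (pi u)], and
    [pi >= 2] gives [1 + u <= pi u]. *)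
Lemma arctan_cdf_tail u : 0 <= u -> 1 - arctan_cdf u <= (1 + u)^-1.
Proof.
move=> u0; have [u1|u1] := leP u 1.
  have := arctan_cdf_ge_half u0.
  have : 2^-1 <= (1 + u)^-1 by rewrite lef_pV2 ?posrE; lra.
  lra.
have pi2 := pi_ge2 R; have pi0 := pi_gt0 R.
have u0' : 0 < u by lra.
have -> : 1 - arctan_cdf u = atan u^-1 / pi.
  rewrite atan_inv// /arctan_cdf mulrBl.
  have -> : pi / 2 / pi = 2^-1 :> R by rewrite mulrAC divff ?mul1r// gt_eqF.
  lra.
rewrite ler_pdivrMr//; apply: le_trans (atan_le_id _) _; first by rewrite invr_ge0.
have uu : 0 < u * (1 + u) by rewrite mulr_gt0//; lra.
rewrite -subr_ge0 (_ : _ - _ = (u * pi - (1 + u)) / (u * (1 + u))).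
  rewrite divr_ge0 ?(ltW uu)// subr_ge0.
  have : u * 2 <= u * pi by rewrite ler_wpM2l// ltW.
  lra.
move: (pi : R) => q; field; move: uu; rewrite pmulr_rgt0// => uu.
by rewrite !gt_eqF.
Qed.

(** [s] is free when [l = x], where the bound is 1; thus strict and weak counting are treated at
    once. *)
Lemma step_arctan_cdf (v x l : R) (s : bool) : 0 < v ->
  (l < x -> s) -> (x < l -> ~~ s) ->
  `|s%:R - arctan_cdf ((x - l) / v)| <= (1 + `|x - l| / v)^-1.
Proof.
move=> v0 s1 s0; have /andP[A B] := arctan_cdf_itv ((x - l) / v).
have [lx|xl|E] := ltgtP l x.
- rewrite s1//= ger0_norm ?subr_ge0// [`|x - l|]ger0_norm ?subr_ge0 ?(ltW lx)//.
  by apply: arctan_cdf_tail; rewrite divr_ge0 ?subr_ge0 ?(ltW lx) ?(ltW v0).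
- rewrite (negbTE (s0 xl))/= sub0r normrN ger0_norm//.
  rewrite [`|x - l|]ler0_norm ?subr_le0 ?(ltW xl)// -[leLHS](subKr 1) -arctan_cdfN -mulNr.
  by apply: arctan_cdf_tail; rewrite divr_ge0 ?oppr_ge0 ?subr_le0 ?(ltW xl) ?(ltW v0).
- rewrite E subrr normr0 mul0r addr0 invr1; case: (s) => /=; rewrite ler_norml;
  apply/andP; split; move: A B; rewrite E subrr mul0r; lra.
Qed.

Lemma is_derive_arctan_cdf (v x l : R) : 0 < v ->
  is_derive x 1 (fun t => arctan_cdf ((t - l) / v)) (poisson v (x - l)).
Proof.
move=> v0; have pi0 := pi_gt0 R.
have D : is_derive x 1 (fun t : R => (t - l) / v) v^-1.
  by apply: is_derive_eq; rewrite -![_ *: _]/(_ * _); ring.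
have A := @is_derive1_comp _ atan _ x _ _ (is_derive1_atan _) D.
have AA : is_derive x 1 (fun t => atan ((t - l) / v)) 
   ((1 + ((x - l) / v) ^+ 2)^-1 / v) by exact: A.
rewrite /arctan_cdf; apply: is_derive_eq; rewrite -![_ *: _]/(_ * _).
rewrite mulr0 !add0r /poisson.
have D0 : v ^+ 2 + (x - l) ^+ 2 != 0.
  by rewrite gt_eqF// ltr_pwDl ?sqr_ge0// exprn_gt0.
by move: (pi : R) pi0 => q q0; field; rewrite !gt_eqF// addrC ltr_pwDl ?sqr_ge0// exprn_gt0.
Qed.

Lemma is_derive_sum_seq (T : Type) (s : seq T) (F dF : T -> R -> R) (x : R) :
  (forall t, is_derive x 1 (F t) (dF t x)) ->
  is_derive x 1 (fun u => \sum_(t <- s) F t u) (\sum_(t <- s) dF t x).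
Proof.
move=> FdF; elim: s => [|t s IH].
  rewrite big_nil; under eq_fun do rewrite big_nil; exact: is_derive_cst.
by rewrite big_cons; under eq_fun do rewrite big_cons; exact: is_deriveD.
Qed.

Lemma is_derive_avg (T : finType) (F dF : T -> R -> R) (x : R) :
  (forall t, is_derive x 1 (F t) (dF t x)) ->
  is_derive x 1 (fun u => avg (fun t => F t u)) (avg (fun t => dF t x)).
Proof.
move=> FdF; have S := is_derive_sum_seq (index_enum T) FdF.
by rewrite /avg; apply: is_derive_eq.
Qed.

End Smoothing.

Section Unsmoothing.
Variables (R : realType) (y : R).
Hypothesis y01 : 0 < y < 1.
Local Notation a := (mp_left y).
Local Notation b := (mp_right y).
Variables (J : finType) (at_ : J -> R) (v h kappa : R).
Hypotheses (J0 : (0 < #|J|)%N) (v0 : 0 < v) (h0 : 0 < h) (kappa0 : 0 <= kappa).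
Hypothesis hab : 2 * h ^+ 2 <= b - a.
Hypothesis dens : forall x : R, a + h ^+ 2 <= x <= b - h ^+ 2 ->
  `|avg (fun j => poisson v (x - at_ j)) - mp_density y x| <= kappa.

Let xl := a + h ^+ 2.
Let xr := b - h ^+ 2.
Let f (x : R) : R := avg (fun j => arctan_cdf ((x - at_ j) / v)).
Let tau := Num.sqrt (b - a) / (2 * pi * a * y) * h ^+ 3.
Let beta := 2 * tau + (b - a) * kappa.

Let ab : a < b := mp_left_lt_right y01.
Let a0 : 0 < a := mp_left_gt0 y01.
Let y0 : 0 < y. Proof. by case/andP: y01. Qed.
Let h2 : 0 < h ^+ 2. Proof. exact: exprn_gt0. Qed.
Let xlr : xl <= xr. Proof. by rewrite /xl /xr; move: hab; lra. Qed.

Let D0 : 0 < 2 * pi * a * y.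
Proof. by rewrite mulr_gt0// mulr_gt0// mulr_gt0// pi_gt0. Qed.

Let tau0 : 0 <= tau.
Proof. by rewrite mulr_ge0 ?exprn_ge0 ?(ltW h0)// divr_ge0 ?sqrtr_ge0// ltW. Qed.

Let beta0 : 0 <= beta.
Proof. by apply: addr_ge0; apply: mulr_ge0 => //; rewrite subr_ge0 ltW. Qed.

Let cdfE x : a <= x <= b -> mp_cdf y x = mp_primitive y x - mp_primitive y a.
Proof. by move=> xab; rewrite /mp_cdf mp_clamp_id. Qed.

Let is_derive_f (x : R) : is_derive x 1 f (avg (fun j => poisson v (x - at_ j))).
Proof.
apply: (is_derive_avg (F := fun j t => arctan_cdf ((t - at_ j) / v))
  (dF := fun j t => poisson v (t - at_ j))) => j.
exact: is_derive_arctan_cdf.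
Qed.

Let f_itv x : 0 <= f x <= 1.
Proof.
apply/andP; split.
  by apply: avg_ge0 => j; case/andP: (arctan_cdf_itv ((x - at_ j) / v)).
rewrite -[leRHS](avg_cst 1 J0); apply: le_avg => j.
by case/andP: (arctan_cdf_itv ((x - at_ j) / v)).
Qed.

Let f_incr s t : xl <= s -> s <= t -> t <= xr ->
  `|(f t - f s) - (mp_cdf y t - mp_cdf y s)| <= (b - a) * kappa.
Proof.
move=> ls st tr.
have as_ : a <= s by rewrite (le_trans _ ls)// lerDl ltW.
have tb : t <= b by rewrite (le_trans tr)// /xr gerBl ltW.
have at' : a <= t <= b by rewrite tb andbT (le_trans as_).
have as' : a <= s <= b by rewrite as_ (le_trans st).
have D x : x \in `]s, t[%R -> is_derive x 1 (fun u => f u - mp_primitive y u)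
    (avg (fun j => poisson v (x - at_ j)) - mp_density y x).
  rewrite in_itv/= => /andP[sx xt].
  have Df := is_derive_f x.
  have Dp : is_derive x 1 (mp_primitive y) (mp_density y x).
    apply: is_derive_mp_primitive => //.
    by rewrite (le_lt_trans as_ sx) (lt_le_trans xt tb).
  exact: is_deriveB.
have [] := MVT_segment st D.
  apply: continuous_in_subspaceT => x; rewrite inE/= in_itv/= => /andP[sx xt].
  apply: continuousB; last first.
    by apply: continuous_mp_primitive => //; exact: le_trans sx.
  apply/differentiable_continuous; rewrite -derivable1_diffP.
  by have [] := is_derive_f x.
move=> c; rewrite in_itv/= => /andP[sc ct] E.
rewrite !cdfE// (_ : _ - _ = (f t - mp_primitive y t) - (f s - mp_primitive y s));
  last by ring.
rewrite E normrM [X in _ * X]ger0_norm ?subr_ge0// mulrC.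
apply: ler_pM; rewrite ?subr_ge0//; first by lra.
by apply: dens; rewrite (le_trans ls sc) (le_trans ct tr).
Qed.

Let tauE : tau = Num.sqrt (b - a) / (2 * pi * a * y) * h * h ^+ 2.
Proof. by rewrite /tau [h ^+ 3]exprS mulrA. Qed.

Let cdf_left : mp_cdf y xl <= tau.
Proof.
have axl : a <= xl by rewrite lerDl ltW.
have xlb : xl <= b by rewrite (le_trans xlr)// gerBl ltW.
rewrite cdfE ?axl// ; have [c /andP[ac cx] ->] := mp_primitive_MVT y01 (lexx a) axl xlb.
rewrite /xl addrAC subrr add0r tauE.
rewrite ler_wpM2r ?(ltW h2)//; apply: mp_density_edge_le => //; last by left.
by rewrite ac (le_trans cx).
Qed.

Let cdf_right : 1 - mp_cdf y xr <= tau.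
Proof.
have axr : a <= xr by rewrite (le_trans _ xlr)// lerDl ltW.
have xrb : xr <= b by rewrite gerBl ltW.
rewrite -(mp_cdf_b y01) !cdfE ?axr ?lexx ?(ltW ab)//.
rewrite opprB addrA subrK.
have [c /andP[ac cx] ->] := mp_primitive_MVT y01 axr xrb (lexx b).
rewrite /xr opprB addrC subrK tauE.
rewrite ler_wpM2r ?(ltW h2)//; apply: mp_density_edge_le => //; last by right.
by rewrite cx (le_trans axr).
Qed.

(** From [xl] to [xr] the limit gains at least [1 - 2 * tau], hence [f] gains at least [1 - beta];
    as [f] stays in [[0, 1]], at most [beta] is left for each side. *)
Let f_edges : f xl <= beta /\ 1 - f xr <= beta.
Proof.
have := f_incr (lexx xl) xlr (lexx xr).
rewrite ler_norml => /andP[A _]; have := cdf_left; have := cdf_right.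
have /andP[B1 B2] := f_itv xl; have /andP[B3 B4] := f_itv xr.
by move=> H1 H2; rewrite /beta; split; lra.
Qed.

Let f_close x : xl <= x -> x <= xr -> `|f x - mp_cdf y x| <= 2 * beta.
Proof.
move=> lx xr_; have := f_incr (lexx xl) lx xr_; rewrite !ler_norml => /andP[A B].
have [E _] := f_edges; have := cdf_left.
have /andP[B1 B2] := f_itv xl; have /andP[C1 C2] := mp_cdf_itv y01 xl.
have := tau0; have bk : 0 <= (b - a) * kappa by rewrite mulr_ge0// subr_ge0 ltW.
by rewrite /beta in E *; move=> H1 H2; apply/andP; split; lra.
Qed.

(** An atom at or left of [xl] contributes at least 1/2 to [f xl]. *)
Let out_left : avg (fun j => (at_ j <= xl)%R%:R) <= 2 * beta.
Proof.
apply: (@le_trans _ _ (2 * f xl)); last by have [] := f_edges; lra.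
rewrite /f -avgZ; apply: le_avg => j.
have /andP[A _] := arctan_cdf_itv ((xl - at_ j) / v).
have [jx|jx] := leP (at_ j) xl; last by rewrite mulr_ge0.
have : 2^-1 <= arctan_cdf ((xl - at_ j) / v).
  by apply: arctan_cdf_ge_half; rewrite divr_ge0 ?subr_ge0// ltW.
by rewrite /=; lra.
Qed.

Let out_right : avg (fun j => (xr <= at_ j)%R%:R) <= 2 * beta.
Proof.
apply: (@le_trans _ _ (2 * (1 - f xr))); last by have [] := f_edges; lra.
rewrite /f -[X in 2 * (X - _)](avg_cst 1 J0) -avgB -avgZ; apply: le_avg => j.
have /andP[_ A] := arctan_cdf_itv ((xr - at_ j) / v).
have [jx|jx] := leP xr (at_ j); last by rewrite mulr_ge0// subr_ge0.
have : 2^-1 <= arctan_cdf (- ((xr - at_ j) / v)).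
  by apply: arctan_cdf_ge_half; rewrite -mulNr divr_ge0 ?oppr_ge0 ?subr_le0// ltW.
by rewrite arctan_cdfN /=; lra.
Qed.

Let N := (Num.truncn ((xr - xl) / v)).+1.
Let E_ m := xl + m%:R * v.

(* Each atom of the bulk lies within [v] of a point of the grid [E_ m], where
   the Poisson kernel is at least [1 / (2 pi v)]. *)
Let grid_bound x l : xl <= x <= xr ->
  (1 + `|x - l| / v)^-1 <= (l <= xl)%R%:R + (xr <= l)%R%:R +
    \sum_(0 <= m < N) 4 * v * pi * (1 + `|x - E_ m| / v)^-1 * poisson v (E_ m - l).
Proof.
move=> /andP[lx xr_]; have pi0 := pi_gt0 R.
have inv1 : (1 + `|x - l| / v)^-1 <= 1.
  have w0 : 0 <= `|x - l| / v by rewrite divr_ge0// ltW.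
  by rewrite invf_le1 ?ltr_pwDl// lerDl.
have inv0 m : 0 < (1 + `|x - E_ m| / v)^-1.
  by rewrite invr_gt0 ltr_pwDl// divr_ge0// ltW.
have pp m : 0 <= 4 * v * pi * (1 + `|x - E_ m| / v)^-1 * poisson v (E_ m - l).
  rewrite mulr_ge0 ?(ltW (inv0 m))//.
    by rewrite mulr_ge0 ?(ltW (inv0 m))// mulr_ge0 ?mulr_ge0 ?(ltW v0) ?(ltW pi0).
  by rewrite divr_ge0 ?(ltW v0)// mulr_ge0 ?(ltW pi0)// addr_ge0 ?sqr_ge0.
have S0 : 0 <= \sum_(0 <= m < N)
    4 * v * pi * (1 + `|x - E_ m| / v)^-1 * poisson v (E_ m - l).
  by apply: sumr_ge0 => m _.
have [ll|ll] := leP l xl.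
  by rewrite (le_trans inv1)// -addrA lerDl addr_ge0.
have [rl|rl] := leP xr l.
  by rewrite (le_trans inv1)// /= add0r lerDl.
rewrite !add0r; pose m := Num.truncn ((l - xl) / v).
have /andP[m1 m2] : m%:R <= (l - xl) / v < m.+1%:R.
  by apply: truncn_itv; rewrite divr_ge0 ?subr_ge0 ?(ltW ll) ?(ltW v0).
have mN : (m < N)%N.
  by rewrite ltnS /m; apply: le_truncn; rewrite ler_wpM2r ?invr_ge0 ?(ltW v0)// lerD2r ltW.
rewrite (big_cat_nat (n := m)) ?(ltnW mN)//= [X in _ <= _ + X]big_ltn//.
have S1 : 0 <= \sum_(0 <= i < m)
    4 * v * pi * (1 + `|x - E_ i| / v)^-1 * poisson v (E_ i - l).
  by apply: sumr_ge0 => i _.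
have S2 : 0 <= \sum_(m.+1 <= i < N)
    4 * v * pi * (1 + `|x - E_ i| / v)^-1 * poisson v (E_ i - l).
  by apply: sumr_ge0 => i _.
apply: (@le_trans _ _ (4 * v * pi * (1 + `|x - E_ m| / v)^-1 * poisson v (E_ m - l)));
  last by rewrite addrCA lerDl addr_ge0.
have lE : 0 <= l - E_ m <= v.
  move: m1 m2; rewrite ler_pdivlMr// ltr_pdivrMr// -natr1 mulrDl mul1r /E_.
  by move=> ? ?; apply/andP; split; lra.
have p_ge : (2 * pi * v)^-1 <= poisson v (E_ m - l).
  rewrite /poisson -[leRHS]invf_div lef_pV2 ?posrE ?divr_gt0 ?mulr_gt0//; last first.
    by rewrite ltr_wpDl ?sqr_ge0// exprn_gt0.
  rewrite ler_pdivrMr//.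
  have : (E_ m - l) ^+ 2 <= v ^+ 2 by case/andP: lE => ? ?; nra.
  move=> sq; rewrite (_ : 2 * pi * v * v = pi * (v ^+ 2 + v ^+ 2)); last by ring.
  by rewrite ler_wpM2l ?(ltW pi0)// lerD2r.
(* The constant 4 is a factor 2 for replacing [l] by the grid point in the weight, and a factor 2
   from the lower bound [1 / (2 pi v)] of the kernel. *)
apply: (@le_trans _ _ (2 * (1 + `|x - E_ m| / v)^-1)); last first.
  have -> : 2 * (1 + `|x - E_ m| / v)^-1 =
      4 * v * pi * (1 + `|x - E_ m| / v)^-1 * (2 * pi * v)^-1.
    move: (pi : R) pi0 ((1 + _)^-1) => q q0 t; field; by rewrite !gt_eqF.
  by rewrite ler_wpM2l// mulr_ge0 ?(ltW (inv0 m))// mulr_ge0 ?mulr_ge0 ?(ltW v0) ?(ltW pi0).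
rewrite -[2]invrK -invfM lef_pV2 ?posrE ?mulr_gt0 ?ltr_pwDl ?divr_ge0 ?invr_gt0 ?(ltW v0)//.
have : `|x - E_ m| <= `|x - l| + v.
  have -> : x - E_ m = (x - l) + (l - E_ m) by ring.
  apply: le_trans (ler_normD _ _) _; rewrite lerD2l ger0_norm; by case/andP: lE.
rewrite -(ler_pM2r (_ : 0 < v^-1)) ?invr_gt0// [leRHS]mulrDl divff ?gt_eqF//.
have : 0 <= `|x - l| / v by rewrite divr_ge0// ltW.
lra.
Qed.

Let M := (b - a) / (2 * pi * a * y) + kappa.

(** Bulk atoms are charged to grid points, where the smoothed density is at most [M]; the remaining
    weights form a harmonic sum, hence the logarithm. The 16 is the 4 of [grid_bound] times the 4 of
    [sum_inv_dist_le], and [4 * beta] pays for the atoms outside the bulk. *)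
Let avg_tail x : xl <= x <= xr ->
  avg (fun j => (1 + `|x - at_ j| / v)^-1) <=
  4 * beta + 16 * pi * v * M * (1 + ln N%:R).
Proof.
move=> xlr'; have pi0 := pi_gt0 R.
have M0 : 0 <= M by rewrite addr_ge0// divr_ge0 ?subr_ge0 ?(ltW ab) ?(ltW D0).
apply: le_trans (le_avg (fun j => grid_bound (at_ j) xlr')) _.
rewrite !avgD avg_sum.
apply: lerD; first by have := out_left; have := out_right; lra.
have dens_le m : (m < N)%N -> avg (fun j => poisson v (E_ m - at_ j)) <= M.
  move=> mN; have Em : xl <= E_ m <= xr.
    rewrite lerDl mulr_ge0 ?(ltW v0)//= /E_ -lerBrDl -ler_pdivlMr//.
    have t0 : 0 <= (xr - xl) / v by rewrite divr_ge0 ?subr_ge0 ?(ltW v0).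
    have /andP[+ _] := truncn_itv t0; apply: le_trans.
    by rewrite ler_nat -ltnS.
  have := dens Em; rewrite ler_norml => /andP[_].
  have := mp_density_le y01 (E_ m); rewrite /M; lra.
apply: (@le_trans _ _ (\sum_(0 <= m < N)
    4 * v * pi * M * (1 + `|(x - xl) / v - m%:R|)^-1)).
  rewrite big_nat [leRHS]big_nat; apply: ler_sum => m /andP[_ mN].
  rewrite avgZ.
  have -> : `|(x - xl) / v - m%:R| = `|x - E_ m| / v.
    rewrite -[v in RHS](gtr0_norm v0) -normf_div; congr `|_|.
    by rewrite /E_; field; rewrite gt_eqF.
  rewrite [leRHS]mulrAC ler_wpM2l ?dens_le//.
  rewrite mulr_ge0 ?invr_ge0 ?addr_ge0 ?divr_ge0 ?(ltW v0)//.
  by rewrite mulr_ge0 ?mulr_ge0 ?(ltW v0) ?(ltW pi0).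
rewrite -mulr_sumr.
have t0 : 0 <= (x - xl) / v.
  by case/andP: xlr' => ? _; rewrite divr_ge0 ?subr_ge0 ?(ltW v0).
have tN : (x - xl) / v < N%:R.
  apply: le_lt_trans (truncnS_gt _).
  by case/andP: xlr' => _ ?; rewrite ler_wpM2r ?invr_ge0 ?(ltW v0)// lerD2r.
have K0 : 0 <= 4 * v * pi * M.
  by rewrite mulr_ge0// mulr_ge0 ?(ltW pi0)// mulr_ge0// ltW.
apply: le_trans (ler_wpM2l K0 (sum_inv_dist_le t0 tN)) _.
have -> : 16 * pi * v * M * (1 + ln N%:R) = 4 * v * pi * M * (4 * (1 + ln N%:R)).
  by move: (pi : R) (ln _) => q q'; ring.
by rewrite ler_wpM2l// ler_wpM2l// harmonic_sum_le.
Qed.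

(** In the bulk, [2 * beta] separates the smoothed function from the limit and [avg_tail] separates
    it from the count. *)
Lemma unsmoothing (c : itv_bound R) :
  `|avg (fun j => (below c (at_ j))%:R) - mp_bound_cdf y c| <=
    6 * beta + 16 * pi * v * M * (1 + ln N%:R).
Proof.
have pi0 := pi_gt0 R.
have M0 : 0 <= M by rewrite addr_ge0// divr_ge0 ?subr_ge0 ?(ltW ab) ?(ltW D0).
have T0 : 0 <= 16 * pi * v * M * (1 + ln N%:R).
  rewrite mulr_ge0//; first by rewrite mulr_ge0// mulr_ge0 ?(ltW v0)// mulr_ge0// ltW.
  by rewrite addr_ge0// ln_ge0// ler1n.
set T := 16 * pi * v * M * (1 + ln N%:R) in T0 *.
have B0 := beta0.
case: c => [s x|[]] /=; last 2 first.
- have -> : avg (fun j => (below -oo%O (at_ j))%:R) = 0 :> R by exact: (avg_cst 0 J0).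
  by rewrite subrr normr0 addr_ge0// mulr_ge0.
- have -> : avg (fun j => (below +oo%O (at_ j))%:R) = 1 :> R by exact: (avg_cst 1 J0).
  by rewrite subrr normr0 addr_ge0// mulr_ge0.
have below_lt l : l < x -> below (BSide s x) l.
  by move=> lx; rewrite /below; case: (s); rewrite bnd_simp// ltW.
have below_gt l : x < l -> ~~ below (BSide s x) l.
  by move=> xl'; rewrite /below -ltNge; case: (s); rewrite bnd_simp// ltW.
have F0 : 0 <= avg (fun j => (below (BSide s x) (at_ j))%:R) :> R.
  exact: avg_ge0.
(* Outside [[xl, xr]] the count and the limit are compared through their common extreme value: to
   the left the count is at most [2 * beta] and the limit at most [tau], and symmetrically for the
   complements to the right. *)
have [xlx|xlx] := ltP x xl.
  have : avg (fun j => (below (BSide s x) (at_ j))%:R) <= 2 * beta.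
    apply: le_trans out_left; apply: le_avg => j.
    have [//|lj] := leP (at_ j) xl.
      by case: (below _ _).
    by rewrite (negbTE (below_gt _ _))//; exact: lt_trans lj.
  have := cdf_left; have /andP[A _] := mp_cdf_itv y01 x.
  have := mp_cdf_le y01 (ltW xlx); have := tau0.
  have : 2 * tau <= beta by rewrite lerDl mulr_ge0// subr_ge0 ltW.
  by move=> H1 H2 H3 H4 H5; rewrite ler_norml; apply/andP; split; lra.
have [xrx|xrx] := ltP xr x.
  have : 1 - avg (fun j => (below (BSide s x) (at_ j))%:R) <= 2 * beta.
    rewrite -[X in X - _](avg_cst 1 J0) -avgB.
    apply: le_trans out_right; apply: le_avg => j.
    have [rj|rj] := leP xr (at_ j).
      by rewrite gerBl.
    by rewrite below_lt ?subrr//; exact: lt_trans xrx.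
  have F1 : avg (fun j => (below (BSide s x) (at_ j))%:R) <= 1 :> R.
    rewrite -[leRHS](avg_cst 1 J0); apply: le_avg => j.
    by case: (below _ _).
  have := cdf_right; have /andP[_ A] := mp_cdf_itv y01 x.
  have := mp_cdf_le y01 (ltW xrx); have := tau0.
  have : 2 * tau <= beta by rewrite lerDl mulr_ge0// subr_ge0 ltW.
  by move=> H1 H2 H3 H4 H5; rewrite ler_norml; apply/andP; split; lra.
have close := f_close xlx xrx.
have tail : `|avg (fun j => (below (BSide s x) (at_ j))%:R) - f x| <= 4 * beta + T.
  apply: le_trans (@avg_tail x _); last by rewrite xlx xrx.
  rewrite /f -avgB; apply: le_trans (norm_avg _) _; apply: le_avg => j.
  apply: step_arctan_cdf => //; [exact: below_lt|exact: below_gt].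
rewrite -[X in `|X|](subrKA (f x)).
apply: le_trans (ler_normD _ _) _; lra.
Qed.

End Unsmoothing.

(** * Expectation and concentration of the counting function *)

Section ExpectedCount.
Variables (R : realType) (y : R).
Hypothesis y01 : 0 < y < 1.
Local Notation a := (mp_left y).
Local Notation b := (mp_right y).

Lemma below_countE p (A : 'M[R]_p) c : A^T = A ->
  below_count A c = avg (fun i : 'I_p => (below c (eigenvalues A)`_i)%:R).
Proof.
move=> As; rewrite (avg_eigenvalues (fun l => (below c l)%:R) As) /below_count mulrC.
congr (_ * _); elim: (eigenvalues A) => [|l s IH]; first by rewrite big_nil.
by rewrite big_cons /= natrD IH.
Qed.

(** The grid has at most [(1 + L) / u^4] points, and [ln (1 / u) <= 1 / u]. This crude bound is
    affordable because it gets multiplied by [v = u^4]. *)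
Lemma grid_size_le (L u : R) : 0 <= L -> 0 < u <= 1 ->
  ln (Num.truncn ((L - 2 * u ^+ 2) / u ^+ 4)).+1%:R <= L + 4 / u.
Proof.
move=> L0 /andP[u0 u1].
have u4 : 0 < u ^+ 4 by rewrite exprn_gt0.
have u41 : u ^+ 4 <= 1 by rewrite exprn_ile1// ltW.
have N_le : (Num.truncn ((L - 2 * u ^+ 2) / u ^+ 4)).+1%:R <= (1 + L) / u ^+ 4.
  rewrite -natr1; have [t0|t0] := leP 0 ((L - 2 * u ^+ 2) / u ^+ 4).
    have /andP[+ _] := truncn_itv t0.
    have : (L - 2 * u ^+ 2) / u ^+ 4 + 1 <= (1 + L) / u ^+ 4.
      rewrite -[X in _ + X](divff (lt0r_neq0 u4)) -mulrDl ler_wpM2r ?invr_ge0 ?(ltW u4)//.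
      have : 0 <= u ^+ 2 by rewrite sqr_ge0.
      lra.
    lra.
  have -> : Num.truncn ((L - 2 * u ^+ 2) / u ^+ 4) = 0%N.
    by apply/eqP; rewrite -leqn0 truncn_le_nat (lt_trans t0).
  by rewrite add0r ler_pdivlMr// mul1r; lra.
apply: (@le_trans _ _ (ln ((1 + L) / u ^+ 4))).
  by rewrite ler_ln ?posrE ?divr_gt0//; lra.
have uV : 0 < u^-1 by rewrite invr_gt0.
have L1 : 0 < 1 + L by lra.
rewrite -exprVn lnM ?posrE ?exprn_gt0//.
apply: lerD; first by apply: le_ln1Dx; lra.
rewrite lnXn// -[ln _ *+ _]mulr_natl ler_wpM2l//.
have : ln (1 + (u^-1 - 1)) <= u^-1 - 1 by apply: le_ln1Dx; lra.
rewrite addrCA subrr addr0; lra.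
Qed.

Lemma expected_count : exists K u0 : R, [/\ 0 < K, 0 < u0 &
  forall (p n : nat) (V : {vspace 'rV['F_2]_n}) (u : R) (c : itv_bound R),
    (0 < p)%N -> (0 < n)%N -> p%:R / n%:R = y ->
    (5%:E <= dual_distance R V)%E ->
    0 < u <= u0 -> n%:R * u ^+ 12 = 1 ->
    `|avg (fun w : {ffun 'I_p -> codeword V} => below_count (gram R (word_mx w)) c)
      - mp_bound_cdf y c| <= K * u ^+ 3].
Proof.
have a0 := mp_left_gt0 y01; have ab := mp_left_lt_right y01.
have [y0 y1] := andP y01; have pi0 := pi_gt0 R.
have [K1 [u1 [K10 u10 density]]] := density_estimate y01.
have D0 : 0 < 2 * pi * a * y by rewrite mulr_gt0// mulr_gt0// mulr_gt0.
pose L := b - a.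
have L0 : 0 < L by rewrite subr_gt0.
pose T := Num.sqrt L / (2 * pi * a * y).
have T0 : 0 <= T by rewrite divr_ge0 ?sqrtr_ge0// ltW.
pose M := L / (2 * pi * a * y) + K1.
have M0 : 0 < M by rewrite addr_gt0// divr_gt0.
(* In order: [6 * beta] with [tau = T u^3] and [kappa = K1 u^3], the logarithmic term, and the
   change from 0-1 to sign matrices, [2 / p <= (2 / y) u^3]. *)
pose K := 6 * (2 * T + L * K1) + 16 * pi * M * (5 + L) + 2 / y.
have K0 : 0 < K.
  rewrite ltr_wpDl ?divr_gt0// addr_ge0//.
    by rewrite mulr_ge0// addr_ge0// mulr_ge0// ltW.
  have : 0 <= 5 + L by lra.
  by move=> ?; rewrite mulr_ge0// mulr_ge0 ?(ltW M0)// mulr_ge0// ltW.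
(* The bound [L / 2] on [u] leaves a bulk: [2 u^2 <= 2 u <= L]. *)
exists K, (Num.min u1 (Num.min 1 (L / 2))); split => //.
  by rewrite !lt_min u10 ltr01 divr_gt0.
move=> p n V u c p0 n0 pn dV /andP[u0]; rewrite !le_min => /and3P[uu1 u1' uL] nu.
have u2 : u ^+ 2 <= u by rewrite expr2 ler_piMl// ltW.
have u3 : 0 < u ^+ 3 by rewrite exprn_gt0.
have u4 : 0 < u ^+ 4 by rewrite exprn_gt0.
have u31 : u ^+ 3 <= 1 by rewrite exprn_ile1// ltW.
have V0 := codeword_gt0 V.
(* The mean spectral measure is the uniform measure on atoms indexed by pairs of a sample and an
   eigenvalue index. *)
pose J := ({ffun 'I_p -> codeword V} * 'I_p)%type.
pose at_ (j : J) := (eigenvalues (sign_gram R j.1))`_j.2.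
have J0 : (0 < #|{: J}|)%N.
  by rewrite card_prod card_ffun card_ord muln_gt0 expn_gt0 V0 p0.
have hab : 2 * u ^+ 2 <= b - a by rewrite -/L; lra.
have dens x : a + u ^+ 2 <= x <= b - u ^+ 2 ->
    `|avg (fun j => poisson (u ^+ 4) (x - at_ j)) - mp_density y x| <= K1 * u ^+ 3.
  move=> xab; rewrite (avg_pair (fun (w : {ffun 'I_p -> codeword V}) (i : 'I_p) =>
    poisson (u ^+ 4) (x - (eigenvalues (sign_gram R w))`_i))).
  by apply: density => //; rewrite u0 uu1.
have k0 : 0 <= K1 * u ^+ 3 by rewrite mulr_ge0 ?ltW.
have := unsmoothing y01 J0 u4 u0 k0 hab dens c.
rewrite -/L -/T.
have -> : b - u ^+ 2 - (a + u ^+ 2) = L - 2 * u ^+ 2 by rewrite /L; ring.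
set N := (Num.truncn _).+1.
have lnN : ln N%:R <= L + 4 / u by apply: grid_size_le; rewrite ?u0 ?(ltW L0).
rewrite (avg_pair (fun (w : {ffun 'I_p -> codeword V}) (i : 'I_p) =>
    (below c (eigenvalues (sign_gram R w))`_i)%:R)).
have -> : avg (fun w : {ffun 'I_p -> codeword V} => avg (fun i : 'I_p =>
    (below c (eigenvalues (sign_gram R w))`_i)%:R)) =
    avg (fun w : {ffun 'I_p -> codeword V} => below_count (sign_gram R w) c).
  by apply: eq_avg => w; rewrite below_countE// sign_gram_sym.
move=> unsm.
have Om0 : (0 < #|{: {ffun 'I_p -> codeword V}}|)%N.
  by rewrite card_ffun expn_gt0 V0.
rewrite -[X in `|X|](subrKA (avg (fun w : {ffun 'I_p -> codeword V} =>
  below_count (sign_gram R w) c))).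
apply: le_trans (ler_normD _ _) _.
have gap : `|avg (fun w : {ffun 'I_p -> codeword V} => below_count (gram R (word_mx w)) c) -
    avg (fun w : {ffun 'I_p -> codeword V} => below_count (sign_gram R w) c)| <=
    2 / y * u ^+ 3.
  rewrite -avgB; apply: norm_avg_le => // w.
  apply: le_trans (below_count_sign w c) _.
  have pE : p%:R = y / u ^+ 12 :> R.
    have nn : n%:R != 0 :> R by rewrite pnatr_eq0 -lt0n.
    have -> : p%:R = y * n%:R :> R by rewrite -pn divfK.
    by rewrite -[n%:R](mulfK (lt0r_neq0 (exprn_gt0 12 u0))) nu mul1r.
  rewrite pE invf_div mulrCA [leLHS]mulrC ler_wpM2l ?divr_ge0 ?(ltW y0)//.
  by rewrite (_ : 12 = 3 + 9)%N// exprD ler_piMr ?(ltW u3)// exprn_ile1// ltW.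
have T1 : 16 * pi * u ^+ 4 * (L / (2 * pi * a * y) + K1 * u ^+ 3) * (1 + ln N%:R) <=
    16 * pi * M * (5 + L) * u ^+ 3.
  have -> : 16 * pi * M * (5 + L) * u ^+ 3 = 16 * pi * (M * ((5 + L) * u ^+ 3)).
    by move: (pi : R) => q; ring.
  have -> : 16 * pi * u ^+ 4 * (L / (2 * pi * a * y) + K1 * u ^+ 3) * (1 + ln N%:R) =
      16 * pi * ((L / (2 * pi * a * y) + K1 * u ^+ 3) * (u ^+ 4 * (1 + ln N%:R))).
    by move: (pi : R) (ln _) => q q'; ring.
  have pi16 : 0 <= 16 * pi :> R by rewrite mulr_ge0// ltW.
  apply: ler_wpM2l => //.
  apply: ler_pM.
  - by rewrite addr_ge0 ?divr_ge0 ?(ltW L0) ?(ltW D0).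
  - by rewrite mulr_ge0 ?(ltW u4)// addr_ge0// ln_ge0// ler1n.
  - by rewrite lerD2l ler_piMr// ltW.
  have -> : (5 + L) * u ^+ 3 = u ^+ 3 * 1 + u ^+ 3 * (L + 4) by ring.
  have : u ^+ 4 * (1 + ln N%:R) <= u ^+ 4 * (1 + (L + 4 / u)).
    by rewrite ler_wpM2l ?(ltW u4)// lerD2l.
  have -> : u ^+ 4 * (1 + (L + 4 / u)) = u ^+ 3 * (u * (1 + L) + 4).
    by field; rewrite gt_eqF.
  move/le_trans; apply; rewrite -mulrDr ler_wpM2l ?(ltW u3)//.
  have : u * (1 + L) <= 1 + L by rewrite ler_piMl//; lra.
  lra.
have -> : K * u ^+ 3 = 2 / y * u ^+ 3 + (6 * (2 * (T * u ^+ 3) + L * (K1 * u ^+ 3)) +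
   16 * pi * M * (5 + L) * u ^+ 3).
  by rewrite /K; move: (pi : R) => q; ring.
by apply: lerD => //; apply: le_trans unsm _; rewrite lerD2l.
Qed.

End ExpectedCount.

(** * From the given probability space to finite averages *)

Section Law.
Variables (R : realType) (d : measure_display) (T : measurableType d).
Variable P : probability T R.

Lemma prob_finite (E : finType) (X : T -> E) (Q : pred E) :
  (forall e, measurable [set w | X w = e]) ->
  P [set w | Q (X w)] = (\sum_(e | Q e) P [set w | X w = e])%E.
Proof.
move=> mX.
have H (s : seq E) : uniq s -> measurable [set w | (X w \in s) && Q (X w)] /\
    P [set w | (X w \in s) && Q (X w)] = (\sum_(e <- s | Q e) P [set w | X w = e])%E.
  elim: s => [_|e s IH /= /andP[es us]].
    rewrite big_nil (_ : [set w | _] = set0); last by apply/seteqP; split.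
    by rewrite measure0.
  have [ms Ps] := IH us; rewrite big_cons; case: ifPn => Qe.
    have -> : [set w | (X w \in e :: s) && Q (X w)] =
        [set w | X w = e] `|` [set w | (X w \in s) && Q (X w)].
      apply/seteqP; split => w /=; rewrite inE.
        by case: eqP => [->|_ /=]; [left|right].
      by case=> [->|/andP[-> ->]]; rewrite ?eqxx ?Qe ?orbT.
    split; first exact: measurableU.
    have I0 : [set w | X w = e] `&` [set w | (X w \in s) && Q (X w)] = set0.
      by apply/seteqP; split => // w [/= ->]; rewrite (negbTE es).
    by rewrite measureU//; congr (_ + _)%E.
  have -> : [set w | (X w \in e :: s) && Q (X w)] =
      [set w | (X w \in s) && Q (X w)]; last by [].
  apply/seteqP; split => w /=; rewrite inE; last by move=> /andP[-> ->]; rewrite orbT.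
  by case: eqP => [->|_ //]; rewrite (negbTE Qe) andbF.
have [_] := H (index_enum E) (index_enum_uniq E).
by under eq_set do rewrite mem_index_enum.
Qed.

(** Independence, applied to all rows and to singletons, gives probability [#|V|^(-p)] to a matrix
    with rows in the code and 0 to any other. Matrices of the first kind correspond to the points of
    the product via [word_mx]. *)
Lemma iid_uniform_rowsE p n (V : {vspace 'rV['F_2]_n}) (Phi : T -> 'M['F_2]_(p, n))
    (Q : pred 'M['F_2]_(p, n)) : iid_uniform_rows P V Phi ->
  P [set w | Q (Phi w)] =
    (avg (fun w : {ffun 'I_p -> codeword V} => (Q (word_mx w))%:R))%:E.
Proof.
move=> [mPhi ind unif]; rewrite prob_finite//.
have PM M : P [set w | Phi w = M] =
    (\prod_i ((row i M \in V)%:R / #|V|%:R))%:E.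
  have := ind [set: 'I_p]%SET (fun i => [set row i M]%SET).
  have -> : [set w | forall i, i \in [set: 'I_p]%SET ->
      row i (Phi w) \in [set row i M]%SET] = [set w | Phi w = M].
    apply/seteqP; split => w /=.
      move=> H; apply/row_matrixP => i; apply/eqP.
      by have := H i; rewrite !inE => ->.
    by move=> -> i _; rewrite inE.
  move=> ->; rewrite (big_morph EFin (@EFinM R) erefl).
  rewrite [LHS](eq_bigl xpredT); last by move=> i; rewrite finset.in_setT.
  apply: eq_bigr => i _; rewrite -(unif i (row i M)); congr (P _).
  by apply/seteqP; split => w /=; [rewrite inE => /eqP|move=> ->; rewrite inE].
under eq_bigr do rewrite PM.
rewrite sumEFin; congr EFin.
(* [c0] is only a default value; on matrices with all rows in the code [h'] inverts [word_mx]. *)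
pose c0 : codeword V := exist _ 0 (mem0v V).
pose h' (M : 'M['F_2]_(p, n)) : {ffun 'I_p -> codeword V} :=
  [ffun i => insubd c0 (row i M)].
rewrite (bigID (fun M : 'M['F_2]_(p, n) => [forall i, row i M \in V]))/=.
rewrite [X in _ + X]big1 ?addr0 => [|M /andP[_ /forallPn[i iV]]]; last first.
  by rewrite (bigD1 i)//= (negbTE iV) mul0r mul0r.
rewrite (reindex_onto (@word_mx p n V) h') /=; last first.
  move=> M /andP[_ /forallP MV]; apply/row_matrixP => i.
  by rewrite rowK ffunE insubdK//; exact: MV.
have inV (w : {ffun 'I_p -> codeword V}) i : row i (word_mx w) \in V.
  by rewrite rowK; exact: (valP (w i)).
have wordP (w : {ffun 'I_p -> codeword V}) : [forall i, row i (word_mx w) \in V].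
  by apply/forallP.
have hK (w : {ffun 'I_p -> codeword V}) : h' (word_mx w) == w.
  apply/eqP/ffunP => i; rewrite ffunE; apply: val_inj.
  by rewrite insubdK; [rewrite rowK|exact: inV].
rewrite /avg mulr_sumr big_mkcond/=; apply: eq_bigr => w _.
rewrite wordP hK !andbT; case: (Q _); last by rewrite mulr0.
rewrite mulr1 card_ffun card_ord card_sig natrX -exprVn.
rewrite (eq_bigr (fun=> #|V|%:R^-1)); first by rewrite prodr_const card_ord.
by move=> i _; rewrite inV mul1r.
Qed.

End Law.

Section SpectralCount.
Variable R : realType.

Lemma spectral_measure_itv p (A : 'M[R]_p) (c1 c2 : itv_bound R) :
  spectral_measure A [set` Interval c1 c2] =
  (if (c1 <= c2)%O then below_count A c2 - below_count A c1 else 0)%:E.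
Proof.
have cE : (\sum_(l <- eigenvalues A) \d_l [set` Interval c1 c2] =
    (count (fun l => l \in Interval c1 c2) (eigenvalues A))%:R%:E :> \bar R)%E.
  elim: (eigenvalues A) => [|l s IH]; first by rewrite big_nil.
  by rewrite big_cons IH diracE /= natrD EFinD mem_setE.
rewrite /spectral_measure cE -EFinM; congr EFin.
have inE' l : (l \in Interval c1 c2) = ~~ below c1 l && below c2 l.
  rewrite itv_boundlr /below; congr (_ && _); rewrite -ltNge.
  by case: c1 {cE} => [[] x|[]]; rewrite !bnd_simp.
rewrite (eq_count inE').
case: ifPn => [c12|]; last first.
  rewrite -ltNge => c21; rewrite (eq_count (a2 := pred0)) ?count_pred0 ?mulr0// => l /=.
  apply/negbTE; rewrite negb_and negbK orbC -implybE.
  by apply/implyP => /le_trans; apply; exact: ltW.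
rewrite /below_count -mulrBl mulrC; congr (_ / _).
have sub l : below c1 l -> below c2 l by move=> /le_trans; exact.
have -> : count (below c2) (eigenvalues A) =
    (count (below c1) (eigenvalues A) +
     count (fun l => ~~ below c1 l && below c2 l) (eigenvalues A))%N.
  elim: (eigenvalues A) => //= l s ->; rewrite addnACA; congr (_ + _)%N.
  by case: (boolP (below c1 l)) => [/sub->|].
by rewrite natrD addrAC subrr add0r.
Qed.

End SpectralCount.

(** * Comparison of growth rates *)

Section Asymptotics.
Variable R : realType.

Lemma powR_unbounded (al B : R) : 0 < al ->
  exists N : nat, forall n : nat, (N < n)%N -> B <= n%:R `^ al.
Proof.
move=> al0; pose B' := Num.max B 0.
have B'0 : 0 <= B' by rewrite le_max lexx orbT.
exists (Num.truncn (B' `^ al^-1)) => n Nn.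
apply: (@le_trans _ _ B'); first by rewrite le_max lexx.
have -> : B' = (B' `^ al^-1) `^ al.
  by rewrite -powRrM mulVf ?gt_eqF// powRr1.
apply: ge0_ler_powR; rewrite ?nnegrE ?powR_ge0 ?(ltW al0)//.
by apply: le_trans (ltW (truncnS_gt _)) _; rewrite ler_nat.
Qed.

(** With [w = n^(1/8)] one has [ln n <= 8 w] and [n^(1/4) = w^2]. Once [w >= 1] and
    [c0 w >= 4 + 8 D], [c0 w^2] exceeds [D ln n] by at least 4, which beats the 1/2 and the
    prefactor [4 <= expR 3]. *)
Lemma exp_tail_lt_powR (c0 D : R) : 0 < c0 -> 0 < D ->
  exists N : nat, forall n : nat, (N < n)%N ->
    4 * expR (2^-1 - c0 * n%:R `^ 4^-1) < n%:R `^ (- D).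
Proof.
move=> c00 D0.
have [N HN] := powR_unbounded (al := 8^-1) (Num.max 1 ((4 + 8 * D) / c0)) ltac:(by []).
exists N => n Nn; have := HN n Nn; rewrite ge_max => /andP[w1 wD].
set w := n%:R `^ 8^-1 in w1 wD.
have n0 : 0 < n%:R :> R by rewrite ltr0n (leq_ltn_trans _ Nn).
have w2 : n%:R `^ 4^-1 = w ^+ 2.
  by rewrite /w -powR_mulrn ?powR_ge0// -powRrM; congr (_ `^ _); field.
have lnw : ln n%:R <= 8 * w.
  have : ln w <= w.
    have : ln (1 + (w - 1)) <= w - 1 by apply: le_ln1Dx; lra.
    by rewrite addrCA subrr addr0; lra.
  by rewrite /w ln_powR -/w; lra.
have four : 4 <= expR 3 :> R by apply: le_trans (expR_ge1Dx 3); lra.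
apply: (@le_lt_trans _ _ (expR 3 * expR (2^-1 - c0 * n%:R `^ 4^-1))).
  by rewrite ler_wpM2r// expR_ge0.
have -> : n%:R `^ (- D) = expR (- D * ln n%:R) by rewrite /powR gt_eqF.
rewrite -expRD ltr_expR w2.
have : (4 + 8 * D) * w <= c0 * w ^+ 2.
  move: wD; rewrite ler_pdivrMr// => wD.
  by rewrite expr2 mulrA ler_wpM2r ?[c0 * w]mulrC//; lra.
have : D * ln n%:R <= D * (8 * w) by rewrite ler_wpM2l// ltW.
lra.
Qed.

(** With differences [2 / p], the choice [t = sqrt p / 4] makes the quadratic term [2 p (t c)^2]
    equal to 1/2. For [s] of order [n^(-1/4)] and [p] proportional to [n], the linear term is of
    order [n^(1/4)]. *)
Lemma below_count_concentration p n (V : {vspace 'rV['F_2]_n}) (c : itv_bound R) (s : R)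
    (f := fun w : {ffun 'I_p -> codeword V} => below_count (gram R (word_mx w)) c) :
  (0 < p)%N ->
  avg (fun w => (s < `|f w - avg f|)%R%:R) <= 2 * expR (2^-1 - Num.sqrt p%:R * s / 4).
Proof.
move=> p0; have pR : 0 < p%:R :> R by rewrite ltr0n.
set q := Num.sqrt p%:R; have q0 : 0 < q by rewrite sqrtr_gt0.
have qq : p%:R = q ^+ 2 by rewrite sqr_sqrtr// ltW.
have q1 : 1 <= q by rewrite -(@ler_pXn2r _ 2) ?nnegrE ?(ltW q0)// expr1n -qq ler1n.
have tc : q / 4 * (2 / p%:R) = 2^-1 / q by rewrite qq; field; rewrite gt_eqF.
have tc_le : q / 4 * (2 / p%:R) <= 2^-1.
  by rewrite tc ler_pdivrMr// ler_peMr.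
have t0 : 0 <= q / 4 by rewrite divr_ge0// ltW.
apply: le_trans (concentration s (codeword_gt0 V) t0 tc_le
  (@below_count_bounded_diff R p n V c)) _.
rewrite ler_wpM2l// ler_expR card_ord tc qq.
rewrite le_eqVlt; apply/orP; left; apply/eqP; field.
by rewrite gt_eqF.
Qed.

End Asymptotics.

Theorem theorem2 (R : realType) (y : R) (hy : 0 < y < 1)
  (C : forall n : nat, {vspace 'rV['F_2]_n})
  (p : nat -> nat)
  (hp : forall n : nat, admissible_length y n ->
     (0 < p n)%N /\ (p n)%:R / n%:R = y)
  (d : nat -> measure_display)
  (T : forall n : nat, measurableType (d n))
  (P : forall n : nat, probability (T n) R)
  (Phi : forall n : nat, T n -> 'M['F_2]_(p n, n))
  (hPhi : forall n : nat, admissible_length y n ->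
      iid_uniform_rows (P n) (C n) (@Phi n))
  (hdual : forall n : nat, admissible_length y n ->
     (5%:E <= dual_distance R (C n))%E) :
  forall eps D : R, 0 < eps -> 0 < D ->
  exists N : nat, forall n : nat, admissible_length y n -> (N < n)%N ->
  forall I : interval R,
    (P n [set w | ((n%:R `^ (eps - 4^-1))%:E <
                   `|spectral_measure (gram R (Phi n w)) [set` I]
                     - marchenko_pastur y [set` I]|)%E]
     < (n%:R `^ (- D))%:E)%E.
Proof.
move=> eps D eps0 D0; have [y0 y1] := andP hy.
have [K [u0 [K0 u00 expected]]] := expected_count hy.
(* The exponent at [s / 4] is [sqrt (y n) (s / 4) / 4 = (sqrt y / 16) n^(1/2) s], and
   [n^(1/2) s >= n^(1/4)]. *)
have c00 : 0 < Num.sqrt y / 16 by rewrite divr_gt0// sqrtr_gt0.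
(* [n^eps >= 4 K] makes the bias [K u^3 = K n^(-1/4)] at most [s / 4]; the next threshold ensures
   [u = n^(-1/12) <= u0]. All thresholds are fixed before the interval appears. *)
have [N1 HN1] := powR_unbounded (4 * K) eps0.
have [N2 HN2] := powR_unbounded (al := 12^-1) u0^-1 ltac:(by []).
have [N3 HN3] := exp_tail_lt_powR c00 D0.
exists (maxn N1 (maxn N2 N3)) => n adm; rewrite !gtn_max => /and3P[/HN1 nK /HN2 nu /HN3 nD].
move=> [c1 c2].
have [p0 pn] := hp n adm; have [n0 _] := adm.
have nR : 0 < n%:R :> R by rewrite ltr0n.
have n1 : 1 <= n%:R :> R by rewrite ler1n.
set s := n%:R `^ (eps - 4^-1).
have s0 : 0 <= s := powR_ge0 _ _.
pose u : R := n%:R `^ (- 12^-1).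
have up : 0 < u by rewrite powR_gt0.
have uu0 : u <= u0.
  by rewrite /u powRN -[u0]invrK lef_pV2// posrE ?powR_gt0// invr_gt0.
have u12 : n%:R * u ^+ 12 = 1.
  rewrite /u -powR_mulrn ?powR_ge0// -powRrM mulNr mulVf// powR_inv1 ?ltW//.
  by rewrite divff// gt_eqF.
have u3 : K * u ^+ 3 <= s / 4.
  have -> : s = n%:R `^ eps * u ^+ 3.
    rewrite /s /u -powR_mulrn ?powR_ge0// -powRrM -powRD; last first.
      by rewrite (gt_eqF nR) implybT.
    by congr (_ `^ _); field.
  have : 0 < u ^+ 3 by rewrite exprn_gt0.
  by move: nK; nra.
pose bc c (w : {ffun 'I_(p n) -> codeword (C n)}) := below_count (gram R (word_mx w)) c.
have close c : `|avg (bc c) - mp_bound_cdf y c| <= s / 4.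
  apply: le_trans u3; apply: expected => //; first exact: hdual.
  by rewrite up uu0.
pose Q (M : 'M['F_2]_(p n, n)) := (s%:E <
    `|spectral_measure (gram R M) [set` Interval c1 c2]
      - marchenko_pastur y [set` Interval c1 c2]|)%E.
rewrite (iid_uniform_rowsE Q (hPhi n adm)) lte_fin.
apply: le_lt_trans nD.
(* [s] is spent in four quarters: bias and fluctuation at each of the two ends. *)
have tailQ w : (Q (word_mx w))%:R <=
    (s / 4 < `|bc c1 w - avg (bc c1)|)%R%:R +
    (s / 4 < `|bc c2 w - avg (bc c2)|)%R%:R :> R.
  case: (boolP (Q _)) => [|_]; last by rewrite addr_ge0.
  rewrite /Q spectral_measure_itv (marchenko_pastur_itv hy) -EFinB abse_EFin lte_fin.
  (* Both formulas carry the same test on the ends; when it fails, both measures are 0. *)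
  case: ifP => _; last by rewrite subrr normr0 ltNge s0.
  rewrite -/(bc c1 w) -/(bc c2 w) => sQ.
  have [A1|A1] := ltP (s / 4) `|bc c1 w - avg (bc c1)|; first by rewrite lerDl.
  have [A2|A2] := ltP (s / 4) `|bc c2 w - avg (bc c2)|; first by rewrite lerDr.
  exfalso; move: sQ; apply/negP; rewrite -leNgt.
  have -> : bc c2 w - bc c1 w - (mp_bound_cdf y c2 - mp_bound_cdf y c1) =
      ((bc c2 w - avg (bc c2)) + (avg (bc c2) - mp_bound_cdf y c2)) -
      ((bc c1 w - avg (bc c1)) + (avg (bc c1) - mp_bound_cdf y c1)) by ring.
  apply: le_trans (ler_normB _ _) _.
  have -> : s = (s / 4 + s / 4) + (s / 4 + s / 4) by field.
  by apply: lerD; apply: le_trans (ler_normD _ _) _; apply: lerD.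
apply: le_trans (le_avg tailQ) _; rewrite avgD.
apply: le_trans (lerD (below_count_concentration _ c1 (s / 4) p0)
  (below_count_concentration _ c2 (s / 4) p0)) _.
have expo : Num.sqrt y / 16 * n%:R `^ 4^-1 <= Num.sqrt (p n)%:R * (s / 4) / 4.
  have pE : (p n)%:R = y * n%:R :> R by rewrite -pn divfK// gt_eqF.
  rewrite pE sqrtrM ?(ltW y0)// -(powR12_sqrt (ltW nR)).
  have -> : Num.sqrt y * n%:R `^ 2^-1 * (s / 4) / 4 =
      Num.sqrt y / 16 * (n%:R `^ 2^-1 * s) by field.
  rewrite ler_wpM2l ?(ltW c00)// /s -powRD; last by rewrite (gt_eqF nR) implybT.
  by apply: ler_powR => //; lra.
rewrite -mulrDl (_ : 2 + 2 = 4)//; last by ring.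
by rewrite ler_wpM2l// ler_expR lerD2l lerN2.
Qed.
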